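(* Let $(X,\mu,T)$ be a nonsingular one-sided Markov shift, where $\mu$ is determined by $(\lambda,(P^{(n)})_{n\ge1})$. Let $\mathcal S_T$ be the tail equivalence relation on $X=\{0,1\}^{\mathbb N}$, and let $\delta:\mathcal S_T\to\mathbb R^*_+$ be the cocycle $\delta(x,y)=\prod_{i=1}^\infty Q_{y_i,y_{i+1}}/Q_{x_i,x_{i+1}}$, where $Q_{i,j}=\frac{\lambda(i)P^{(1)}_{i,j}}{\lambda(0)P^{(1)}_{0,j}+\lambda(1)P^{(1)}_{1,j}}$. If the cocycle $\Delta_{\mathcal S_T,\mu}/\delta$ of $\mathcal S_T$ is ergodic, then the Maharam extension of the natural extension $(\widetilde X,\widetilde\mu,\widetilde T)$ of $T$ is a $K$-automorphism. If, moreover, $\widetilde T$ is conservative, then $\widetilde T$ is weakly mixing and of type $III_1$.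
   Context: Markov measure: for a probability $\lambda$ on $\{0,1\}$ and stochastic $2\times2$ matrices $P^{(n)}$, $\mu$ is the Borel probability on $X=\{0,1\}^{\mathbb N}$ with $\mu(\{x_1=a_1,\dots,x_k=a_k\})=\lambda(a_1)P^{(1)}_{a_1,a_2}\cdots P^{(k-1)}_{a_{k-1},a_k}$. It is non-degenerate if $\lambda(a)>0$, $P^{(n)}_{a,b}>0$ for all $a,b,n$. A nonsingular one-sided Markov shift is $(X,\mu,T)$ with $(Tx)_n=x_{n+1}$, $\mu$ a non-degenerate non-atomic Markov measure, and $\mu\circ T^{-1}\sim\mu$. Two points are tail equivalent ($(x,y)\in\mathcal S_T$) if $T^nx=T^ny$ for some $n\ge 0$. For a countable $\nu$-nonsingular equivalence relation $\mathcal S$ on $(Y,\nu)$ generated by a countable group $\Gamma$ of Borel bijections, the Radon-Nikodym cocycle is $\Delta_{\mathcal S,\nu}(y,\gamma y)=\frac{d\nu\circ\gamma}{d\nu}(y)$. A cocycle $\alpha:\mathcal S\to\mathbb R^*_+$ is ergodic if the equivalence relation $(y,g)\sim(y',\alpha(y,y')g)$, $(y,y')\in\mathcal S$, on $Y\times\mathbb R^*_+$ (with $\nu$ times Haar measure) is ergodic. Natural extension: $\widetilde T$ is the two-sided shift on $\widetilde X=\{0,1\}^{\mathbb Z}$ with the measure $\widetilde\mu(\{x_i=a_i,-n\le i\le n\})=\big(\prod_{-n<i\le1}Q_{a_{i-1},a_i}\big)\lambda(a_1)\prod_{1\le i<n}P^{(i)}_{a_i,a_{i+1}}$; $\widetilde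 T$ is $\widetilde\mu$-nonsingular. For an invertible nonsingular transformation $R$ of a $\sigma$-finite standard space $(Y,\mathfrak C,\nu)$: conservative means that for each $A$ with $\nu(A)>0$ there is $n>0$ with $\nu(R^{-n}A\cap A)>0$. Put $\omega_{R,\nu}=d(\nu\circ R)/d\nu$. The Maharam extension is $(y,t)\mapsto(Ry,\omega_{R,\nu}(y)t)$ on $(Y\times\mathbb R^*_+,\nu\times\kappa)$, where $\kappa\sim$ Lebesgue and $\kappa(aB)=a^{-1}\kappa(B)$. $R$ is of type $III_1$ if its Maharam extension is ergodic. $R$ is a $K$-automorphism if there is a sub-$\sigma$-algebra $\mathfrak F\subset\mathfrak C$ on which $\nu$ is $\sigma$-finite with $R^{-1}\mathfrak F\subset\mathfrak F$, $\omega_{R,\nu}$ $\mathfrak F$-measurable, $\bigvee_{n>0}R^n\mathfrak F=\mathfrak C$ and $\bigcap_{n>0}R^{-n}\mathfrak F$ trivial (mod $\nu$). $R$ is weakly mixing if $R\times S$ is ergodic for every ergodic probability preserving $S$. *)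

(* Defs.v *)
From HB Require Import structures.
From mathcomp Require Import all_boot all_order all_algebra.
From mathcomp Require Import all_classical all_reals all_analysis.
Import Order.TTheory GRing.Theory Num.Theory.
Import numFieldNormedType.Exports.

Set Implicit Arguments.
Unset Strict Implicit.
Unset Printing Implicit Defensive.

Local Open Scope classical_set_scope.
Local Open Scope ring_scope.

Definition Rpos (R : realType) : Type := {posnum R}.

HB.instance Definition _ (R : realType) := Choice.on (Rpos R).
HB.instance Definition _ (R : realType) :=
  isPointed.Build (Rpos R) (1%:pos : {posnum R}).

Definition Rpos_val (R : realType) (t : Rpos R) : R := (t : {posnum R})%:num.

(* The Borel sigma-algebra of ]0, +oo[, as the trace of that of R. *)
HB.instance Definition _ (R : realType) :=
  Measurable.copy (Rpos R) (g_sigma_algebra_preimageType (@Rpos_val R)).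

Definition Rpos_mul (R : realType) (s t : Rpos R) : Rpos R :=
  (((s : {posnum R})%:num * (t : {posnum R})%:num)%:pos : {posnum R}).

Definition dilate (R : realType) (a : Rpos R) (B : set (Rpos R)) :
  set (Rpos R) := Rpos_mul a @` B.

Section measures.
Context d (Y : measurableType d) (R : realType).
Local Open Scope ereal_scope.

Definition measure_equiv (m1 m2 : set Y -> \bar R) : Prop :=
  m1 `<< m2 /\ m2 `<< m1.

Definition null_or_conull (m : set Y -> \bar R) (A : set Y) : Prop :=
  m A = 0 \/ m (~` A) = 0.

Definition non_atomic (m : set Y -> \bar R) : Prop :=
  forall A, measurable A -> 0 < m A ->
    exists B, [/\ measurable B, B `<=` A, 0 < m B & m B < m A].

(* [w] is a version of dm'/dm.  Values are in ]0, +oo[ because only equivalent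
   measures are compared; m' and m may be infinite, so that ['d m' '/d m] of
   the library (whose first argument is a finite charge) does not apply. *)
Definition is_RN_derivative (m' m : set Y -> \bar R) (w : Y -> Rpos R) : Prop :=
  measurable_fun setT w /\
  forall A, measurable A -> m' A = \int[m]_(y in A) (Rpos_val (w y))%:E.

End measures.

Section positive_reals.
Context (R : realType).
Local Open Scope ereal_scope.

Definition is_haar (chi : set (Rpos R) -> \bar R) : Prop :=
  [/\ forall a B, measurable B -> chi (dilate a B) = chi B,
      forall a b : R, (0 < a)%R ->
        chi [set t | (a <= Rpos_val t <= b)%R] < +oo &
      chi setT != 0].

(* Up to a positive factor, the only such sigma-finite measure is t^-2 dt. *)
Definition is_maharam_fiber (kappa : set (Rpos R) -> \bar R) : Prop :=
  measure_equiv kappa (fun B => lebesgue_measure (@Rpos_val R @` B)) /\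
  forall a B, measurable B ->
    kappa (dilate a B) = ((Rpos_val a)^-1)%:E * kappa B.

End positive_reals.

Section transformations.
Context d (Y : measurableType d) (R : realType).
Implicit Types (nu : {measure set Y -> \bar R}) (T : Y -> Y).
Local Open Scope ereal_scope.

(* The set function nu o T, for an invertible T. *)
Definition direct_image nu T : set Y -> \bar R := fun A => nu (T @` A).

Definition invertible_nonsingular nu T : Prop :=
  [/\ bijective T,
      measurable_fun setT T,
      forall A, measurable A -> measurable (T @` A) &
      measure_equiv (direct_image nu T) nu].

Definition ergodic nu T : Prop :=
  forall A, measurable A -> T @^-1` A = A -> null_or_conull nu A.

Definition conservative nu T : Prop :=
  forall A, measurable A -> 0 < nu A ->
    exists n, (0 < n)%N /\ 0 < nu (iter n T @^-1` A `&` A).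

(* A fixed version of d(nu o T)/dnu; versions agree nu-almost everywhere. *)
Definition omega nu T : Y -> Rpos R :=
  xget (fun=> point) [set w | is_RN_derivative (direct_image nu T) nu w].

Definition maharam nu T : Y * Rpos R -> Y * Rpos R :=
  fun p => (T p.1, Rpos_mul (omega nu T p.1) p.2).

(* The requirement on the Radon-Nikodym derivative and the equality with the
   whole sigma-algebra are understood mod nu. *)
Definition K_automorphism nu T : Prop :=
  invertible_nonsingular nu T /\
  exists F : set (set Y),
    [/\ sigma_algebra setT F /\ F `<=` measurable,
        exists E : (set Y)^nat,
          (forall k, F (E k) /\ nu (E k) < +oo) /\ \bigcup_k E k = setT,
        forall A, F A -> F (T @^-1` A),
        exists w, is_RN_derivative (direct_image nu T) nu w /\
          forall B, measurable B -> F (w @^-1` B) &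
        (forall C, measurable C ->
           exists2 B, <<s \bigcup_(n in [set n | (0 < n)%N])
                            [set iter n T @` A | A in F] >> B &
             nu (C `\` B) = 0 /\ nu (B `\` C) = 0) /\
        (forall A, (\bigcap_(n in [set n | (0 < n)%N])
                      [set iter n T @^-1` B | B in F]) A ->
           null_or_conull nu A)].

End transformations.

Section mixing_and_type.
Context d (Y : measurableType d) (R : realType).
Implicit Types (nu : {measure set Y -> \bar R}) (T : Y -> Y).
Local Open Scope ereal_scope.

Definition weakly_mixing nu T : Prop :=
  forall d' (Z : measurableType d') (rho : probability Z R) (S : Z -> Z),
    measurable_fun setT S ->
    (forall A, measurable A -> rho (S @^-1` A) = rho A) ->
    ergodic rho S ->
    ergodic (nu \x rho) (fun p : Y * Z => (T p.1, S p.2)).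

Definition type_III1 (kappa : {sigma_finite_measure set (Rpos R) -> \bar R})
    nu T : Prop :=
  invertible_nonsingular nu T /\ ergodic (nu \x kappa) (maharam nu T).

End mixing_and_type.

Section relations.
Context d (Y : measurableType d) (R : realType).
Implicit Types (nu : {measure set Y -> \bar R}) (S : Y -> Y -> Prop).
Local Open Scope ereal_scope.

Definition relation_ergodic nu S : Prop :=
  forall A, measurable A -> (forall y y', S y y' -> A y -> A y') ->
    null_or_conull nu A.

(* A countable group of Borel bijections, under composition. *)
Definition countable_borel_group (G : set (Y -> Y)) : Prop :=
  [/\ countable G,
      G id,
      forall f g, G f -> G g -> G (f \o g),
      forall f, G f -> exists2 g, G g & cancel f g /\ cancel g f &
      forall f, G f -> measurable_fun setT f].

Definition is_cocycle S (D : Y -> Y -> Rpos R) : Prop :=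
  forall x y z, S x y -> S y z -> D x z = Rpos_mul (D x y) (D y z).

(* [D] is a version of the Radon-Nikodym cocycle of (S, nu); its values outside
   of S are irrelevant, and two versions agree above a conull S-invariant
   set. *)
Definition is_RN_cocycle S nu (D : Y -> Y -> Rpos R) : Prop :=
  is_cocycle S D /\
  exists G : set (Y -> Y),
    [/\ countable_borel_group G,
        forall y y', S y y' <-> exists2 g, G g & y' = g y,
        forall g, G g -> measure_equiv (direct_image nu g) nu &
        forall g, G g ->
          is_RN_derivative (direct_image nu g) nu (fun y => D y (g y))].

End relations.

Section cocycle_ergodicity.
Context d (Y : measurableType d) (R : realType).

(* [chi] is meant to be a Haar measure of the positive reals and [a] to be
   positive on S. *)
Definition cocycle_ergodic (chi : {sigma_finite_measure set (Rpos R) -> \bar R})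
    (nu : {measure set Y -> \bar R}) (S : Y -> Y -> Prop) (a : Y -> Y -> R) :
    Prop :=
  relation_ergodic (nu \x chi)%E
    (fun p q : Y * Rpos R =>
       S p.1 q.1 /\ Rpos_val q.2 = a p.1 q.1 * Rpos_val p.2).

End cocycle_ergodicity.

(* I -> bool with the Borel sigma-algebra of the product topology. *)
Definition bitspace (I : Type) : Type :=
  g_sigma_algebraType (@open {ptws I -> bool}).
HB.instance Definition _ (I : Type) := Measurable.on (bitspace I).

(* One-sided sequences are numbered from 1 in the mathematics: [x n] stands for
   the coordinate x_(n+1). *)
Definition shift1 (x : bitspace nat) : bitspace nat := fun n => x n.+1.
Definition shift2 (x : bitspace int) : bitspace int := fun i => x (i + 1).

Definition tail_equivalent (X : Type) (T : X -> X) (x y : X) : Prop :=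
  exists n, iter n T x = iter n T y.

Section markov.
Context (R : realType).
Implicit Types (lam : bool -> R) (P : nat -> bool -> bool -> R).

Definition prob_vector lam : Prop :=
  (forall a, 0 <= lam a) /\ \sum_(a : bool) lam a = 1.

Definition stochastic (M : bool -> bool -> R) : Prop :=
  forall a, prob_vector (M a).

(* [P n] stands for P^(n+1), the transition from [x n] to [x n.+1]. *)
Definition markov_measure lam P (mu : set (bitspace nat) -> \bar R) : Prop :=
  forall (k : nat) (a : nat -> bool),
    mu [set x | forall i, (i <= k)%N -> x i = a i] =
    (lam (a 0%N) * \prod_(0 <= i < k) P i (a i) (a i.+1))%:E.

Definition non_degenerate lam P : Prop :=
  (forall a, 0 < lam a) /\ (forall n a b, 0 < P n a b).

Definition nonsingular_markov_shift lam P (mu : probability (bitspace nat) R) :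
    Prop :=
  [/\ prob_vector lam /\ (forall n, stochastic (P n)),
      markov_measure lam P mu,
      non_degenerate lam P,
      non_atomic mu &
      measure_equiv (fun A => mu (shift1 @^-1` A)) mu].

Definition Qmx lam P (i j : bool) : R :=
  lam i * P 0%N i j / (lam false * P 0%N false j + lam true * P 0%N true j).

(* The measure of the natural extension; coordinates of [int -> bool] are not
   renumbered, and the first product runs over -n < i <= 1 as i = 1 - k. *)
Definition natural_extension_measure lam P
    (mut : set (bitspace int) -> \bar R) : Prop :=
  forall (n : nat) (a : int -> bool), (0 < n)%N ->
    mut [set x | forall i : int, - n%:Z <= i <= n%:Z -> x i = a i] =
    ((\prod_(0 <= k < n.+1) Qmx lam P (a (1 - k%:Z - 1)) (a (1 - k%:Z))) *
     lam (a 1) *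
     \prod_(1 <= i < n) P i.-1 (a i%:Z) (a (i%:Z + 1)))%:E.

(* For tail equivalent x and y the partial products are eventually constant. *)
Definition delta_cocycle lam P (x y : bitspace nat) : R :=
  limn (fun n : nat =>
    \prod_(0 <= i < n)
      (Qmx lam P (y i) (y i.+1) / Qmx lam P (x i) (x i.+1)) : R).

End markov.

(* Main.v *)
(* The density of the two-sided shift depends on the future (x_1, x_2, ...) of
   a point only.  Hence its Maharam extension S, which preserves the product
   measure, has as a factor the skew product T0 of the one-sided shift by the
   same density, and the sets depending on the future generate everything under
   S.  Two points (x, t) and (y, s) have the same image under some power of T0
   iff T^n x = T^n y for some n and s / t is the quotient of the Jacobians of T^n
   at x and y; that quotient is (Delta / delta)(x, y), by a change of variables
   on the cylinders of length n.  So the tail sets of T0 are the sets invariant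
   under the relation assumed to be ergodic, T0 is exact, and S is a
   K-automorphism.
   If the shift is conservative, so is S: in a wandering set, almost every orbit
   of the shift would have a last point where the density along the orbit is
   largest, and those points form a wandering set.  Finally, let U be an ergodic
   probability preserving map and A be a set invariant under S x U.  It can be
   approximated by sets whose images under a power of S x U depend on the future
   and the second coordinate only.  Were A itself not such a set, the error of
   approximation would be bounded below on a set E of futures, and recurrence
   to E would keep the same bound for every power.  So A comes from T0 x U, and
   its sections are tail sets of T0, hence null or conull.  Type III_1 is
   the case of a one-point U; weak mixing follows as the shift is a factor of
   S. *)
From HB Require Import structures.
Require Import Defs.
From mathcomp Require Import all_boot all_order all_algebra.
From mathcomp Require Import all_classical all_reals all_analysis.
From mathcomp Require Import measurable_realfun simple_functions.
From mathcomp Require Import ring lra zify.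
Import Order.TTheory GRing.Theory Num.Theory.
Import numFieldNormedType.Exports.
Local Open Scope classical_set_scope.
Local Open Scope ring_scope.

Set Implicit Arguments.
Unset Strict Implicit.
Unset Printing Implicit Defensive.

(** * Almost everywhere *)

(** Many identities below hold only modulo null sets, and this shapes the constructions. The Maharam
    extension is built from an arbitrary version [omega] of the density, so it covers the one-sided
    skew product only almost everywhere; the sigma-algebra witnessing the K-property therefore
    consists of the sets that agree almost everywhere with a pullback. Conversely, ergodicity is a
    statement on strictly invariant sets: a tail set is first replaced by the intersection of its
    preimages under the lifts of the countable group generating the tail relation, and an almost
    invariant set by a limsup of preimages. The hypothesis is stated with [chi] and the conclusion
    with [kappa]; Fubini on the product of two half-lines compares their null sets. A quantitative
    form of this argument shows that [kappa] is finite on [c, +oo[, which its scaling and its null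
    sets do not display. Conservativity rests on this finiteness, through Borel-Cantelli: almost
    every point of a wandering set visits a given set of finite measure only finitely often. *)

Section almost_everywhere.
Context d d' (X : measurableType d) (Y : measurableType d') (R : realType).
Local Open Scope ereal_scope.

(** The half of nonsingularity that pulls almost everywhere statements back along [f]. Source and
    target may differ, so it also covers factor maps. *)
Definition nonsingular (m : set X -> \bar R) (m' : set Y -> \bar R)
    (f : X -> Y) : Prop :=
  measurable_fun setT f /\
  forall N, measurable N -> m' N = 0 -> m (f @^-1` N) = 0.

Lemma nonsingular_ae (m : {measure set X -> \bar R})
    (m' : {measure set Y -> \bar R}) f (P : Y -> Prop) :
  nonsingular m m' f -> {ae m', forall y, P y} -> {ae m, forall x, P (f x)}.
Proof.
move=> [mf f0] [N [mN N0 PN]]; exists (f @^-1` N); split.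
- by rewrite -[X in measurable X]setTI; exact: mf.
- exact: f0.
- by move=> x /= Px; apply: PN.
Qed.

End almost_everywhere.

Section ae_measure.
Context d (X : measurableType d) (R : realType).
Implicit Types (m : {measure set X -> \bar R}).
Local Open Scope ereal_scope.

Lemma ae_measure0 m A : measurable A ->
  {ae m, forall x, ~ A x} <-> m A = 0.
Proof.
move=> mA; rewrite -(negligibleP m mA) /almost_everywhere.
by rewrite /prop_near1/= /nbhs/= /almost_everywhere (_ : ~` _ = A)//;
  apply/seteqP; split => x /=; rewrite not_notE.
Qed.

Lemma ae_measureC0 m A : measurable A ->
  {ae m, forall x, A x} <-> m (~` A) = 0.
Proof.
move=> mA; rewrite -(@ae_measure0 m (~` A)); last exact: measurableC.
by split; apply: filterS => x /=; rewrite not_notE.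
Qed.

Lemma null_or_conullP m A : measurable A ->
  null_or_conull m A <->
  {ae m, forall x, ~ A x} \/ {ae m, forall x, A x}.
Proof.
by move=> mA; rewrite (ae_measure0 m mA) (ae_measureC0 m mA).
Qed.

Lemma measure_ae m A B : measurable A -> measurable B ->
  {ae m, forall x, A x = B x} -> m A = m B.
Proof.
move=> mA mB AB; rewrite -[A]setIT -[B]setIT -!integral_indic//.
apply: ae_eq_integral => //.
- exact/measurable_EFinP/measurable_indic.
- exact/measurable_EFinP/measurable_indic.
- by move: AB; apply: filterS => x ABx _; rewrite !indicE /in_mem/= /in_set ABx.
Qed.

Lemma measure_bigcup0 m (F : (set X)^nat) : (forall n, measurable (F n)) ->
  (forall n, m (F n) = 0) -> m (\bigcup_n F n) = 0.
Proof.
move=> mF F0; apply/negligibleP; first exact: bigcupT_measurable.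
by apply: negligible_bigcup => n; apply/(negligibleP m (mF n)); exact: F0.
Qed.

Lemma nonsingular_id m : nonsingular m m id.
Proof. by split. Qed.

End ae_measure.

Lemma nonsingular_comp d d' d'' (X : measurableType d) (Y : measurableType d')
    (Z : measurableType d'') (R : realType) (m : set X -> \bar R)
    (m' : set Y -> \bar R) (m'' : set Z -> \bar R) f g :
  nonsingular m m' f -> nonsingular m' m'' g -> nonsingular m m'' (g \o f).
Proof.
move=> [mf f0] [mg g0]; split; first exact: measurableT_comp.
move=> N mN N0; rewrite comp_preimage; apply: f0; last exact: g0.
by rewrite -[X in measurable X]setTI; exact: mg.
Qed.

Lemma nonsingular_iter d (X : measurableType d) (R : realType)
    (m : {measure set X -> \bar R}) (f : X -> X) n :
  nonsingular m m f -> nonsingular m m (iter n f).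
Proof.
move=> nf; elim: n => [|n IH]; first exact: nonsingular_id.
exact: (nonsingular_comp IH nf).
Qed.

Lemma iter_intertwine_ae d d' (X : measurableType d) (Y : measurableType d')
    (R : realType) (m : {measure set X -> \bar R}) (f : X -> X) (g : Y -> Y)
    (p : X -> Y) :
  nonsingular m m f -> {ae m, forall x, p (f x) = g (p x)} ->
  forall n, {ae m, forall x, p (iter n f x) = iter n g (p x)}.
Proof.
move=> nf pfg; elim=> [|n IH]; first exact: aeW.
have /(nonsingular_ae (nonsingular_iter n nf)) := pfg.
by move: IH; apply: filterS2 => x IH /= ->; rewrite IH.
Qed.

Section ae_product.
Context d1 d2 (X1 : measurableType d1) (X2 : measurableType d2) (R : realType).
Context (m1 : {sigma_finite_measure set X1 -> \bar R})
        (m2 : {sigma_finite_measure set X2 -> \bar R}).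
Local Open Scope ereal_scope.

(** The product measure integrates the measures of the sections, and a nonnegative function has
    integral zero iff it vanishes almost everywhere. *)
Lemma product_measure0E (N : set (X1 * X2)) : measurable N ->
  (m1 \x m2) N = 0 <-> {ae m1, forall x, m2 (xsection N x) = 0}.
Proof.
move=> mN; rewrite /product_measure1; split => [N0|N0].
  have := ae_eq_integral_abs m1 measurableT
    (measurable_fun_xsection m2 mN).
  move=> [+ _]; rewrite (_ : (\int[m1]_(x in _) _) = 0).
    by move=> /(_ erefl); apply: filterS => x; apply.
  rewrite -[RHS]N0; apply: eq_integral => x _.
  by rewrite gee0_abs.
rewrite (ae_eq_integral (cst 0)) ?integral0//.
- exact: measurable_fun_xsection.
- by move: N0; apply: filterS.
Qed.

Lemma ae_prodP (P : X1 * X2 -> Prop) : measurable [set p | P p] ->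
  {ae m1, forall x, {ae m2, forall y, P (x, y)}} ->
  {ae (m1 \x m2), forall p, P p}.
Proof.
move=> mP H; apply/(ae_measureC0 (m1 \x m2) mP).
apply/product_measure0E; first exact: measurableC.
move: H; apply: filterS => x Hx.
apply/ae_measure0; first by apply: measurable_xsection; exact: measurableC.
by move: Hx; apply: filterS => y Pxy /xsectionP; exact.
Qed.

Lemma product_measure0EC (N : set (X1 * X2)) : measurable N ->
  (m1 \x m2) N = 0 <-> {ae m2, forall y, m1 (ysection N y) = 0}.
Proof.
(* Uniqueness of the product measure exchanges the order of integration. *)
move=> mN; rewrite (_ : (m1 \x m2) N = (m1 \x^ m2) N); last first.
  by apply: product_measure_unique => //= A B mA mB; rewrite product_measure2E.
rewrite /product_measure2; split => [N0|N0].
  have := ae_eq_integral_abs m2 measurableT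
    (measurable_fun_ysection m1 mN).
  move=> [+ _]; rewrite (_ : (\int[m2]_(x in _) _) = 0).
    by move=> /(_ erefl); apply: filterS => x; apply.
  rewrite -[RHS]N0; apply: eq_integral => x _.
  by rewrite gee0_abs.
rewrite (ae_eq_integral (cst 0)) ?integral0//.
- exact: measurable_fun_ysection.
- by move: N0; apply: filterS.
Qed.

Lemma ae_prodCW (P : X1 * X2 -> Prop) :
  {ae (m1 \x m2), forall p, P p} ->
  {ae m2, forall y, {ae m1, forall x, P (x, y)}}.
Proof.
move=> [N [mN /product_measure0EC N0 PN]].
move: (N0 mN); apply: filterS => y Ny0; exists (ysection N y); split => //.
- exact: measurable_ysection.
- by move=> x /= Px; apply/ysectionP; apply: PN.
Qed.

Lemma ae_prodCP (P : X1 * X2 -> Prop) : measurable [set p | P p] ->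
  {ae m2, forall y, {ae m1, forall x, P (x, y)}} ->
  {ae (m1 \x m2), forall p, P p}.
Proof.
move=> mP H; apply/(ae_measureC0 (m1 \x m2) mP).
apply/product_measure0EC; first exact: measurableC.
move: H; apply: filterS => y Hy.
apply/ae_measure0; first by apply: measurable_ysection; exact: measurableC.
by move: Hy; apply: filterS => x Pxy /ysectionP; exact.
Qed.

End ae_product.

(** * Sequences of bits *)

Lemma bigcup_countType_measurable d (X : measurableType d) (J : countType)
    (D : set J) (F : J -> set X) :
  (forall j, D j -> measurable (F j)) -> measurable (\bigcup_(j in D) F j).
Proof.
move=> mF; rewrite (_ : \bigcup_(j in D) F j =
    \bigcup_k (if unpickle k is Some j then [set x | D j /\ F j x] else set0)).
  apply: bigcupT_measurable => k; case: unpickle => // j.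
  have [Dj|Dj] := pselect (D j).
    by rewrite (_ : [set x | _] = F j); [exact: mF|apply/seteqP; split => [x []//|x Fx]; split].
  by rewrite (_ : [set x | _] = set0)//; apply/seteqP; split => x [].
apply/seteqP; split => [x [j Dj Fjx]|x [k _]].
  by exists (pickle j) => //; rewrite pickleK.
by case: unpickle => // j [Dj Fjx]; exists j.
Qed.

Section bitspace.
Context (I : countType).

Lemma bit_measurable (i : I) (b : bool) :
  measurable [set x : bitspace I | x i = b].
Proof.
apply: sub_sigma_algebra.
rewrite (_ : [set x | _] = proj i @^-1` [set b] :> set {ptws I -> bool}).
  apply: open_comp; last exact: discrete_open.
  by move=> x _; exact: (@proj_continuous I (fun=> bool) i).
by apply/seteqP; split => x /=.
Qed.

Let cyl n (x : I -> bool) : set (bitspace I) :=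
  [set y | forall i, (pickle i < n)%N -> y i = x i].

(** The filter generated by the cylinders around x converges pointwise to x, so every open
    neighbourhood of x contains one of them. *)
Let open_cyl (U : set {ptws I -> bool}) x : open U -> U x ->
  exists n, cyl n x `<=` U.
Proof.
move=> oU Ux.
pose F := filter_from [set: nat] (fun n => cyl n x).
have FF : Filter F.
  apply: filter_from_filter; first by exists 0%N.
  move=> m n _ _; exists (maxn m n) => // y yx; split => i im; apply: yx.
    by rewrite leq_max im.
  by rewrite leq_max im orbT.
have : {ptws, F --> (x : I -> bool)}.
  apply/cvg_sup => i A /= [B [[C _ <-] /= Cx] BA].
  by exists (pickle i).+1 => // y yx; apply: BA; rewrite /= yx.
move=> /(_ U (open_nbhs_nbhs (conj oU Ux))) [n _ nU].
by exists n.
Qed.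

(** An open set is the union of the cylinders it contains. These are indexed by finite words of
    bits, so the union is countable. *)
Lemma bitspace_measurableE :
  @measurable _ (bitspace I) =
  <<s [set A : set (bitspace I) | exists i, A = [set x : bitspace I | x i : bool]] >>.
Proof.
apply/seteqP; split; last first.
  apply: smallest_sub; first exact: sigma_algebra_measurable.
  by move=> _ [i ->]; exact: (bit_measurable i true).
set G := <<s _ >>.
have sG : sigma_algebra setT G by exact: smallest_sigma_algebra.
pose GT := g_sigma_algebraType [set A : set (I -> bool) | exists i, A = [set x : I -> bool | x i]].
have bG (i : I) (b : bool) : @measurable _ GT [set x : I -> bool | x i = b].
  have H : @measurable _ GT [set x : I -> bool | x i].
    by apply: sub_sigma_algebra; exists i.
  case: b => //.
  rewrite (_ : [set x | _] = ~` [set x : I -> bool | x i]); last first.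
    by apply/seteqP; split => x /=; case: (x i).
  exact: (@measurableC _ GT).
suff : <<s @open {ptws I -> bool} >> `<=` G by [].
apply: (smallest_sub sG) => U oU.
pose c (s : seq bool) : set (I -> bool) :=
  [set y | forall i, (pickle i < size s)%N -> y i = nth false s (pickle i)].
have -> : U = \bigcup_(s in [set s | c s `<=` U]) c s.
  apply/seteqP; split => [x Ux|x [s]]; last exact.
  have [n nU] := open_cyl oU Ux.
  pose s := mkseq (fun k => if unpickle k is Some i then x i else false) n.
  have cs : c s = cyl n x.
    apply/seteqP; split => y /= yx i; [move=> ni|rewrite size_mkseq => ni].
      by rewrite yx ?size_mkseq// nth_mkseq// pickleK.
    by rewrite nth_mkseq// pickleK; exact: yx.
  by exists s; rewrite /= cs// => i _.
apply: (@bigcup_countType_measurable _ GT) => s _.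
rewrite (_ : c s = \bigcap_k (if unpickle k is Some i then
   if (pickle i < size s)%N then [set y : I -> bool | y i = nth false s (pickle i)] else setT
   else setT)); last first.
  apply/seteqP; split => [y /= ys k _|y H i si].
    by case: unpickle => // i; case: ifPn => // si; exact: ys.
  by have := H (pickle i) Logic.I; rewrite pickleK si.
apply: (@bigcapT_measurable _ GT) => k.
by case: unpickle => // i; case: ifPn => // _; exact: bG.
Qed.

Lemma measurable_fun_bitspace d (Y : measurableType d)
    (f : Y -> bitspace I) :
  (forall i, measurable [set y | f y i]) -> measurable_fun setT f.
Proof.
move=> mf; apply: (measurability _ bitspace_measurableE).
by move=> _ [_ [i ->] <-]; rewrite setTI; exact: mf.
Qed.

Lemma measurable_bit (i : I) : measurable_fun setT (fun x : bitspace I => x i).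
Proof.
apply: (measurable_fun_bool true).
by rewrite setTI; exact: (bit_measurable i true).
Qed.

End bitspace.

Section finite_measure_unique.
Context d (X : measurableType d) (R : realType).
Variables (G : set (set X)) (m1 m2 : {measure set X -> \bar R}).
Hypotheses (mG : measurable = <<s G >>) (GI : setI_closed G).
Hypothesis m12 : forall A, G A -> m1 A = m2 A.
Hypothesis m12T : m1 setT = m2 setT.
Hypothesis m1oo : (m1 setT < +oo)%E.

Lemma finite_measure_unique A : measurable A -> m1 A = m2 A.
Proof.
(* The whole space joins the pi-system, so that it can serve as the exhausting sequence. *)
move=> mA; apply: (@measure_unique _ _ _ (G `|` [set setT]) (fun=> setT)) => //.
- rewrite mG; apply/seteqP; split.
    by apply: sub_sigma_algebra2 => B; left.
  apply: smallest_sub; first exact: smallest_sigma_algebra.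
  move=> B [|->]; first exact: sub_sigma_algebra.
  by rewrite -mG.
- move=> B C [GB|->] [GC|->]; rewrite ?setTI ?setIT; try by [left|right].
  by left; exact: GI.
- by move=> _; right.
- by apply/seteqP; split => // x _; exists 0%N.
- by move=> B [|->]; [exact: m12|].
Qed.

End finite_measure_unique.

(** * Measures on the positive reals *)

Section positive_reals.
Context (R : realType).
Implicit Types (s t a : Rpos R).

Lemma Rpos_val_gt0 t : 0 < Rpos_val t.
Proof. exact: (gt0 (t : {posnum R})). Qed.

Lemma Rpos_val_inj : injective (@Rpos_val R).
Proof. by move=> s t st; apply/val_inj. Qed.

Lemma Rpos_val_mul s t : Rpos_val (Rpos_mul s t) = Rpos_val s * Rpos_val t.
Proof. by []. Qed.

Definition Rpos_one : Rpos R := 1%:pos.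
Definition Rpos_inv t : Rpos R := ((t : {posnum R})%:num^-1)%:pos.

Lemma Rpos_val_inv t : Rpos_val (Rpos_inv t) = (Rpos_val t)^-1.
Proof. by []. Qed.

Lemma Rpos_mulA : associative (@Rpos_mul R).
Proof. by move=> r s t; apply: Rpos_val_inj; rewrite !Rpos_val_mul mulrA. Qed.

Lemma Rpos_mulC : commutative (@Rpos_mul R).
Proof. by move=> s t; apply: Rpos_val_inj; rewrite !Rpos_val_mul mulrC. Qed.

Lemma Rpos_mul1 t : Rpos_mul Rpos_one t = t.
Proof. by apply: Rpos_val_inj; rewrite !Rpos_val_mul mul1r. Qed.

Lemma Rpos_mulV t : Rpos_mul (Rpos_inv t) t = Rpos_one.
Proof.
by apply: Rpos_val_inj; rewrite !Rpos_val_mul Rpos_val_inv mulVf// gt_eqF// Rpos_val_gt0.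
Qed.

Lemma Rpos_mulK t s : Rpos_mul (Rpos_inv t) (Rpos_mul t s) = s.
Proof. by rewrite Rpos_mulA Rpos_mulV Rpos_mul1. Qed.

Lemma Rpos_mulVK t s : Rpos_mul t (Rpos_mul (Rpos_inv t) s) = s.
Proof. by rewrite Rpos_mulA (Rpos_mulC t) Rpos_mulV Rpos_mul1. Qed.

Lemma Rpos_invK t : Rpos_inv (Rpos_inv t) = t.
Proof. by apply: Rpos_val_inj; rewrite !Rpos_val_inv invrK. Qed.

Lemma dilateE a (B : set (Rpos R)) : dilate a B = Rpos_mul (Rpos_inv a) @^-1` B.
Proof.
apply/seteqP; split => [_ [t Bt <-]|t Bt] /=; first by rewrite Rpos_mulK.
by exists (Rpos_mul (Rpos_inv a) t) => //; rewrite Rpos_mulVK.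
Qed.

(** The value 1 outside the positive reals is arbitrary; in [positive_density] it repairs a density
    on the null set where it vanishes. *)
Definition to_Rpos (x : R) : Rpos R :=
  if pselect (0 < x) is left x0 then PosNum x0 else Rpos_one.

Lemma to_RposK (x : R) : 0 < x -> Rpos_val (to_Rpos x) = x.
Proof. by rewrite /to_Rpos; case: pselect. Qed.

Lemma measurable_Rpos_val : measurable_fun setT (@Rpos_val R).
Proof. by move=> _ B mB; rewrite setTI; exists B => //; rewrite setTI. Qed.

Lemma measurable_fun_Rpos d (X : measurableType d) (f : X -> Rpos R) :
  measurable_fun setT (fun x => Rpos_val (f x)) -> measurable_fun setT f.
Proof. by move=> mf _ _ [B mB <-]; rewrite setTI; exact: mf. Qed.

Lemma measurable_Rpos_mul d (X : measurableType d) (f g : X -> Rpos R) :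
  measurable_fun setT f -> measurable_fun setT g ->
  measurable_fun setT (fun x => Rpos_mul (f x) (g x)).
Proof.
move=> mf mg; apply: measurable_fun_Rpos; apply: measurable_funM.
  exact: measurableT_comp measurable_Rpos_val mf.
exact: measurableT_comp measurable_Rpos_val mg.
Qed.

Lemma measurable_fun_posV d (X : measurableType d) (f : X -> R) :
  (forall x, 0 < f x) -> measurable_fun setT f ->
  measurable_fun setT (fun x => (f x)^-1).
Proof.
move=> f0 mf.
have m0 : measurable [set` `](0:R), +oo[] by exact: measurable_itv.
apply: (measurable_comp m0 _ _ mf).
  by move=> _ [x _ <-] /=; rewrite in_itv/= f0.
apply: open_continuous_measurable_fun; first exact: interval_open.
move=> x; rewrite inE/= in_itv/= andbT => x0.
by apply: inv_continuous; rewrite gt_eqF.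
Qed.

Lemma measurable_Rpos_inv d (X : measurableType d) (f : X -> Rpos R) :
  measurable_fun setT f -> measurable_fun setT (fun x => Rpos_inv (f x)).
Proof.
move=> mf; apply: measurable_fun_Rpos; apply: measurable_fun_posV.
  by move=> x; exact: Rpos_val_gt0.
exact: measurableT_comp measurable_Rpos_val mf.
Qed.

Lemma measurable_to_Rpos d (X : measurableType d) (f : X -> R) :
  measurable_fun setT f -> measurable_fun setT (fun x => to_Rpos (f x)).
Proof.
move=> mf; apply: measurable_fun_Rpos.
rewrite (_ : (fun x => _) = (fun x => if 0 < f x then f x else 1)); last first.
  by apply/funext => x; case: ifPn => [|/negP] fx; [rewrite to_RposK|rewrite /to_Rpos; case: pselect].
apply: measurable_fun_ifT => //.
have H := measurable_fun_ltr (@measurable_cst _ _ X R setT 0) mf; exact H.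
Qed.

Lemma measurable_dilate a (B : set (Rpos R)) :
  measurable B -> measurable (dilate a B).
Proof.
move=> mB; rewrite dilateE -[X in measurable X]setTI.
by apply: measurable_Rpos_mul => //; exact: measurable_cst.
Qed.

Lemma Rpos_itv_measurable (i : interval R) :
  measurable [set t : Rpos R | Rpos_val t \in i].
Proof.
rewrite -[X in measurable X]setTI.
exact: (measurable_Rpos_val measurableT (measurable_itv i)).
Qed.

Local Open Scope ereal_scope.

(** The property shared by [chi] and [kappa] that makes their null sets comparable. *)
Definition quasi_invariant (k : set (Rpos R) -> \bar R) : Prop :=
  forall a N, measurable N -> k N = 0 -> k (Rpos_mul a @^-1` N) = 0.

Lemma haar_quasi_invariant chi : is_haar chi -> quasi_invariant chi.
Proof.
move=> [inv _ _] a N mN N0; rewrite -(Rpos_invK a) -dilateE inv//.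
Qed.

Lemma maharam_quasi_invariant kappa :
  is_maharam_fiber kappa -> quasi_invariant kappa.
Proof.
move=> [_ inv] a N mN N0; rewrite -(Rpos_invK a) -dilateE inv// N0 mule0//.
Qed.

Lemma maharam_fiber_neq0 (kappa : {measure set (Rpos R) -> \bar R}) :
  is_maharam_fiber kappa -> 0 < kappa setT.
Proof.
move=> [[_ lk] _]; rewrite measure_gt0; apply/negP => /eqP k0.
have k0T : kappa.-null_set setT.
  by move=> A mA _; apply/eqP; rewrite -measure_le0 -k0; apply: le_measure; rewrite ?inE.
have /= := lk setT k0T setT measurableT.
rewrite (_ : _ @` setT = [set` `]0%R, +oo[]); last first.
  apply/seteqP; split => [_ [t _ <-]|x] /=; rewrite in_itv/= andbT.
    exact: Rpos_val_gt0.
  by move=> x0; exists (to_Rpos x) => //; exact: to_RposK.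
by rewrite lebesgue_measure_itv/= ltry => /(_ (fun _ => id)).
Qed.

End positive_reals.

(** * Skew products with the positive reals *)

Section skew_products.
Context (R : realType).

Definition skew_product (X Y : Type) (f : X -> Y) (a : X -> Rpos R) (p : X * Rpos R) :
  Y * Rpos R := (f p.1, Rpos_mul (a p.1) p.2).

Context d d' (X : measurableType d) (Y : measurableType d').
Context (f : X -> Y) (a : X -> Rpos R).
Hypotheses (mf : measurable_fun setT f) (ma : measurable_fun setT a).
Local Open Scope ereal_scope.

Lemma measurable_skew : measurable_fun setT (skew_product f a).
Proof.
apply: measurable_fun_pair; first exact: measurableT_comp mf measurable_fst.
by apply: measurable_Rpos_mul => //; exact: measurableT_comp ma measurable_fst.
Qed.

Lemma xsection_skew (N : set (Y * Rpos R)) x :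
  xsection (skew_product f a @^-1` N) x = Rpos_mul (a x) @^-1` xsection N (f x).
Proof.
by apply/seteqP; split => t /=; rewrite /xsection/= !inE.
Qed.

(** Null sets are recognised on sections, and the section of the preimage at x is a dilate of the
    section of [N] at [f x]. *)
Lemma skew_nonsingular (m : {sigma_finite_measure set X -> \bar R})
    (m' : {sigma_finite_measure set Y -> \bar R})
    (k : {sigma_finite_measure set (Rpos R) -> \bar R}) :
  quasi_invariant k -> nonsingular m m' f ->
  nonsingular (m \x k) (m' \x k) (skew_product f a).
Proof.
move=> qk nf; split; first exact: measurable_skew.
move=> N mN /(product_measure0E _ _ mN) N0; apply/product_measure0E.
  by rewrite -[X in measurable X]setTI; exact: measurable_skew.
have := nonsingular_ae nf N0; apply: filterS => x /= Nx.
rewrite xsection_skew; apply: qk => //; exact: measurable_xsection.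
Qed.

End skew_products.

(** * Comparison of the Haar measure with the fibre measure of the Maharam extension *)

Section fiber_measures.
Context (R : realType).
Context (chi kappa : {sigma_finite_measure set (Rpos R) -> \bar R}).
Local Open Scope ereal_scope.

Let mul_set (B : set (Rpos R)) : set (Rpos R * Rpos R) :=
  [set p | B (Rpos_mul p.1 p.2)].

Let mul_set_measurable B : measurable B -> measurable (mul_set B).
Proof.
move=> mB; rewrite -[X in measurable X]setTI.
apply: (@measurable_Rpos_mul R _ (Rpos R * Rpos R)%type fst snd) => //.
Qed.

(* Both [chi (t^-1 B) = 0] for all [t] and [kappa (s^-1 B) = 0] for almost all
   [s] express that [(s, t) |-> s t] maps almost no point into [B]. *)
Lemma quasi_invariant_dominates : quasi_invariant chi -> quasi_invariant kappa ->
  chi setT != 0 ->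
  forall B, measurable B -> chi B = 0 -> kappa B = 0.
Proof.
move=> qchi qkappa chi0 B mB B0.
have mD := mul_set_measurable mB.
have D0 : (chi \x kappa) (mul_set B) = 0.
  apply/product_measure0EC => //; apply: aeW => t.
  rewrite (_ : ysection _ _ = Rpos_mul t @^-1` B); first exact: qchi.
  by apply/seteqP; split => s /=; rewrite /ysection/= inE/= Rpos_mulC.
move/(product_measure0E _ _ mD) : D0.
(* As [chi] is nonzero, a property of almost every s holds for at least one s; dilating back by this
   s recovers [B]. *)
have PF : ProperFilter (almost_everywhere chi).
  by apply: ae_properfilter_algebraOfSetsType; rewrite measure_gt0.
move=> /filter_ex[s]; rewrite (_ : xsection _ _ = Rpos_mul s @^-1` B).
  move=> sB0; have := qkappa (Rpos_inv s) _ _ sB0.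
  rewrite -comp_preimage (_ : _ \o _ = id); last first.
    by apply/funext => t /=; rewrite Rpos_mulVK.
  apply; rewrite -[X in measurable X]setTI.
  by apply: measurable_Rpos_mul => //; exact: measurable_cst.
by apply/seteqP; split => t /=; rewrite /xsection/= inE.
Qed.

Hypotheses (hchi : is_haar chi) (hkappa : is_maharam_fiber kappa).

Let J : set (Rpos R) := [set t | (Rpos_val t \in `[1, 2])%R].

Let dominated B : measurable B -> chi B = 0 -> kappa B = 0.
Proof.
apply: quasi_invariant_dominates.
- exact: haar_quasi_invariant.
- exact: maharam_quasi_invariant.
- by case: hchi.
Qed.

Let maharam_fiberE (s : Rpos R) B : measurable B ->
  kappa (Rpos_mul s @^-1` B) = (Rpos_val s)%:E * kappa B.
Proof.
move=> mB; have [_ H] := hkappa.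
by rewrite -{1}(Rpos_invK s) -dilateE H// Rpos_val_inv invrK.
Qed.

Let haarE (s : Rpos R) B : measurable B -> chi (Rpos_mul s @^-1` B) = chi B.
Proof. by move=> mB; rewrite -{1}(Rpos_invK s) -dilateE; case: hchi => H _ _; exact: H. Qed.

(* The same Fubini argument with a quantitative bound: for [K] of finite
   positive [kappa]-measure, the [kappa]-integral over [t] in [1, 2] of
   [chi {s in [a, b] | s t in K}] is at most
   [b * kappa K * chi [a, b]]. *)
Let maharam_fiber_bounded_itv : kappa J < +oo.
Proof.
have mJ : measurable J by exact: Rpos_itv_measurable.
have [K [mK K0 Koo]] : exists K, [/\ measurable K, 0 < kappa K & kappa K < +oo].
  have [F FT Foo] := sigma_finiteT kappa.
  apply: contrapT => nK.
  have := maharam_fiber_neq0 hkappa; rewrite FT measure_gt0 => /eqP; apply.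
  apply: measure_bigcup0 => // n; first by case: (Foo n).
  apply/eqP/negPn/negP; rewrite -measure_gt0 => n0; apply: nK; exists (F n).
  by have [] := Foo n.
(* If t is in [1, 2] and s t is in [L n], then s is in [1/(n+1), n+1], the interval [I] below, where
   [chi] is finite. *)
pose L n : set (Rpos R) := [set t | (Rpos_val t \in `[2 * n.+1%:R^-1, n.+1%:R])%R].
have mL n : measurable (L n) by exact: Rpos_itv_measurable.
(* The sets [L n] cover the half-line; were all these measures zero, [chi K] and hence [kappa K]
   would vanish. *)
have [n Kn0] : exists n, 0 < chi (K `&` L n).
  apply: contrapT => nK; move: K0; rewrite lt_neqAle => /andP[/eqP + _]; apply.
  apply/esym/dominated => //.
  rewrite (_ : K = \bigcup_n (K `&` L n)).
    apply: measure_bigcup0 => n; first exact: measurableI.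
    by apply/eqP/negPn/negP; rewrite -measure_gt0 => n0; apply: nK; exists n.
  rewrite -setI_bigcupr (_ : \bigcup_n L n = setT) ?setIT//.
  rewrite -subTset => t _; have t0 := Rpos_val_gt0 t.
  set v := Rpos_val t in t0.
  have v2 : (0 <= v + 2 / v)%R by rewrite addr_ge0 ?divr_ge0// ltW.
  exists (Num.bound (v + 2 / v)) => //; rewrite /L/= in_itv/= -/v.
  have := archi_boundP v2; set N := Num.bound _ => vN.
  have N0 : (0 < N.+1%:R :> R)%R by rewrite ltr0n.
  have NN : (N%:R <= N.+1%:R :> R)%R by rewrite ler_nat.
  have v20 : (0 < 2 / v)%R by rewrite divr_gt0.
  apply/andP; split; last by lra.
  by rewrite ler_pdivrMr// mulrC -ler_pdivrMr//; lra.
set eta := chi (K `&` L n) in Kn0.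
pose a : R := (n.+1%:R^-1)%R; pose b : R := (n.+1%:R)%R.
pose I : set (Rpos R) := [set t | (Rpos_val t \in `[a, b])%R].
have mI : measurable I by exact: Rpos_itv_measurable.
have a0 : (0 < a)%R by rewrite invr_gt0.
have Ioo : chi I < +oo.
  case: hchi => _ + _ => /(_ a b a0).
  by rewrite (_ : [set t | _] = I)//; apply/seteqP; split => t; rewrite /I/= in_itv.
have etaoo : eta < +oo.
  apply: le_lt_trans Ioo; apply: le_measure; rewrite ?inE//; first exact: measurableI.
  move=> t [_]; rewrite /L /I/= !in_itv/= => /andP[h1 ->]; rewrite andbT.
  by move: h1; rewrite -/a => h1; lra.
pose D := mul_set K `&` (I `*` setT).
have mD : measurable D by apply: measurableI => //; [exact: mul_set_measurable|exact: measurableX].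
have D1 : (chi \x kappa) D < +oo.
  apply: (@le_lt_trans _ _ (\int[chi]_(s in I) (b%:E * kappa K))).
    rewrite /product_measure1 [leRHS]integral_mkcond; apply: ge0_le_integral => //.
    - exact: measurable_fun_xsection.
    - exact: (proj1 (measurable_restrictT _ mI) (measurable_cst _)).
    - move=> s _; rewrite patchE; case: ifPn => [sI|sI] /=.
        rewrite (_ : xsection D s = Rpos_mul s @^-1` K); last first.
          apply/seteqP; split => t /=; rewrite /xsection/= inE/=.
            by case.
          by move=> Kst; split => //; split => //=; move: sI; rewrite inE.
        rewrite maharam_fiberE// lee_wpmul2r// lee_fin.
        by move: sI; rewrite inE /I/= in_itv/= => /andP[].
      rewrite (_ : xsection D s = set0) ?measure0//.
      apply/seteqP; split => t //=; rewrite /xsection/= inE/= => -[_ [/= Is _]].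
      by move: sI; rewrite notin_setE.
  rewrite integral_cst// lte_mul_pinfty//.
  - by rewrite mule_ge0// lee_fin.
  - by rewrite fin_numM// ge0_fin_numE.
rewrite (_ : (chi \x kappa) D = (chi \x^ kappa) D) in D1; last first.
  by apply: product_measure_unique => //= A B mA mB; rewrite product_measure2E.
have etaf : eta \is a fin_num by rewrite ge0_fin_numE// ltW.
(* For each t in [J], the s with s t in [K] and in [L n] form a set of measure [eta], by invariance
   of [chi], contained in the section of [D] at t. *)
have : eta * kappa J <= (chi \x^ kappa) D.
  rewrite -integral_cst// /product_measure2 [leLHS]integral_mkcond.
  apply: ge0_le_integral => //.
  - by move=> s _; rewrite patchE; case: ifP => // _; exact: ltW.
  - exact: (proj1 (measurable_restrictT _ mJ) (measurable_cst _)).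
  - exact: measurable_fun_ysection.
  - move=> t _; rewrite patchE; case: ifPn => [tJ|_] /=; last exact: measure_ge0.
    rewrite /eta -(haarE t); last exact: measurableI.
    apply: le_measure; rewrite ?inE.
    + rewrite -[X in measurable X]setTI.
      apply: measurable_Rpos_mul => //; exact: measurableI.
    + exact: measurable_ysection.
    + move=> s /= [Ks]; rewrite /L/= in_itv/= => /andP[as_ sb].
      rewrite /ysection/= inE/=; split.
        by rewrite /mul_set/= Rpos_mulC.
      split => //; rewrite /I/= in_itv/=.
      move: tJ; rewrite inE /J/= in_itv/= => /andP[t1 t2].
      have {}as_ : (2 * a <= Rpos_val t * Rpos_val s)%R := as_.
      have {}sb : (Rpos_val t * Rpos_val s <= b)%R := sb.
      have := Rpos_val_gt0 s; have := Rpos_val_gt0 t; move=> t0 s0.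
      apply/andP; split; nra.
move=> etaJ; have {}D1 := le_lt_trans etaJ D1.
rewrite ltNge; apply/negP; rewrite leye_eq => /eqP Joo; move: D1.
by rewrite Joo gt0_muley// ltxx.
Qed.

(** The half-line is covered by the intervals [2^k c, 2^(k+1) c], dilates of [J] whose measures
    decrease like 2^-k. *)
Lemma maharam_fiber_tail_finite (c : R) : (0 < c)%R ->
  kappa [set t | (c <= Rpos_val t)%R] < +oo.
Proof.
move=> c0; have mJ : measurable J by exact: Rpos_itv_measurable.
have Jf : kappa J \is a fin_num by rewrite ge0_fin_numE// maharam_fiber_bounded_itv.
pose a k := to_Rpos (c * (2 ^ k)%:R)%R.
have aE k : Rpos_val (a k) = (c * (2 ^ k)%:R)%R.
  by rewrite to_RposK// mulr_gt0// ltr0n expn_gt0.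
have mJk k : measurable (dilate (a k) J) by exact: measurable_dilate.
apply: (@le_lt_trans _ _ (\sum_(k <oo) kappa (dilate (a k) J))).
  apply: measure_sigma_subadditive => //.
    rewrite (_ : [set t | _] = [set t | (Rpos_val t \in `[c, +oo[)%R]); last first.
      by apply/seteqP; split => t /=; rewrite in_itv/= andbT.
    exact: Rpos_itv_measurable.
  move=> t /= ct.
  have [n vn] : exists n, (Rpos_val t < c * (2 ^ n)%:R)%R.
    have t0 : (0 <= Rpos_val t / c)%R by rewrite divr_ge0// ltW// Rpos_val_gt0.
    exists (Num.bound (Rpos_val t / c)); rewrite mulrC -ltr_pdivrMr//.
    by apply: lt_le_trans (archi_boundP t0) _; rewrite ler_nat ltnW// ltn_expl.
  have /ex_minnP[k vk kmin] : exists n, (Rpos_val t < c * (2 ^ n)%:R)%R by exists n.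
  case: k => [|k] in vk kmin *.
    by move: vk; rewrite expn0 mulr1 ltNge ct.
  exists k => //; rewrite dilateE /J /preimage; do 2 rewrite /mkset.
  rewrite Rpos_val_mul Rpos_val_inv aE in_itv/=.
  have ck : (c * (2 ^ k)%:R <= Rpos_val t)%R.
    by rewrite leNgt; apply/negP => /kmin; rewrite ltnn.
  have c2 : (0 < c * (2 ^ k)%:R)%R by rewrite mulr_gt0// ltr0n expn_gt0.
  rewrite mulrC ler_pdivlMr// mul1r ck/= ler_pdivrMr//.
  by move: vk; rewrite expnS natrM => vk; lra.
(* The factor 2 compensates the exponent k + 1, the form in which [epsilon_trick0] sums the
   geometric series. *)
have -> : \sum_(k <oo) kappa (dilate (a k) J) =
    \sum_(k <oo) ((c^-1 * 2 * fine (kappa J)) / (2 ^ k.+1)%:R)%:E.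
  apply: eq_eseriesr => k _; have [_ ->//] := hkappa.
  rewrite aE -{1}(fineK Jf) -EFinM; congr EFin.
  rewrite expnS natrM; field.
  by rewrite (gt_eqF c0) pnatr_eq0 -lt0n expn_gt0.
apply: (le_lt_trans (epsilon_trick0 xpredT _)); last exact: ltry.
by rewrite !mulr_ge0// ?invr_ge0 ?fine_ge0// ltW.
Qed.

End fiber_measures.

(** * Factors of measure preserving maps *)

Lemma measurable_eq_set d (X : measurableType d) (A B : set X) :
  measurable A -> measurable B -> measurable [set x | A x = B x].
Proof.
move=> mA mB; rewrite (_ : [set x | _] = (A `&` B) `|` (~` A `&` ~` B)).
  by apply: measurableU; apply: measurableI => //; exact: measurableC.
apply/seteqP; split => [x /= AB|x /= [[Ax Bx]|[Ax Bx]]].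
- by rewrite -AB; have [Ax|Ax] := pselect (A x); [left|right].
- by apply/propext.
- by apply/propext.
Qed.

Lemma measurable_preimage d d' (X : measurableType d) (Y : measurableType d')
    (f : X -> Y) (A : set Y) :
  measurable_fun setT f -> measurable A -> measurable (f @^-1` A).
Proof. by move=> mf mA; rewrite -[X in measurable X]setTI; exact: mf. Qed.

Lemma measurable_iter d (X : measurableType d) (f : X -> X) n :
  measurable_fun setT f -> measurable_fun setT (iter n f).
Proof.
by move=> mf; elim: n => [|n IH]; [exact: measurable_id|exact: measurableT_comp mf IH].
Qed.

Section measure_preserving_factor.
Context d d0 (Y : measurableType d) (Y0 : measurableType d0) (R : realType).
Context (nu : {measure set Y -> \bar R}) (nu0 : {measure set Y0 -> \bar R}).
Context (p : Y -> Y0).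
Hypotheses (mp : measurable_fun setT p)
  (p_pres : forall A, measurable A -> nu (p @^-1` A) = nu0 A).

Lemma preserving_nonsingular : nonsingular nu nu0 p.
Proof. by split => // N mN N0; rewrite p_pres. Qed.

Lemma preserving_ae (P : Y0 -> Prop) : measurable [set y | P y] ->
  {ae nu, forall y, P (p y)} <-> {ae nu0, forall y, P y}.
Proof.
move=> mP; split; last exact: nonsingular_ae preserving_nonsingular.
move=> Pp; apply/(ae_measureC0 nu0 mP); rewrite -p_pres; last exact: measurableC.
rewrite preimage_setC.
by apply/(@ae_measureC0 _ _ _ nu (p @^-1` [set y | P y]) (measurable_preimage mp mP)).
Qed.

End measure_preserving_factor.

(* An invertible measure preserving [S] with a factor [T0], through [p], that
   is exact: the sets of [F] below are those depending on [p] only. *)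
Section exact_factor.
Context d d0 (Y : measurableType d) (Y0 : measurableType d0) (R : realType).
Context (nu : {measure set Y -> \bar R}) (nu0 : {measure set Y0 -> \bar R}).
Context (S Si : Y -> Y) (T0 : Y0 -> Y0) (p : Y -> Y0) (gens : set (set Y)).
Hypothesis nu0_sigma_finite : sigma_finite setT nu0.
Hypotheses (SK : cancel S Si) (SiK : cancel Si S).
Hypotheses (mS : measurable_fun setT S) (mSi : measurable_fun setT Si).
Hypothesis S_pres : forall A, measurable A -> nu (S @^-1` A) = nu A.
Hypotheses (mT0 : measurable_fun setT T0) (mp : measurable_fun setT p).
Hypothesis p_pres : forall A, measurable A -> nu (p @^-1` A) = nu0 A.
Hypothesis pS : {ae nu, forall y, p (S y) = T0 (p y)}.
Hypothesis gensE : @measurable _ Y = <<s gens >>.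
Hypothesis gensF : forall g, gens g -> exists n B, measurable B /\
  {ae nu, forall y, g (iter n S y) = B (p y)}.
Hypothesis exactT0 : forall A, measurable A ->
  (forall n, exists2 B, measurable B & {ae nu0, forall y, A y = B (iter n T0 y)}) ->
  null_or_conull nu0 A.

(** The equality is asked almost everywhere because [pS] holds only almost everywhere: exact
    pullbacks need not be stable under preimages by [S]. *)
Let F : set (set Y) := [set A | measurable A /\
  exists2 B, measurable B & {ae nu, forall y, A y = B (p y)}].

Let nsS : nonsingular nu nu S.
Proof. exact: preserving_nonsingular. Qed.

Let p_iter n : {ae nu, forall y, p (iter n S y) = iter n T0 (p y)}.
Proof. exact: iter_intertwine_ae. Qed.

Let F_iter n A : F A -> F (iter n S @^-1` A).
Proof.
move=> [mA [B mB AB]]; split; first exact: measurable_preimage (measurable_iter n mS) mA.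
exists (iter n T0 @^-1` B).
  exact: measurable_preimage (measurable_iter n mT0) mB.
have := nonsingular_ae (nonsingular_iter n nsS) AB.
by move: (p_iter n); apply: filterS2 => y /= <- ->.
Qed.

Let sF : sigma_algebra setT F.
Proof.
split.
- split; first exact: measurable0.
  by exists set0; [exact: measurable0|exact: aeW].
- move=> A [mA [B mB AB]]; rewrite setTD; split; first exact: measurableC.
  exists (~` B); first exact: measurableC.
  by move: AB; apply: filterS => y /= ->.
- move=> A FA; split; first by apply: bigcupT_measurable => n; case: (FA n).
  have /choice[B HB] : forall n, exists B, measurable B /\
      {ae nu, forall y, A n y = B (p y)}.
    by move=> n; have [_ [B mB AB]] := FA n; exists B.
  exists (\bigcup_n B n); first by apply: bigcupT_measurable => n; case: (HB n).
  have : {ae nu, forall y n, A n y = B n (p y)}.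
    by apply: ae_foralln => n; case: (HB n).
  apply: filterS => y AB; apply/propext; split => -[n _ H]; exists n => //.
    by rewrite -AB.
  by rewrite AB.
Qed.

Let imageE A : S @` A = Si @^-1` A.
Proof.
apply/seteqP; split => [_ [y Ay <-]|y Ay] /=; first by rewrite SK.
by exists (Si y).
Qed.

Let iter_image n A : iter n S @` (iter n S @^-1` A) = A.
Proof.
apply/seteqP; split => [_ [y Ay <-]//|y Ay].
have iterK m : cancel (iter m Si) (iter m S).
    by elim: m => // m IH y'; rewrite [iter m.+1 Si y']iterSr iterS IH SiK.
by exists (iter n Si y) => //=; rewrite iterK.
Qed.

Let direct_imageE A : measurable A -> direct_image nu S A = nu A.
Proof.
move=> mA; rewrite /direct_image imageE -[LHS]S_pres.
  by rewrite -comp_preimage (_ : Si \o S = id)//; apply/funext => y /=; rewrite SK.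
exact: measurable_preimage.
Qed.

Let S_invertible : invertible_nonsingular nu S.
Proof.
split => //; first by exists Si.
  by move=> A mA; rewrite imageE; exact: measurable_preimage.
split => A HA B mB BA; first by rewrite direct_imageE//; exact: HA.
by transitivity (direct_image nu S B); [rewrite direct_imageE|exact: HA].
Qed.

Lemma exact_factor_K_automorphism : K_automorphism nu S.
Proof.
split; first exact: S_invertible.
exists F; split.
- by split => // A [].
- have [E ET Eoo] := nu0_sigma_finite; exists (fun k => p @^-1` E k); split.
    move=> k; have [mE] := Eoo k; rewrite -(p_pres mE) => Ek; split => //.
    split; first exact: measurable_preimage.
    by exists (E k) => //; exact: aeW.
  by rewrite -preimage_bigcup -ET preimage_setT.
- by move=> A FA; exact: (F_iter 1).
- exists (fun=> Rpos_one R); split.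
    split; first exact: measurable_cst.
    by move=> A mA; rewrite direct_imageE// integral_cst// mul1e.
  move=> B mB; rewrite preimage_cst; case: ifP => _; last by case: sF.
  by have [F0 FC _] := sF; rewrite -(setD0 [set: Y]); exact: FC.
- split.
    move=> C mC; exists C; last by rewrite setDv measure0.
    move: C mC; rewrite gensE; apply: smallest_sub.
      exact: smallest_sigma_algebra.
    (* A generator g is the image by S^(n+1) of S^-(n+1) g, which lies in [F]; one step beyond n
       makes the exponent positive. *)
    move=> g gg; have [n [B [mB gB]]] := gensF gg.
    apply: sub_sigma_algebra; exists n.+1 => //.
    exists (iter n.+1 S @^-1` g); last exact: iter_image.
    have -> : iter n.+1 S @^-1` g = iter 1 S @^-1` (iter n S @^-1` g).
      by apply/funext => y; rewrite /preimage/= -iterS iterSr.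
    apply: F_iter; split; last by exists B.
    apply: measurable_preimage; first exact: measurable_iter.
    by rewrite gensE; exact: sub_sigma_algebra.
(* [A] is almost everywhere the pullback of [A0]. Since [p] preserves measure, the identities
   expressing that [A] lies in every S^-n F descend to [A0] and make it a tail set of [T0]. *)
- move=> A tA.
  have [B1 [mB1 [B0 mB0 B10]] A1] := tA 1%N erefl.
  have mA : measurable A by rewrite -A1; exact: measurable_preimage.
  pose A0 := T0 @^-1` B0.
  have mA0 : measurable A0 by exact: measurable_preimage.
  have AA0 : {ae nu, forall y, A y = A0 (p y)}.
    rewrite -A1; have := nonsingular_ae nsS B10; move: pS.
    by apply: filterS2 => y; rewrite /A0 /preimage/= => -> ->.
  have : null_or_conull nu0 A0.
    (* The tail intersection starts at n = 1; at n = 0 exactness is fed with [A0] itself. *)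
    apply: exactT0 => // -[|n]; first by exists A0 => //; exact: aeW.
    have [Bn [mBn [Cn mCn BCn]] An] := tA n.+1 isT.
    exists Cn => //.
    have mT := measurable_preimage (measurable_iter n.+1 mT0) mCn.
    apply/(preserving_ae mp p_pres (measurable_eq_set mA0 mT)).
    have := nonsingular_ae (nonsingular_iter n.+1 nsS) BCn.
    move: (p_iter n.+1) AA0; apply: filterS3 => y pn <- H.
    by rewrite -An; exact: (etrans H (congr1 Cn pn)).
  have mpA0 := measurable_preimage mp mA0.
  move=> /null_or_conullP-/(_ mA0) H; apply/null_or_conullP => //.
  case: H => H; [left|right]; have := nonsingular_ae (preserving_nonsingular mp p_pres) H;
    by move: AA0; apply: filterS2 => y ->.
Qed.

End exact_factor.

(** * Conservativity *)

Section wandering.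
Context d (Y : measurableType d) (R : realType).
Context (nu : {measure set Y -> \bar R}) (S Si : Y -> Y).
Hypotheses (SK : cancel S Si) (SiK : cancel Si S).
Hypotheses (mS : measurable_fun setT S) (mSi : measurable_fun setT Si).
Hypothesis S_pres : forall A, measurable A -> nu (S @^-1` A) = nu A.
Local Open Scope ereal_scope.

Definition wandering (U : Y -> Y) (W : set Y) : Prop :=
  forall n, (0 < n)%N -> forall y, W y -> ~ W (iter n U y).

Lemma iter_cancel n (f g : Y -> Y) : cancel f g -> cancel (iter n f) (iter n g).
Proof.
by move=> fg; elim: n => // n IH y; rewrite [iter n.+1 f y]iterS iterSr fg IH.
Qed.

Lemma iter_cancel_le m n (f g : Y -> Y) : cancel f g -> (m <= n)%N ->
  forall y, iter m g (iter n f y) = iter (n - m) f y.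
Proof.
by move=> fg mn y; rewrite -{1}(subnKC mn) iterD iter_cancel.
Qed.

Lemma preserving_inverse A : measurable A -> nu (Si @^-1` A) = nu A.
Proof.
move=> mA; rewrite -[LHS]S_pres; last exact: measurable_preimage.
by rewrite -comp_preimage (_ : Si \o S = id)//; apply/funext => y /=; rewrite SK.
Qed.

Lemma wandering_inverse W : wandering S W -> wandering Si W.
Proof.
move=> wW n n0 y Wy Wn; apply: (wW n n0 _ Wn).
by rewrite (iter_cancel n SiK).
Qed.

Lemma preserving_iter n (f : Y -> Y) : measurable_fun setT f ->
  (forall A, measurable A -> nu (f @^-1` A) = nu A) ->
  forall A, measurable A -> nu (iter n f @^-1` A) = nu A.
Proof.
move=> mf pf; elim: n => // n IH A mA.
rewrite -[RHS]pf// -[RHS]IH//; last exact: measurable_preimage.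
Qed.

(** Borel-Cantelli: W /\ S^-n K has the same measure as S^n W /\ K, and the latter sets are disjoint
    subsets of [K], so the measures have a finite sum. *)
Lemma wandering_transient W K : measurable W -> measurable K -> wandering S W ->
  nu K < +oo ->
  {ae nu, forall y, W y -> exists N, forall n, (N <= n)%N -> ~ K (iter n S y)}.
Proof.
move=> mW mK wW Koo.
pose G n := W `&` iter n S @^-1` K.
pose H n := iter n Si @^-1` W `&` K.
have mH n : measurable (H n).
  by apply: measurableI => //; exact: measurable_preimage (measurable_iter n mSi) mW.
have mG n : measurable (G n).
  by apply: measurableI => //; exact: measurable_preimage (measurable_iter n mS) mK.
have GH n : nu (G n) = nu (H n).
  rewrite -(preserving_iter n mSi preserving_inverse (mG n)); congr (nu _).
  apply/seteqP; split => y [Wy Ky]; split => //.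
    by move: Ky; rewrite /preimage/= (iter_cancel n SiK).
  by rewrite /preimage/= (iter_cancel n SiK).
have tH : trivIset setT H.
  apply: ltn_trivIset => n m mn; apply/seteqP; split => // y [[Wm _] [Wn _]].
  apply: (wW (n - m)%N _ _ Wn); first by rewrite subn_gt0.
  by rewrite (iter_cancel_le SiK) ?leq_subr// subKn// ltnW.
have : nu (lim_sup_set G) = 0.
  apply: lim_sup_set_cvg0 => //.
  apply: le_lt_trans Koo; rewrite (eq_eseriesr (fun n _ => GH n)).
  have mUH : measurable (\bigcup_n H n) by exact: bigcupT_measurable.
  rewrite -measure_semi_bigcup//; apply: le_measure; rewrite ?inE//.
  by move=> y [n _ []].
have mL : measurable (lim_sup_set G).
  by apply: bigcapT_measurable => n; apply: bigcup_measurable.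
move=> /(ae_measure0 nu mL); apply: filterS => y nG Wy.
apply: contrapT => H1; apply: nG => n _.
apply: contrapT => H2; apply: H1; exists n => k nk Kk; apply: H2.
by exists k => //; split.
Qed.

(** The points of [E] whose backward orbit never returns to [E] form a wandering set: if y and S^n y
    were two of them, S^n y would return at y. One return almost everywhere, applied along the whole
    backward orbit, gives infinitely many. *)
Lemma conservative_recurrent E : measurable E ->
  (forall W, measurable W -> wandering S W -> nu W = 0) ->
  {ae nu, forall y, E y -> forall m, exists2 n, (m <= n)%N & E (iter n Si y)}.
Proof.
move=> mE noW.
have step : {ae nu, forall y, E y -> exists2 n, (0 < n)%N & E (iter n Si y)}.
  pose W := E `&` \bigcap_n (iter n.+1 Si @^-1` (~` E)).
  have mW : measurable W.
    apply: measurableI => //; apply: bigcapT_measurable => n.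
    exact: measurable_preimage (measurable_iter n.+1 mSi) (measurableC mE).
  have : nu W = 0.
    apply: noW => // -[//|n] _ y [Ey _] [_ /(_ n Logic.I)] /=.
    rewrite -iterS -[S _]iterS.
    by rewrite (iter_cancel n.+1 SK).
  move=> /(ae_measure0 nu mW); apply: filterS => y nW Ey.
  apply: contrapT => H; apply: nW; split => // n _ En.
  by apply: H; exists n.+1.
have nsSi : nonsingular nu nu Si.
  by split => // N mN; rewrite preserving_inverse.
have : {ae nu, forall y k, E (iter k Si y) ->
    exists2 n, (0 < n)%N & E (iter n Si (iter k Si y))}.
  by apply: ae_foralln => k; exact: (nonsingular_ae (nonsingular_iter k nsSi) step).
apply: filterS => y Hy Ey; elim => [|m [n mn En]]; first by exists 0%N.
have [k k0 Ek] := Hy n En; exists (k + n)%N; last by rewrite iterD.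
by rewrite -add1n leq_add.
Qed.

End wandering.

(** The strict inequality after the chosen index is what prevents the set [M] below from returning
    to itself. *)
Lemma last_argmax (R : realType) (u : nat -> R) L : exists2 k, (k <= L)%N &
  forall j, (j <= L)%N -> u j <= u k /\ ((k < j)%N -> u j < u k).
Proof.
elim: L => [|L [k kL IH]].
  by exists 0%N => // j; rewrite leqn0 => /eqP ->.
have [ku|ku] := leP (u k) (u L.+1).
  exists L.+1 => // j; rewrite leq_eqVlt => /orP[/eqP->|jL].
    by rewrite ltnn.
  by have [uj _] := IH j jL; split; [exact: le_trans ku|rewrite ltnNge ltnW].
exists k; first exact: leqW.
move=> j; rewrite leq_eqVlt => /orP[/eqP->|jL]; last exact: IH.
by split => //; exact: ltW.
Qed.

Section skew_iter.
Context (R : realType) (X : Type) (f : X -> X) (a : X -> Rpos R).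

Lemma iter_skew1 n (p : X * Rpos R) : (iter n (skew_product f a) p).1 = iter n f p.1.
Proof. by elim: n => //= n ->. Qed.

Lemma iter_skew2 n x t : (iter n (skew_product f a) (x, t)).2 =
  Rpos_mul (iter n (skew_product f a) (x, Rpos_one R)).2 t.
Proof.
elim: n => [|n IH]; first by rewrite /= Rpos_mul1.
by rewrite [LHS]/= IH Rpos_mulA /= !iter_skew1.
Qed.

End skew_iter.

(** * Conservativity of the Maharam extension *)

Section maharam_conservative.
Context d (X : measurableType d) (R : realType).
Context (m : {sigma_finite_measure set X -> \bar R}).
Context (kappa : {sigma_finite_measure set (Rpos R) -> \bar R}).
Context (T Ti : X -> X) (w : X -> Rpos R).
Hypotheses (TK : cancel T Ti) (TiK : cancel Ti T).
Hypotheses (mTi : measurable_fun setT Ti).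
Hypotheses (nsT : nonsingular m m T) (nsTi : nonsingular m m Ti).
Hypothesis m_finite : (m setT < +oo)%E.
Hypothesis mw : measurable_fun setT w.
Hypothesis kappa_tail : forall c : R, 0 < c ->
  (kappa [set t | (c <= Rpos_val t)%R] < +oo)%E.
Local Notation S := (skew_product T w).
Local Open Scope ereal_scope.

Definition skew_inv : X * Rpos R -> X * Rpos R :=
  skew_product Ti (fun x => Rpos_inv (w (Ti x))).

Lemma skewK : cancel S skew_inv.
Proof. by move=> [x t]; rewrite /skew_inv /skew_product/= TK Rpos_mulK. Qed.

Lemma skew_invK : cancel skew_inv S.
Proof. by move=> [x t]; rewrite /skew_inv /skew_product/= TiK Rpos_mulVK. Qed.

Lemma measurable_skew_inv : measurable_fun setT skew_inv.
Proof.
apply: measurable_skew => //; apply: measurable_Rpos_inv.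
exact: measurableT_comp mw mTi.
Qed.

Hypothesis S_pres : forall A, measurable A -> (m \x kappa) (S @^-1` A) = (m \x kappa) A.
Hypothesis consT : conservative m T.

(* The points whose orbit takes its largest density there, for the last time. *)
Let M : set X := [set x | forall n, (0 < n)%N ->
  (Rpos_val (iter n S (x, Rpos_one R)).2 < 1 /\
   Rpos_val (iter n skew_inv (x, Rpos_one R)).2 <= 1)%R].

Let mS : measurable_fun setT S.
Proof. by apply: measurable_skew => //; case: nsT. Qed.

Let mM : measurable M.
Proof.
have mval (f : X * Rpos R -> X * Rpos R) n : measurable_fun setT f ->
    measurable_fun setT (fun x => Rpos_val (iter n f (x, Rpos_one R)).2).
  move=> mf; apply: measurableT_comp (@measurable_Rpos_val R) _.
  apply: measurableT_comp measurable_snd _.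
  exact: measurableT_comp (measurable_iter n mf) (measurable_pair2 _).
rewrite (_ : M = \bigcap_n
    ([set x | Rpos_val (iter n.+1 S (x, Rpos_one R)).2 < 1]%R `&`
     [set x | Rpos_val (iter n.+1 skew_inv (x, Rpos_one R)).2 <= 1]%R)).
  apply: bigcapT_measurable => n; apply: measurableI.
    rewrite -[X in measurable X]setTI; apply: measurable_fun_ltr => //.
    exact: mval.
  rewrite -[X in measurable X]setTI; apply: measurable_fun_ler => //.
  apply: mval; exact: measurable_skew_inv.
apply/seteqP; split => [x Mx n _|x H [//|n] _]; first exact: Mx.
by have [] := H n Logic.I.
Qed.

(** The fibre coordinate along an orbit is proportional to its initial value, so membership in [M]
    can be tested from any t. *)
Let ME x t : (forall n, (0 < n)%N ->
  (Rpos_val (iter n S (x, t)).2 < Rpos_val t /\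
   Rpos_val (iter n skew_inv (x, t)).2 <= Rpos_val t)%R) <-> M x.
Proof.
have t0 := Rpos_val_gt0 t.
have E1 n : Rpos_val (iter n S (x, t)).2 =
    (Rpos_val (iter n S (x, Rpos_one R)).2 * Rpos_val t)%R.
  by rewrite iter_skew2.
have E2 n : Rpos_val (iter n skew_inv (x, t)).2 =
    (Rpos_val (iter n skew_inv (x, Rpos_one R)).2 * Rpos_val t)%R.
  by rewrite /skew_inv iter_skew2.
by split => H n n0; have := H n n0; rewrite E1 E2 gtr_pMl// ger_pMl.
Qed.

(** Were x and T^n x both in [M], the density at time n would be smaller than at time 0 seen from x,
    and at least as large seen from T^n x. So [M] is wandering, and conservativity of [T] makes it
    null. *)
Let M0 : m M = 0.
Proof.
apply/eqP/negPn/negP; rewrite -measure_gt0 => M0.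
have [n [n0]] := consT mM M0.
rewrite (_ : _ `&` _ = set0) ?measure0 ?ltxx//.
apply/seteqP; split => // x [/= Mn Mx].
have [h1 _] := Mx n n0.
have E : iter n S (x, Rpos_one R) = (iter n T x, (iter n S (x, Rpos_one R)).2).
  by rewrite {1}[iter n S _]surjective_pairing iter_skew1.
have /(ME _ (iter n S (x, Rpos_one R)).2)/(_ n n0)[_] := Mn.
by rewrite -E (iter_cancel n skewK) /= leNgt h1.
Qed.

Let orbit_max (c : R) x t :
  (c <= Rpos_val t)%R ->
  (exists N, forall n, (N <= n)%N -> ~ (c <= Rpos_val (iter n S (x, t)).2)%R) ->
  (exists N, forall n, (N <= n)%N -> ~ (c <= Rpos_val (iter n skew_inv (x, t)).2)%R) ->
  exists N k, M (iter k T (iter N Ti x)).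
Proof.
move=> ct [N1 H1] [N2 H2]; pose N := maxn N1 N2.
have {}H1 n : (N <= n)%N -> (Rpos_val (iter n S (x, t)).2 < c)%R.
  by move=> Nn; rewrite ltNge; apply/negP/H1; rewrite (leq_trans _ Nn)// leq_maxl.
have {}H2 n : (N <= n)%N -> (Rpos_val (iter n skew_inv (x, t)).2 < c)%R.
  by move=> Nn; rewrite ltNge; apply/negP/H2; rewrite (leq_trans _ Nn)// leq_maxr.
(* [u n] is the fibre coordinate at time n - N: index N is the given point, and the indices up to 2N
   cover all times where the coordinate can reach c. *)
pose q := iter N skew_inv (x, t).
pose u n := Rpos_val (iter n S q).2.
have uN n : (N <= n)%N -> u n = Rpos_val (iter (n - N) S (x, t)).2.
  by move=> Nn; rewrite /u -{1}(subnK Nn) iterD (iter_cancel N skew_invK).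
have [k kN kmax] := last_argmax u (N + N).
have cuk : (c <= u k)%R.
  apply: (le_trans ct); have [+ _] := kmax N (leq_addr _ _).
  by rewrite (uN N)// subnn.
exists N, k.
have E : iter k S q = (iter k T (iter N Ti x), (iter k S q).2).
  by rewrite {1}[iter k S q]surjective_pairing iter_skew1 /q /skew_inv iter_skew1.
apply/(ME _ (iter k S q).2) => n n0; rewrite -E -/(u k); split.
  rewrite -iterD -/(u (n + k)%N).
  have [nk|nk] := leqP (n + k) (N + N).
    by have [_] := kmax _ nk; apply; rewrite -{1}(add0n k) ltn_add2r.
  apply: lt_le_trans cuk; rewrite uN; last by rewrite (leq_trans _ (ltnW nk))// leq_addr.
  by apply: H1; rewrite leq_subRL ?(ltnW nk)// (leq_trans _ (ltnW nk))// leq_addr.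
have [nk|kn] := leqP n k.
  rewrite (iter_cancel_le skewK)// -/(u _).
  by have [] := kmax (k - n)%N (leq_trans (leq_subr _ _) kN).
rewrite -(subnK (ltnW kn)) iterD (iter_cancel k skewK) /q -iterD.
by apply: le_trans cuk; apply/ltW/H2; rewrite leq_addl.
Qed.

(** The set where t >= 1/(n+1) has finite measure, so almost every point of [W] leaves it both
    forward and backward. By [orbit_max] its orbit then meets the null set [M]. *)
Lemma maharam_conservative W : measurable W -> wandering S W -> (m \x kappa) W = 0.
Proof.
move=> mW wW.
have mK (c : R) : measurable [set p : X * Rpos R | (c <= Rpos_val p.2)%R].
  rewrite -[X in measurable X]setTI; apply: measurable_fun_ler => //.
  exact: measurableT_comp (@measurable_Rpos_val R) measurable_snd.
have : {ae (m \x kappa), forall p, forall N k, ~ M (iter k T (iter N Ti p.1))}.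
  apply: ae_foralln => N; apply: ae_foralln => k.
  apply: (@ae_prodP _ _ _ _ _ m kappa (fun p => ~ M (iter k T (iter N Ti p.1)))).
    apply: measurableC; apply: measurable_preimage mM.
    apply: measurableT_comp (measurable_iter k (proj1 nsT)) _.
    exact: measurableT_comp (measurable_iter N mTi) measurable_fst.
  have /(ae_measure0 m mM) nM := M0.
  have := nonsingular_ae (nonsingular_iter N nsTi) (nonsingular_ae (nonsingular_iter k nsT) nM).
  by apply: filterS => x Mx; exact: aeW.
have trans (n : nat) : {ae (m \x kappa), forall p, W p -> ~ (n.+1%:R^-1 <= Rpos_val p.2)%R \/
    ((exists N, forall k, (N <= k)%N -> ~ (n.+1%:R^-1 <= Rpos_val (iter k S p).2)%R) /\
     (exists N, forall k, (N <= k)%N -> ~ (n.+1%:R^-1 <= Rpos_val (iter k skew_inv p).2)%R))}.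
  have Koo : (m \x kappa) [set p | (n.+1%:R^-1 <= Rpos_val p.2)%R] < +oo.
    rewrite (_ : [set p | _] = setT `*` [set t | (n.+1%:R^-1 <= Rpos_val t)%R]).
      rewrite [X in X < _]product_measure1E//.
        by rewrite lte_mul_pinfty// ?ge0_fin_numE//; apply: kappa_tail; rewrite invr_gt0.
      rewrite (_ : [set t | _] = [set t | (Rpos_val t \in `[n.+1%:R^-1, +oo[)%R]).
        exact: Rpos_itv_measurable.
      by apply/seteqP; split => t /=; rewrite in_itv/= andbT.
    by apply/seteqP; split => [[x t]//|[x t] []].
  have H1 := wandering_transient skewK skew_invK mS measurable_skew_inv S_pres
    mW (mK _) wW Koo.
  have H2 := wandering_transient skew_invK skewK measurable_skew_inv mS
    (preserving_inverse skewK measurable_skew_inv S_pres)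
    mW (mK _) (wandering_inverse skew_invK wW) Koo.
  by move: H1 H2; apply: filterS2 => p H1 H2 Wp; right; split; [exact: H1|exact: H2].
move=> H; apply/ae_measure0 => //.
have {}trans := ae_foralln trans.
move: H trans; apply: filterS2 => -[x t] nM H Wxt.
have t0 := Rpos_val_gt0 t.
have [n nt] : exists n : nat, (n.+1%:R^-1 <= Rpos_val t)%R.
  exists (Num.bound (Rpos_val t)^-1%R).
  rewrite -[leRHS]invrK lef_pV2 ?posrE ?invr_gt0 ?ltr0n//.
  have tV : (0 <= (Rpos_val t)^-1)%R by rewrite invr_ge0 ltW.
  have /ltW h := archi_boundP tV.
  by apply: (le_trans h); rewrite ler_nat.
have [//|[h1 h2]] := H n Wxt.
by have [N [k /nM]] := orbit_max nt h1 h2.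
Qed.

End maharam_conservative.

(** * Products with ergodic maps *)

Section density.
Context d (X : measurableType d) (R : realType).
Local Open Scope ereal_scope.

Lemma finite_density (th : {measure set X -> \bar R})
    (m : {sigma_finite_measure set X -> \bar R}) :
  th setT < +oo -> (forall A, measurable A -> m A = 0 -> th A = 0) ->
  exists u : X -> \bar R, [/\ measurable_fun setT u, forall x, 0 <= u x,
    forall x, u x \is a fin_num &
    forall A, measurable A -> th A = \int[m]_(x in A) u x].
Proof.
move=> thoo thm.
have F : fin_num_fun th.
  move=> A mA; rewrite ge0_fin_numE//; apply: le_lt_trans thoo.
  by apply: le_measure; rewrite ?inE.
have sf : sigma_finite setT th by apply: fin_num_fun_sigma_finite => //; rewrite measure0.
pose H1 := isFinite.Build _ _ _ _ F.
pose H2 := isSFinite.Build _ _ _ _ (sfinite_measure_sigma_finite sf).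
pose H3 := isSigmaFinite.Build _ _ _ _ sf.
pose th' := HB.pack_for (FiniteMeasure.type X R) (Measure.sort th) H1 H2 H3.
have dom : th' `<< m by apply/null_content_dominatesP.
exists (Radon_Nikodym_SigmaFinite.f th' m); split.
- exact: measurable_int (Radon_Nikodym_SigmaFinite.f_integrable dom).
- exact: Radon_Nikodym_SigmaFinite.f_ge0.
- exact: Radon_Nikodym_SigmaFinite.f_fin_num.
- exact: (Radon_Nikodym_SigmaFinite.f_integral dom).
Qed.

End density.

Section preserving.
Context d d' (X : measurableType d) (Y : measurableType d') (R : realType).
Local Open Scope ereal_scope.

Lemma preserving_integral (m : {measure set X -> \bar R})
    (m' : {measure set Y -> \bar R}) (f : X -> Y) (h : Y -> \bar R) :
  measurable_fun setT f ->
  (forall A, measurable A -> m (f @^-1` A) = m' A) ->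
  measurable_fun setT h -> (forall y, 0 <= h y) ->
  \int[m]_x h (f x) = \int[m']_y h y.
Proof.
move=> mf pf mh h0; rewrite -(@ge0_integral_pushforward _ _ _ _ _ f mf m setT h)//.
by apply: eq_measure_integral => A mA _; exact: pf.
Qed.

End preserving.

Section preserving_prod.
Context d1 d2 d3 d4 (X1 : measurableType d1) (X2 : measurableType d2)
  (Y1 : measurableType d3) (Y2 : measurableType d4) (R : realType).
Context (m1 : {measure set X1 -> \bar R}) (m2 : {sigma_finite_measure set X2 -> \bar R}).
Context (n1 : {measure set Y1 -> \bar R}) (n2 : {sigma_finite_measure set Y2 -> \bar R}).
Context (f : X1 -> Y1) (g : X2 -> Y2).
Hypotheses (mf : measurable_fun setT f) (mg : measurable_fun setT g).
Hypothesis f_pres : forall A, measurable A -> m1 (f @^-1` A) = n1 A.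
Hypothesis g_pres : forall A, measurable A -> m2 (g @^-1` A) = n2 A.
Local Open Scope ereal_scope.

Definition map_pair (p : X1 * X2) : Y1 * Y2 := (f p.1, g p.2).

Lemma measurable_map_pair : measurable_fun setT map_pair.
Proof.
apply: measurable_fun_pair; first exact: measurableT_comp mf measurable_fst.
exact: measurableT_comp mg measurable_snd.
Qed.

Lemma preserving_prod A : measurable A ->
  (m1 \x m2) (map_pair @^-1` A) = (n1 \x n2) A.
Proof.
move=> mA; rewrite /product_measure1.
rewrite -(preserving_integral mf f_pres (measurable_fun_xsection n2 mA))//.
apply: eq_integral => x _ /=; rewrite -g_pres; last exact: measurable_xsection.
by congr (m2 _); apply/seteqP; split => y; rewrite /xsection/= !inE.
Qed.

End preserving_prod.

Section mod_null_invariant.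
Context d (Z : measurableType d) (R : realType) (rho : {measure set Z -> \bar R}).
Context (U : Z -> Z).
Hypotheses (mU : measurable_fun setT U)
  (U_pres : forall A, measurable A -> rho (U @^-1` A) = rho A).

(** The limsup of the preimages of [A] is strictly invariant and agrees with [A] almost
    everywhere. *)
Lemma ergodic_ae A : ergodic rho U -> measurable A ->
  {ae rho, forall z, A z = A (U z)} -> null_or_conull rho A.
Proof.
move=> eU mA AU.
pose A' := lim_sup_set (fun k => iter k U @^-1` A).
have mA' : measurable A'.
  apply: bigcapT_measurable => n; apply: bigcup_measurable => k _.
  exact: measurable_preimage (measurable_iter k mU) mA.
have A'U : U @^-1` A' = A'.
  apply/seteqP; split => z Az n _.
    have [k /= nk Ak] := Az n I; exists k.+1; first exact: leqW.
    by rewrite /preimage/= -iterS iterSr.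
  have [[//|k] /= nk Ak] := Az n.+1 I; exists k => //.
  by move: Ak; rewrite /preimage/= -iterS iterSr.
have nsU : nonsingular rho rho U by split => // N mN N0; rewrite U_pres.
have AA' : {ae rho, forall z, A z = A' z}.
  have : {ae rho, forall z n, A (iter n U z) = A (iter n.+1 U z)}.
    by apply: ae_foralln => n; exact: nonsingular_ae (nonsingular_iter n nsU) AU.
  apply: filterS => z H.
  have {}H n : A z = A (iter n U z) by elim: n => // n ->.
  apply/propext; split => [Az n _|Az]; first by exists n => //=; rewrite -H.
  by have [k _] := Az 0%N I; rewrite /= -H.
have /null_or_conullP-/(_ mA')[] := eU A' mA' A'U => B;
  apply/(null_or_conullP _ mA); [left|right]; by move: B AA'; apply: filterS2 => z + ->.
Qed.

End mod_null_invariant.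

(* The library's instance for [m1 \x m2] is shadowed by the one for products of
   subprobabilities. *)
Section sigma_finite_prod.
Context d1 d2 (X1 : measurableType d1) (X2 : measurableType d2) (R : realType).
Context (m1 : {sigma_finite_measure set X1 -> \bar R})
        (m2 : {sigma_finite_measure set X2 -> \bar R}).
Local Open Scope ereal_scope.

Lemma product_sigma_finite : sigma_finite setT (m1 \x m2).
Proof.
have /sigma_finiteP[F [FT Fnd Foo]] := sigma_finiteT m1.
have /sigma_finiteP[G [GT Gnd Goo]] := sigma_finiteT m2.
exists (fun n => F n `*` G n).
  apply/seteqP; split => // -[x y] _.
  have [i _ Fx] : (\bigcup_k F k) x by rewrite -FT.
  have [j _ Gy] : (\bigcup_k G k) y by rewrite -GT.
  exists (maxn i j) => //; split => /=.
    by have /subsetPset := Fnd _ _ (leq_maxl i j); exact.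
  by have /subsetPset := Gnd _ _ (leq_maxr i j); exact.
move=> n; have [mF Fn] := Foo n; have [mG Gn] := Goo n.
split; first exact: measurableX.
by rewrite product_measure1E// lte_mul_pinfty// ge0_fin_numE.
Qed.

Definition sigma_finite_prod : {sigma_finite_measure set (X1 * X2)%type -> \bar R} :=
  HB.pack_for (SigmaFiniteMeasure.type (X1 * X2)%type R) (m1 \x m2)
    (isSFinite.Build _ _ _ _ (sfinite_measure_sigma_finite product_sigma_finite))
    (isSigmaFinite.Build _ _ _ _ product_sigma_finite).

End sigma_finite_prod.

(** * Approximation in measure by an increasing sequence of set algebras *)

Section approximation.
Context d (X : measurableType d) (R : realType) (m : {measure set X -> \bar R}).
Context (V : set X) (good : nat -> set (set X)).
Local Open Scope ereal_scope.
Hypotheses (mV : measurable V) (Voo : m V < +oo).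
Hypothesis goodm : forall n B, good n B -> measurable B.
Hypothesis goodC : forall n B, good n B -> good n (~` B).
Hypothesis goodU : forall n A B, good n A -> good n B -> good n (A `|` B).
Hypothesis goodS : forall n B, good n B -> good n.+1 B.

Definition discrepancy (A B : set X) : \bar R := m (V `&` [set x | A x <> B x]).

Definition approximable : set (set X) := [set A | measurable A /\
  forall e : R, (0 < e)%R -> exists n B, good n B /\ discrepancy A B < e%:E].

Lemma measurable_discrepancy A B : measurable A -> measurable B ->
  measurable (V `&` [set x | A x <> B x]).
Proof.
move=> mA mB; apply: measurableI => //.
exact: (measurableC (measurable_eq_set mA mB)).
Qed.

Let goodD n k B : good n B -> good (k + n)%N B.
Proof. by move=> gB; elim: k => //= k IH; rewrite addSn; exact: goodS. Qed.

Let discrepancy_triangle A B C : measurable A -> measurable B -> measurable C ->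
  discrepancy A C <= discrepancy A B + discrepancy B C.
Proof.
move=> mA mB mC.
apply: (@le_trans _ _ (m ((V `&` [set x | A x <> B x]) `|` (V `&` [set x | B x <> C x])))).
  apply: le_measure; rewrite ?inE.
  - exact: measurable_discrepancy.
  - by apply: measurableU; exact: measurable_discrepancy.
  - move=> x [Vx /= AC]; have [AB|AB] := pselect (A x = B x); [right|left]; split => //=.
    by rewrite -AB.
by apply: measureU2; exact: measurable_discrepancy.
Qed.

Lemma approximable_good n B : good n B -> approximable B.
Proof.
move=> gB; split; first exact: goodm gB.
move=> e e0; exists n, B; split => //.
rewrite /discrepancy (_ : _ `&` _ = set0) ?measure0//.
by apply/seteqP; split => x // [_] /=.
Qed.

Lemma approximableC A : approximable A -> approximable (~` A).
Proof.
move=> [mA hA]; split; first exact: measurableC.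
move=> e /hA[n [B [gB AB]]]; exists n, (~` B); split; first exact: goodC.
rewrite /discrepancy (_ : [set x | _] = [set x | A x <> B x])//.
apply/seteqP; split => x /= H AB'; apply: H; first by rewrite /setC/= AB'.
by apply/propext; split => ?; apply: contrapT => ?; move: AB'; rewrite /setC/= => /propeqP; tauto.
Qed.

Lemma approximableU A B : approximable A -> approximable B -> approximable (A `|` B).
Proof.
move=> [mA hA] [mB hB]; split; first exact: measurableU.
move=> e e0; have e2 : (0 < e / 2)%R by rewrite divr_gt0.
have [n [A' [gA' AA']]] := hA _ e2; have [k [B' [gB' BB']]] := hB _ e2.
exists (k + n)%N, (A' `|` B'); split.
  by apply: goodU; [exact: goodD|rewrite addnC; exact: goodD].
rewrite (splitr e) EFinD; apply: le_lt_trans (lteD AA' BB').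
have mA' := goodm gA'; have mB' := goodm gB'.
apply: (@le_trans _ _ (m ((V `&` [set x | A x <> A' x]) `|` (V `&` [set x | B x <> B' x])))).
  apply: le_measure; rewrite ?inE.
  - by apply: measurable_discrepancy; exact: measurableU.
  - by apply: measurableU; exact: measurable_discrepancy.
  - move=> x [Vx /= AB].
    have [AA|AA] := pselect (A x = A' x); last by left; split.
    by right; split => //= BB; apply: AB; rewrite /setU/= AA BB.
by apply: measureU2; exact: measurable_discrepancy.
Qed.

(** A countable union is first replaced by a finite one: the remainders within [V] decrease to the
    empty set, and [V] has finite measure. *)
Lemma approximable_sigma_algebra : approximable set0 -> sigma_algebra setT approximable.
Proof.
move=> h0; split => //; first by move=> A hA; rewrite setTD; exact: approximableC.
move=> A hA; pose F n := \big[setU/set0]_(i < n) A i.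
have hF n : approximable (F n).
  by rewrite /F; elim/big_ind : _ => //; exact: approximableU.
have mA i : measurable (A i) by case: (hA i).
have mUA : measurable (\bigcup_i A i) by exact: bigcupT_measurable.
split => // e e0; have e2 : (0 < e / 2)%R by rewrite divr_gt0.
have mF n : measurable (F n) by case: (hF n).
have [N HN] : exists N, discrepancy (\bigcup_i A i) (F N) < (e / 2)%:E.
  pose G n := V `&` (\bigcup_i A i `\` F n).
  have mG n : measurable (G n) by apply: measurableI => //; exact: measurableD.
  have : m (G n) @[n --> \oo] --> m (\bigcap_n G n).
    apply: nonincreasing_cvg_mu => //.
    - apply: le_lt_trans Voo; apply: le_measure; rewrite ?inE//.
      exact: subIsetl.
    - exact: bigcapT_measurable.
    - move=> n k nk; apply/subsetPset => x [Vx [Ax Fx]]; split => //; split => //.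
      by move: Fx; apply: contra_not; apply: subset_bigsetU.
  rewrite (_ : \bigcap_n G n = set0); last first.
    apply/seteqP; split => // x Gx; have [_ [[i _ Aix] _]] := Gx 0%N I.
    have [_ [_]] := Gx i.+1 I; apply; rewrite /F.
    by rewrite -bigcup_mkord; exists i => //=.
  rewrite measure0 => /fine_cvgP[_ /cvgrPdist_lt/(_ _ e2)] [N _ /(_ N (leqnn _))] /=.
  have GNf : m (G N) \is a fin_num.
    rewrite ge0_fin_numE//; apply: le_lt_trans Voo; apply: le_measure; rewrite ?inE//.
    exact: subIsetl.
  rewrite sub0r normrN ger0_norm ?fine_ge0// -lte_fin fineK// => GN; exists N.
  rewrite /discrepancy (_ : _ `&` _ = G N)//; apply/seteqP; split => x [Vx /= H]; split => //.
    have FA : F N x -> (\bigcup_i A i) x.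
      by rewrite /F -bigcup_mkord => -[i _ Aix]; exists i.
    have [Ax|Ax] := pselect ((\bigcup_i A i) x).
      by split => // Fx; apply: H; apply/propext; split.
    by exfalso; apply: H; apply/propext; split => // /FA.
  by case: H => Ax Fx E; apply: Fx; rewrite -E.
have [n [B [gB FB]]] := (hF N).2 _ e2; exists n, B; split => //.
rewrite (splitr e) EFinD; apply: le_lt_trans (lteD HN FB).
exact: discrepancy_triangle (goodm gB).
Qed.

End approximation.

Lemma ae_fst d d' (X : measurableType d) (Y : measurableType d') (R : realType)
    (m1 : {measure set X -> \bar R}) (m2 : {sigma_finite_measure set Y -> \bar R})
    (P : X -> Prop) :
  {ae m1, forall x, P x} -> {ae (m1 \x m2)%E, forall p, P p.1}.
Proof.
move=> [N [mN N0 PN]]; exists (N `*` setT); split.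
- exact: measurableX.
- by rewrite [LHS]product_measure1E// N0 mul0e.
- by move=> [x y] /= Px; split => //; exact: PN.
Qed.

(** * Conditional probabilities given a factor *)

Section conditional_bound.
Context d d0 (Y : measurableType d) (W : measurableType d0) (R : realType).
Context (m : {measure set Y -> \bar R}) (m0 : {sigma_finite_measure set W -> \bar R}).
Context (q : Y -> W) (K : set W) (A : set Y).
Hypotheses (mq : measurable_fun setT q) (mK : measurable K) (mA : measurable A).
Hypothesis q_pres : forall B, measurable B -> m (q @^-1` B) = m0 B.
Hypothesis Koo : (m0 K < +oo)%E.
Local Open Scope ereal_scope.

(** On [K], [u] is the conditional probability of [C] given [q]; restricting to [K] makes the
    differentiated measure finite. *)
Let trace_density (C : set Y) : measurable C -> exists u : W -> \bar R,
  [/\ measurable_fun setT u, forall x, 0 <= u x, forall x, u x \is a fin_num &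
   forall D, measurable D -> m (q @^-1` (D `&` K) `&` C) = \int[m0]_(x in D) u x].
Proof.
move=> mC.
have mKC : measurable (q @^-1` K `&` C).
  by apply: measurableI => //; exact: measurable_preimage.
pose mr : {measure set Y -> \bar R} := mrestr m mKC.
have mrE D : measurable D -> pushforward mr q D = m (q @^-1` (D `&` K) `&` C).
  by move=> mD; rewrite /pushforward /mr/= /mrestr setIA.
pose th : {measure set W -> \bar R} := pushforward mr q.
have [||u [mu u0 uf uE]] := @finite_density _ _ _ (th mq) m0.
- rewrite /th/= mrE// setTI; apply: le_lt_trans Koo; rewrite -q_pres//.
  apply: le_measure; rewrite ?inE//.
  exact: measurable_preimage.
- move=> D mD D0; rewrite /th/= mrE//; apply/eqP; rewrite -measure_le0 -D0 -q_pres//.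
  have mqD := measurable_preimage mq mD.
  apply: le_measure; rewrite ?inE//; last by move=> y [[]].
  apply: measurableI => //; apply: measurable_preimage => //; exact: measurableI.
- by exists u; split => // D mD; rewrite -mrE// -uE.
Qed.

(* [v] is the minimum of the conditional probabilities of [A] and [~` A] given
   [q], so that [\int v] bounds from below the error of approximating [A] by a
   set depending on [q] only. *)
Lemma conditional_bound : exists v : W -> \bar R,
  [/\ measurable_fun setT v, forall x, 0 <= v x,
   forall D B, measurable D -> D `<=` K -> measurable B ->
     \int[m0]_(x in D) v x <= m (q @^-1` D `&` [set y | A y <> B (q y)]) &
   {ae m0, forall x, K x -> v x = 0} ->
     exists2 B, measurable B & {ae m, forall y, K (q y) -> A y = B (q y)}].
Proof.
have [u [mu u0 uf uE]] := trace_density mA.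
have [u' [mu' u'0 uf' uE']] := trace_density (measurableC mA).
exists (fun x => mine (u x) (u' x)).
have mv : measurable_fun setT (fun x => mine (u x) (u' x)).
  exact: measurable_mine.
split => //.
- by move=> x; rewrite le_min u0 u'0.
- move=> D B mD DK mB.
  have mDB : measurable (D `&` B) by exact: measurableI.
  have mDnB : measurable (D `\` B) by exact: measurableD.
  have mqDB : measurable (q @^-1` (D `&` B `&` K) `&` ~` A).
    apply: measurableI; last exact: measurableC.
    by apply: measurable_preimage => //; exact: measurableI.
  have mqDnB : measurable (q @^-1` ((D `\` B) `&` K) `&` A).
    apply: measurableI => //.
    by apply: measurable_preimage => //; exact: measurableI.
  (* Over [B] the error is the part outside [A], with density [u']; off [B] it is the part inside
     [A], with density [u]. Both densities dominate the minimum. *)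
  apply: (@le_trans _ _ (m (q @^-1` (D `&` B `&` K) `&` ~` A) +
      m (q @^-1` ((D `\` B) `&` K) `&` A))).
    rewrite uE// uE'// -{1}(setUIDK D B) ge0_integral_setU//.
    + apply: leeD; apply: ge0_le_integral => //.
      * by move=> x _; rewrite le_min u0 u'0.
      * exact: measurable_funTS.
      * exact: measurable_funTS.
      * by move=> x _; rewrite ge_min lexx orbT.
      * by move=> x _; rewrite le_min u0 u'0.
      * exact: measurable_funTS.
      * exact: measurable_funTS.
      * by move=> x _; rewrite ge_min lexx.
    + exact: measurable_funTS.
    + by move=> x _; rewrite le_min u0 u'0.
    + by apply/disj_setPS => x [[_ Bx] [_ nBx]]; exact: nBx.
  rewrite -measureU//; last first.
    by apply/seteqP; split => // y [[_ nA] [_ /nA]].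
  apply: le_measure; rewrite ?inE//.
  + exact: measurableU.
  + apply: measurableI; first exact: measurable_preimage.
    exact: measurableC (measurable_eq_set mA (measurable_preimage mq mB)).
  + move=> y [[[[Dy By] _] nA]|[[[Dy By] _] Ay]]; split => //=.
      by move=> AB; apply: nA; rewrite AB.
    by move=> AB; apply: By; rewrite -AB.
(* Almost everywhere on [K] one of [u], [u'] vanishes, so [A] is conditionally null where u = 0 and
   conditionally full where u > 0. *)
- move=> v0; pose B := [set x | 0 < u x].
  have mB : measurable B.
    rewrite -[B]setTI; exact: emeasurable_fun_o_infty.
  exists B => //.
  have h1 : m (q @^-1` (~` B `&` K) `&` A) = 0.
    rewrite uE; last exact: measurableC.
    rewrite (eq_integral (cst 0)) ?integral0// => x; rewrite inE => /= /negP.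
    by rewrite -leNgt => ux; apply/eqP; rewrite eq_le ux u0.
  have h2 : m (q @^-1` (B `&` K) `&` ~` A) = 0.
    have -> : B `&` K = (B `&` K) `&` K by rewrite -setIA setIid.
    rewrite uE'; last exact: measurableI.
    rewrite (ae_eq_integral (cst 0)) ?integral0//.
    - exact: measurableI.
    - exact: measurable_funTS.
    - move: v0; apply: filterS => x v0 [Bx Kx]; have := v0 Kx.
      by rewrite /mine; case: ltP => // _ ux0; move: Bx; rewrite /B/= ux0 ltxx.
  have mh1 : measurable (q @^-1` (~` B `&` K) `&` A).
    apply: measurableI => //; apply: measurable_preimage => //.
    by apply: measurableI => //; exact: measurableC.
  have mh2 : measurable (q @^-1` (B `&` K) `&` ~` A).
    apply: measurableI; last exact: measurableC.
    by apply: measurable_preimage => //; exact: measurableI.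
  have /(ae_measure0 m mh1) := h1; have /(ae_measure0 m mh2) := h2.
  apply: filterS2 => y n2 n1 Kq; apply/propext; split => [Ay|Bq].
    by apply: contrapT => nB; apply: n1.
  by apply: contrapT => nA; apply: n2.
Qed.

End conditional_bound.

Lemma lt_inv_nat (R : realType) (x : \bar R) : (0 < x)%E ->
  exists n : nat, ((n.+1%:R^-1)%:E < x)%E.
Proof.
case: x => [r r0| _|//]; last by exists 0%N; exact: ltry.
have r0' : 0 <= r^-1 by rewrite invr_ge0 ltW.
exists (Num.bound r^-1); rewrite lte_fin -[ltRHS]invrK ltf_pV2 ?posrE ?invr_gt0//.
by apply: lt_le_trans (archi_boundP r0') _; rewrite ler_nat.
Qed.

(** * Ergodicity of products with an extension of an exact map *)

Section product_with_exact_extension.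
Context d d0 d1 (Y : measurableType d) (Y0 : measurableType d0)
  (Z : measurableType d1) (R : realType).
Context (nu : {sigma_finite_measure set Y -> \bar R}).
Context (nu0 : {sigma_finite_measure set Y0 -> \bar R}).
Context (rho : {sigma_finite_measure set Z -> \bar R}).
Context (S Si : Y -> Y) (T0 : Y0 -> Y0) (p : Y -> Y0) (U : Z -> Z).
Context (gens : set (set Y)).
Hypothesis SK : cancel S Si.
Hypotheses (mS : measurable_fun setT S) (mSi : measurable_fun setT Si).
Hypothesis S_pres : forall A, measurable A -> nu (S @^-1` A) = nu A.
Hypotheses (mT0 : measurable_fun setT T0) (mp : measurable_fun setT p).
Hypothesis p_pres : forall A, measurable A -> nu (p @^-1` A) = nu0 A.
Hypothesis pS : {ae nu, forall y, p (S y) = T0 (p y)}.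
Hypothesis gensE : @measurable _ Y = <<s gens >>.
Hypothesis gensF : forall g, gens g -> exists n B, measurable B /\
  {ae nu, forall y, g (iter n S y) = B (p y)}.
Hypothesis exactT0 : forall A, measurable A ->
  (forall n, exists2 B, measurable B & {ae nu0, forall y, A y = B (iter n T0 y)}) ->
  null_or_conull nu0 A.
Hypothesis recS : forall E, measurable E ->
  {ae nu, forall y, E y -> forall m, exists2 n, (m <= n)%N & E (iter n Si y)}.
Hypotheses (mU : measurable_fun setT U)
  (U_pres : forall A, measurable A -> rho (U @^-1` A) = rho A).
Hypothesis rhoT : rho setT = 1%E.
Hypothesis ergU : ergodic rho U.
Hypothesis nu0_gt0 : (0 < nu0 setT)%E.
Local Open Scope ereal_scope.

Local Notation m := (nu \x rho).
Local Notation m0 := (nu0 \x rho).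
Let q : Y * Z -> Y0 * Z := map_pair p id.
Let Q n : Y * Z -> Y * Z := map_pair (iter n S) (iter n U).
Let Q0 n : Y0 * Z -> Y0 * Z := map_pair (iter n T0) (iter n U).

Let mq : measurable_fun setT q.
Proof. exact: measurable_map_pair. Qed.

Let mQ n : measurable_fun setT (Q n).
Proof. by apply: measurable_map_pair; exact: measurable_iter. Qed.

Let mQ0 n : measurable_fun setT (Q0 n).
Proof. by apply: measurable_map_pair; exact: measurable_iter. Qed.

Let q_pres B : measurable B -> m (q @^-1` B) = m0 B.
Proof. by move=> mB; exact: preserving_prod. Qed.

Let Q_pres n B : measurable B -> m (Q n @^-1` B) = m B.
Proof.
move=> mB; apply: preserving_prod => //; try exact: measurable_iter.
  by move=> A mA; exact: preserving_iter.
by move=> A mA; exact: preserving_iter.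
Qed.

Let nsQ n : nonsingular m m (Q n).
Proof. by split => // N mN N0; rewrite Q_pres. Qed.

Let nsq : nonsingular m m0 q.
Proof. by split => // N mN N0; rewrite q_pres. Qed.

Let nsS : nonsingular nu nu S.
Proof. by split => // N mN N0; rewrite S_pres. Qed.

Let p_iter n : {ae nu, forall y, p (iter n S y) = iter n T0 (p y)}.
Proof. exact: iter_intertwine_ae. Qed.

Let qQ n : {ae m, forall x, q (Q n x) = Q0 n (q x)}.
Proof.
have := ae_fst rho (p_iter n); apply: filterS => -[y z] /= H.
by rewrite /q /Q /Q0 /map_pair/= H.
Qed.

Let good n : set (set (Y * Z)) := [set B | measurable B /\
  exists2 B0, measurable B0 & {ae m, forall x, B (Q n x) = B0 (q x)}].

Let goodC n B : good n B -> good n (~` B).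
Proof.
move=> [mB [B0 mB0 BB]]; split; first exact: measurableC.
exists (~` B0); first exact: measurableC.
by move: BB; apply: filterS => x /= ->.
Qed.

Let goodU n A B : good n A -> good n B -> good n (A `|` B).
Proof.
move=> [mA [A0 mA0 AA]] [mB [B0 mB0 BB]]; split; first exact: measurableU.
exists (A0 `|` B0); first exact: measurableU.
by move: AA BB; apply: filterS2 => x; rewrite /setU/= => -> ->.
Qed.

Let Q_iter n k x : Q (n + k) x = Q n (Q k x).
Proof. by rewrite /Q /map_pair/= !iterD. Qed.

Let goodD k n B : good n B -> good (n + k) B.
Proof.
move=> [mB [B0 mB0 BB]]; split => //; exists (Q0 k @^-1` B0).
  exact: measurable_preimage.
have := nonsingular_ae (nsQ k) BB; move: (qQ k); apply: filterS2 => x qx.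
by rewrite Q_iter => ->; rewrite qx.
Qed.

Let good_gens g : gens g -> exists n, good n (g `*` setT).
Proof.
move=> gg; have [n [B [mB gB]]] := gensF gg; exists n; split.
  by apply: measurableX => //; rewrite gensE; exact: sub_sigma_algebra.
exists (B `*` setT); first exact: measurableX.
have := ae_fst rho gB; apply: filterS => -[y z] /= E.
by apply/propext; split => -[H _]; split => //; move: H; rewrite /= E.
Qed.

Let good_Z C : measurable C -> good 0 (setT `*` C).
Proof.
move=> mC; split; first exact: measurableX.
by exists (setT `*` C); [exact: measurableX|exact: aeW].
Qed.

(** The approximable sets form a sigma-algebra, and it contains the rectangles: [gensF] handles the
    generators in [Y], and sets in [Z] are good at level 0. *)
Let measurable_approximable V : measurable V -> m V < +oo ->
  forall A, measurable A -> approximable m V good A.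
Proof.
move=> mV Voo.
have goodm n B : good n B -> measurable B by case.
have goodS n B : good n B -> good n.+1 B by rewrite -addn1; exact: goodD.
have h0 : approximable m V good set0.
  apply: (@approximable_good _ _ _ _ _ _ goodm 0%N); split => //.
  by exists set0 => //; exact: aeW.
have sH := approximable_sigma_algebra mV Voo goodm goodC goodU goodS h0.
have HI A B : approximable m V good A -> approximable m V good B ->
    approximable m V good (A `&` B).
  move=> hA hB; rewrite -(setCK A) -(setCK B) -setCU.
  apply: (approximableC goodC); apply: (approximableU mV goodm goodU goodS);
    exact: (approximableC goodC).
have HX : forall C, measurable C -> approximable m V good (C `*` setT).
  have : sigma_algebra setT [set C : set Y | approximable m V good (C `*` setT)].
    have [_ HC HU] := sH; split.
    - by rewrite /= set0X.
    - move=> C /= /HC; congr (approximable _ _ _ _).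
      by apply/seteqP; split => -[y z]/=; rewrite /setX/=; tauto.
    - move=> F /= /HU; congr (approximable _ _ _ _).
      by apply/seteqP; split => [[y z] [k _ [Fk _]]|[y z] [[k _ Fk] _]];
        [split => //; exists k|exists k].
  move=> sHX C; rewrite gensE; apply: (smallest_sub sHX) => g gg.
  by have [n gn] := good_gens gg; exact: approximable_good gn.
move=> A; rewrite measurable_prod_measurableType; apply: (smallest_sub sH).
move=> _ [C mC [D mD <-]].
rewrite -(setTI D) -(setIT C) setXI; apply: HI; first exact: HX.
exact: (approximable_good m V goodm (good_Z mD)).
Qed.

Section invariant.
Context (A : set (Y * Z)).
Hypothesis mA : measurable A.
Hypothesis AQ : forall x, A (S x.1, U x.2) = A x.

Let A_iter n x : A (Q n x) = A x.
Proof.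
elim: n x => [|n IH] x; first by rewrite /Q /map_pair/=; case: x.
by rewrite -[in LHS]addn1 Q_iter IH; exact: AQ.
Qed.

(* A positive lower bound [e] for the error on the sets [D0] propagates along
   the orbits: cut [E] into the pieces [P n] of the points whose backward
   orbit first returns to [E] at time [n >= k]; then [S^-n (P n)] lies in [E]
   and depends on [p] only, whatever the approximating [B] in [good k]. *)
Let error_propagates (E0 : set Y0) (e : R) k (B : set (Y * Z)) :
  measurable E0 -> nu0 E0 < +oo -> (0 < e)%R ->
  (forall D0 B0, measurable D0 -> D0 `<=` E0 -> measurable B0 ->
    e%:E * nu0 D0 <= m (q @^-1` (D0 `*` setT) `&` [set x | A x <> B0 (q x)])) ->
  good k B ->
  e%:E * nu0 E0 <= discrepancy m ((p @^-1` E0) `*` setT) A B.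
Proof.
move=> mE0 E0oo e0 bound gB.
have mB : measurable B by case: gB.
pose E := p @^-1` E0.
have mE : measurable E by exact: measurable_preimage.
have mSiE j : measurable (iter j Si @^-1` E).
  exact: measurable_preimage (measurable_iter j mSi) mE.
pose ret j : set Y := if (k <= j)%N then E `&` iter j Si @^-1` E else set0.
have mret j : measurable (ret j).
  by rewrite /ret; case: ifP => // _; exact: measurableI.
pose P n := seqDU ret n.
have mP n : measurable (P n) by exact: seqDU_measurable.
have AB : measurable [set x | A x <> B x].
  exact: (measurableC (measurable_eq_set mA mB)).
have piece n : e%:E * nu (P n) <= m ((P n `*` setT) `&` [set x | A x <> B x]).
  have [kn|nk] := leqP k n; last first.
    have -> : P n = set0.
      by rewrite -subset0; apply: subset_trans (@subset_seqDU _ ret n) _; rewrite /ret leqNgt nk.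
    by rewrite measure0 mule0.
  have [_ [B0 mB0 BB0]] := goodD (n - k) gB.
  rewrite subnKC// in BB0.
  (* This is S^-n (P n) read through [p]: from S^n y, the backward point at time j is S^(n-j) y, so
     the return conditions become conditions on the forward orbit of p y under [T0]. *)
  pose D0 := [set y | E0 y /\ E0 (iter n T0 y) /\
    forall j, (k <= j < n)%N -> ~ E0 (iter (n - j) T0 y)].
  have mD0 : measurable D0.
    rewrite (_ : D0 = E0 `&` (iter n T0 @^-1` E0 `&` \bigcap_j
        (if (k <= j < n)%N then ~` (iter (n - j) T0 @^-1` E0) else setT))).
      have mT0E j : measurable (iter j T0 @^-1` E0).
        exact: measurable_preimage (measurable_iter j mT0) mE0.
      apply: measurableI => //; apply: measurableI => //.
      by apply: bigcapT_measurable => j; case: ifP => // _; exact: measurableC.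
    apply/seteqP; split => y [Ey [Eny H]]; split => //; split => // j.
      by move=> _; case: ifP => // /H.
    by move=> jn; have := H j I; rewrite jn.
  have PD : {ae nu, forall y, P n (iter n S y) = D0 (p y)}.
    have := ae_foralln p_iter; apply: filterS => y py.
    have ES i : E (iter i S y) = E0 (iter i T0 (p y)) by rewrite /E /preimage/= py.
    rewrite /P /seqDU /D0 -bigcup_mkord /ret kn; apply/propext; split.
      move=> [[En /= Ey] nret]; split.
        by move: Ey; rewrite (iter_cancel n SK).
      split; first by rewrite -ES.
      move=> j /andP[kj jn] Ej; apply: nret; exists j => //=.
      by rewrite kj; split => //=; rewrite (iter_cancel_le SK (ltnW jn)) ES.
    move=> [/= Ey [En H]]; split.
      by split; [rewrite ES|rewrite /= (iter_cancel n SK)].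
    move=> [j /= jn]; case: ifP => // kj [_ /=].
    rewrite (iter_cancel_le SK (ltnW jn)) ES.
    by apply: H; rewrite kj.
  have mPB : measurable ((P n `*` setT) `&` [set x | A x <> B x]).
    by apply: measurableI => //; exact: measurableX.
  have -> : nu (P n) = nu0 D0.
    transitivity (nu (iter n S @^-1` P n)); first exact/esym/preserving_iter.
    transitivity (nu (p @^-1` D0)); last exact: p_pres.
    apply: measure_ae PD; last exact: measurable_preimage.
    exact: measurable_preimage (measurable_iter n mS) (mP n).
  rewrite -(Q_pres n mPB).
  (* As [A] is invariant, its error against [B] over [P n] is its error against [B0] o q over the
     preimage of [D0]. *)
  apply: le_trans (bound D0 B0 mD0 _ mB0) _; first by move=> y [].
  rewrite le_eqVlt; apply/orP; left; apply/eqP; apply: measure_ae.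
  - apply: measurableI; first by apply: measurable_preimage => //; exact: measurableX.
    exact: measurableC (measurable_eq_set mA (measurable_preimage mq mB0)).
  - exact: measurable_preimage.
  - have := ae_fst rho PD; move: BB0; apply: filterS2 => -[y z] BB0 /= PD'.
    rewrite /preimage/setI/setX/= BB0 A_iter /= PD'//.
(* By recurrence of the inverse map, almost every point of [E] lies in some [P n]. *)
have -> : nu0 E0 = nu (\bigcup_n P n).
  rewrite -p_pres//; apply: measure_ae => //; first exact: bigcupT_measurable.
  have := recS mE; apply: filterS => y rec; rewrite -seqDU_bigcup_eq.
  apply/propext; split => [Ey|[n _]]; last by rewrite /ret; case: ifP => // _ [].
  by have [n kn En] := rec Ey k; exists n => //; rewrite /ret kn.
apply: (@le_trans _ _ (m (\bigcup_n ((P n `*` setT) `&` [set x | A x <> B x])))); last first.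
  apply: le_measure; rewrite ?inE.
  - by apply: bigcupT_measurable => n; apply: measurableI => //; exact: measurableX.
  - by apply: measurableI => //; exact: measurableX.
  - move=> [y z] [n _ [[Py _] H]]; split => //; split => //=.
    have : (\bigcup_n P n) y by exists n.
    by rewrite -seqDU_bigcup_eq => -[j _]; rewrite /ret; case: ifP => // _ [].
have -> : nu (\bigcup_n P n) = \sum_(n <oo) nu (P n).
  apply: measure_semi_bigcup => //; first exact: trivIset_seqDU.
  exact: bigcupT_measurable.
have mPn n : measurable ((P n `*` setT) `&` [set x | A x <> B x]).
  by apply: measurableI => //; exact: measurableX.
have -> : m (\bigcup_n ((P n `*` setT) `&` [set x | A x <> B x])) =
    \sum_(n <oo) m ((P n `*` setT) `&` [set x | A x <> B x]).
  apply: measure_semi_bigcup => //; last exact: bigcupT_measurable.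
  apply: trivIset_setIr; apply/trivIsetP => i j _ _ ij.
  have /trivIsetP/(_ i j I I ij) h := @trivIset_seqDU _ ret.
  by rewrite -setXI [P i `&` P j]h set0X.
rewrite -nneseriesZl//.
by apply: lee_nneseries => [n _ _|n _]; [rewrite mule_ge0// lee_fin ltW|exact: piece].
Qed.

Let section_integral D0 (v : Y0 * Z -> \bar R) : measurable D0 ->
  measurable_fun setT v -> (forall x, 0 <= v x) ->
  \int[m0]_(x in D0 `*` setT) v x = \int[nu0]_(y in D0) \int[rho]_z v (y, z).
Proof.
move=> mD0 mv v0; have mD : measurable (D0 `*` [set: Z]) by exact: measurableX.
rewrite integral_mkcond [RHS]integral_mkcond fubini_tonelli1.
- apply: eq_integral => y _; rewrite /fubini_F !patchE.
  case: ifPn => [yD|yD].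
    apply: eq_integral => z _; rewrite patchE ifT//.
    by move: yD; rewrite !inE.
  rewrite (eq_integral (cst 0)) ?integral0// => z _; rewrite patchE ifF//.
  by apply/negbTE; move: yD; rewrite !notin_setE => yD [].
- exact: (proj1 (measurable_restrictT _ mD) (measurable_funTS mv)).
- by move=> x; rewrite patchE; case: ifP.
Qed.

(** If the bound v were not zero almost everywhere over [K0], its integral over Z would exceed
    1/(n+1) on a set [E n] of positive measure. An approximation of [A] over [E n] with error below
    nu0 (E n) / (n+1) then contradicts [error_propagates]. *)
Let local_factor K0 : measurable K0 -> nu0 K0 < +oo ->
  exists2 B, measurable B & {ae m, forall x, K0 (p x.1) -> A x = B (q x)}.
Proof.
move=> mK0 K0oo; pose K := K0 `*` [set: Z].
have mK : measurable K by exact: measurableX.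
have Koo : m0 K < +oo by rewrite [X in X < _]product_measure1E// rhoT mule1.
have [v [mv v0 vlow vfac]] := @conditional_bound _ _ (Y * Z)%type (Y0 * Z)%type R
  (nu \x rho) (sigma_finite_prod nu0 rho) q K A mq mK mA q_pres Koo.
have me : measurable_fun setT (fun y => \int[rho]_z v (y, z)).
  exact: (measurable_fun_fubini_tonelli_F v).
have [|B mB AB] := vfac; last first.
  by exists B => //; move: AB; apply: filterS => x H Kx; exact: H.
pose E n := K0 `&` [set y | (n.+1%:R^-1)%:E < \int[rho]_z v (y, z)].
have mE n : measurable (E n).
  apply: measurableI => //; rewrite -[X in measurable X]setTI.
  exact: emeasurable_fun_o_infty.
have E0 n : nu0 (E n) = 0.
  apply/eqP/negPn/negP; rewrite -measure_gt0 => E0.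
  have Eoo : nu0 (E n) < +oo.
    by apply: le_lt_trans K0oo; apply: le_measure; rewrite ?inE//; exact: subIsetl.
  have e0 : (0 < n.+1%:R^-1 :> R)%R by rewrite invr_gt0.
  have mV : measurable ((p @^-1` E n) `*` [set: Z]).
    by apply: measurableX => //; exact: measurable_preimage.
  have Voo : m ((p @^-1` E n) `*` [set: Z]) < +oo.
    rewrite [X in X < _]product_measure1E//; last exact: measurable_preimage.
    by rewrite rhoT mule1; apply: le_lt_trans Eoo; rewrite -(p_pres (mE n)) lexx.
  have Ef : nu0 (E n) \is a fin_num by rewrite ge0_fin_numE.
  have nu_pos : (0 < n.+1%:R^-1 * fine (nu0 (E n)))%R.
    by rewrite mulr_gt0// fine_gt0// E0.
  have [k [B [gB AB]]] := (measurable_approximable mV Voo mA).2 _ nu_pos.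
  have bound D0 B0 : measurable D0 -> D0 `<=` E n -> measurable B0 ->
      (n.+1%:R^-1)%:E * nu0 D0 <=
      m (q @^-1` (D0 `*` setT) `&` [set x | A x <> B0 (q x)]).
    move=> mD0 D0E mB0.
    have mD : measurable (D0 `*` [set: Z]) by exact: measurableX.
    apply: le_trans (vlow _ B0 mD _ mB0); last first.
      by move=> [y z] [/D0E[Ky _] _]; split.
    rewrite section_integral// -integral_cst//.
    apply: ge0_le_integral => //.
    - by move=> y _; rewrite lee_fin ltW.
    - exact: measurable_funTS.
    - by move=> y /D0E[_ /ltW].
  have := error_propagates (mE n) Eoo e0 bound gB.
  by rewrite leNgt => /negP; apply; move: AB; rewrite EFinM fineK.
have : {ae nu0, forall y, K0 y -> \int[rho]_z v (y, z) = 0}.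
  have : {ae nu0, forall y n, ~ E n y}.
    by apply: ae_foralln => n; apply/(ae_measure0 nu0 (mE n)); exact: E0.
  apply: filterS => y nE Ky; apply/eqP; rewrite eq_le integral_ge0// andbT.
  rewrite leNgt; apply/negP => /lt_inv_nat[n en].
  by apply: (nE n); split.
move=> H; apply: ae_prodP.
  rewrite (_ : [set x | _] = ~` K `|` v @^-1` [set 0]).
    apply: measurableU; first exact: measurableC.
    exact: measurable_preimage mv (emeasurable_set1 0).
  apply/seteqP; split => [x /= Kx|x /= []//].
  by have [/Kx|] := pselect (K x); [right|left].
move: H; apply: filterS => y H.
have [Ky|Ky] := pselect (K0 y); last by apply: aeW => z [].
have mvy : measurable_fun setT (fun z => v (y, z)).
  exact: measurableT_comp mv (measurable_pair1 y).
have [+ _] := ae_eq_integral_abs rho measurableT mvy.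
rewrite (_ : \int[rho]_(x in _) _ = 0).
  by move=> /(_ erefl); apply: filterS => z + _; apply.
by rewrite -[RHS](H Ky); apply: eq_integral => z _; rewrite gee0_abs.
Qed.

Lemma invariant_factor :
  exists2 B, measurable B & {ae m, forall x, A x = B (q x)}.
Proof.
have [F FT Foo] := sigma_finiteT nu0.
have /choice[B HB] : forall k, exists B, measurable B /\
    {ae m, forall x, F k (p x.1) -> A x = B (q x)}.
  by move=> k; have [mF Fk] := Foo k; have [B mB H] := local_factor mF Fk; exists B.
have mF k : measurable (F k) by case: (Foo k).
exists (\bigcup_k ((F k `*` setT) `&` B k)).
  apply: bigcupT_measurable => k; apply: measurableI; last by case: (HB k).
  exact: measurableX.
have : {ae m, forall x k, F k (p x.1) -> A x = B k (q x)}.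
  by apply: ae_foralln => k; case: (HB k).
apply: filterS => x H; apply/propext; split => [Ax|[k _ [[Fk _] Bk]]].
  have : (\bigcup_k F k) (p x.1) by rewrite -FT.
  by move=> [k _ Fk]; exists k => //; split => //; rewrite -H.
by rewrite (H k).
Qed.

(** For almost every z, the section of [A0] at z is the T0^n-preimage of its section at U^n z for
    all n, hence a tail set. The z with a conull section form an almost invariant set for [U]. *)
Lemma invariant_null_or_conull : null_or_conull m A.
Proof.
have [A0 mA0 AA0] := invariant_factor.
have T0_pres B : measurable B -> nu0 (T0 @^-1` B) = nu0 B.
  move=> mB; have mTB := measurable_preimage mT0 mB.
  rewrite -(p_pres mTB) -(p_pres mB) -[RHS]S_pres; last exact: measurable_preimage.
  have mSp : measurable (S @^-1` (p @^-1` B)).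
    by apply: measurable_preimage => //; exact: measurable_preimage.
  apply: measure_ae => //; first exact: measurable_preimage.
  by move: pS; apply: filterS => y; rewrite /preimage/= => ->.
have nsT0 : nonsingular nu0 nu0 T0 by split => // N mN N0; rewrite T0_pres.
have mQA0 n : measurable (Q0 n @^-1` A0) by exact: measurable_preimage.
have A0Q n : {ae m0, forall x, A0 x = A0 (Q0 n x)}.
  apply/(preserving_ae mq q_pres (measurable_eq_set mA0 (mQA0 n))).
  have := nonsingular_ae (nsQ n) AA0; move: AA0 (qQ n).
  by apply: filterS3 => x; rewrite A_iter /preimage/= => <- <- <-.
have sA0 : {ae rho, forall z n, {ae nu0, forall y, A0 (y, z) = A0 (iter n T0 y, iter n U z)}}.
  by apply: ae_foralln => n; exact: ae_prodCW (A0Q n).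
have mys z : measurable [set y | A0 (y, z)].
  by rewrite (_ : [set y | _] = ysection A0 z);
    [exact: measurable_ysection|apply/seteqP; split => y; rewrite /ysection/= inE].
have dich : {ae rho, forall z, {ae nu0, forall y, ~ A0 (y, z)} \/ {ae nu0, forall y, A0 (y, z)}}.
  move: sA0; apply: filterS => z H.
  apply/(null_or_conullP nu0 (mys z)); apply: exactT0 => // n.
  by exists [set y | A0 (y, iter n U z)]; [exact: mys|exact: H].
pose C := [set z | nu0 (ysection (~` A0) z) = 0].
have CE z : C z <-> {ae nu0, forall y, A0 (y, z)}.
  rewrite /C/= (_ : ysection _ z = ~` [set y | A0 (y, z)]); last first.
    by apply/seteqP; split => y; rewrite /ysection/= inE.
  by rewrite -(ae_measureC0 nu0 (mys z)).
have mC : measurable C.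
  rewrite -[C]setTI.
  exact: (measurable_fun_ysection nu0 (measurableC mA0) measurableT (emeasurable_set1 0)).
have nsU : nonsingular rho rho U by split => // N mN N0; rewrite U_pres.
have PF : ProperFilter (almost_everywhere nu0).
  apply: ae_properfilter_algebraOfSetsType; exact: nu0_gt0.
(* As [nu0] is nonzero, no section is both null and conull; so a conull section at z forces a conull
   section at U z. *)
have CU : {ae rho, forall z, C z = C (U z)}.
  have := nonsingular_ae nsU dich; move: sA0; apply: filterS2 => z /(_ 1%N)/= H D.
  apply/propext; split => /CE; last first.
    by move=> /(nonsingular_ae nsT0) K; apply/CE; move: H K; apply: filterS2 => y ->.
  move=> Cz; case: D => [/(nonsingular_ae nsT0) D|]; last by move=> /CE.
  exfalso; have : {ae nu0, forall y : Y0, False}.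
    by move: H Cz D; apply: filterS3 => y -> .
  by move=> /filter_ex[].
apply/null_or_conullP => //.
have m0A : {ae m0, forall x, ~ A0 x} \/ {ae m0, forall x, A0 x}.
  have /null_or_conullP-/(_ mC)[CN|CC] := ergodic_ae mU U_pres ergU mC CU; [left|right].
    apply: ae_prodCP; first exact: measurableC.
    by move: CN dich; apply: filterS2 => z /CE nC [].
  apply: ae_prodCP => //.
  by move: CC; apply: filterS => z /CE.
case: m0A => H; [left|right]; have := nonsingular_ae nsq H;
  by move: AA0; apply: filterS2 => x ->.
Qed.

End invariant.
End product_with_exact_extension.

(** * Densities and transfer of integrals *)

Section integral_density.
Context d (X : measurableType d) (R : realType).
Context (m m' : {measure set X -> \bar R}) (w : X -> R).
Hypotheses (mw : measurable_fun setT w) (w0 : forall x, 0 <= w x).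
Hypothesis m'E : forall A, measurable A -> (m' A = \int[m]_(x in A) (w x)%:E)%E.
Local Open Scope ereal_scope.
Import HBNNSimple.

Let integral_density_nnsfun (g : {nnsfun X >-> R}) :
  \int[m']_x (g x)%:E = \int[m]_x ((g x)%:E * (w x)%:E).
Proof.
have mg r : measurable (g @^-1` [set r]) by exact: measurable_sfunP.
have mind r : measurable_fun setT (fun x => (r * \1_(g @^-1` [set r]) x)%:E).
  by apply/measurable_EFinP; apply: measurable_funM => //; exact: measurable_indic.
have mwE : measurable_fun setT (fun x => (w x)%:E) by exact/measurable_EFinP.
transitivity (\sum_(r \in range g) (r%:E * m' (g @^-1` [set r]))).
  rewrite integralT_nnsfun sintegralE.
  by apply: eq_fsbigr.
transitivity (\int[m]_x (\sum_(r \in range g) (r * \1_(g @^-1` [set r]) x)%:E * (w x)%:E)).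
  rewrite ge0_integral_fsum//=; last 2 first.
  - by move=> r; apply: emeasurable_funM.
  - by move=> r x _; apply: mule_ge0; [exact: nnfun_muleindic_ge0|rewrite lee_fin].
  apply: eq_fsbigr => r; rewrite inE => -[x0 _ rE].
  have r0 : (0 <= r)%R by rewrite -rE.
  rewrite m'E// integral_mkcond -ge0_integralZl//.
  - apply: eq_integral => x _; rewrite patchE indicE EFinM.
    by case: (x \in _); rewrite ?mule1 ?mule0 ?mul0e.
  - exact: (proj1 (measurable_restrictT _ (mg r)) (measurable_funTS mwE)).
  - by move=> x _; rewrite patchE; case: ifP => _; rewrite lee_fin.
apply: eq_integral => x _; rewrite [in RHS](fimfunE g x) -fsumEFin//.
rewrite ge0_mule_fsuml// => r; exact: nnfun_muleindic_ge0.
Qed.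

Lemma integral_density (f : X -> \bar R) : measurable_fun setT f ->
  (forall x, 0 <= f x) -> \int[m']_x f x = \int[m]_x (f x * (w x)%:E).
Proof.
move=> mf f0; pose h := nnsfun_approx measurableT mf.
have hf x : (h n x)%:E @[n --> \oo] --> f x by exact: cvg_nnsfun_approx.
have ndh x : {homo (fun n => (h n x)%:E) : a b / (a <= b)%N >-> a <= b}.
  by move=> a b ab; rewrite lee_fin; exact/lefP/nd_nnsfun_approx.
transitivity (limn (fun n => \int[m']_x (h n x)%:E)).
  rewrite -monotone_convergence//.
  - by apply: eq_integral => x _; apply/esym/cvg_lim.
  - by move=> n; exact/measurable_EFinP.
  - by move=> n x _; rewrite lee_fin.
under eq_fun do rewrite integral_density_nnsfun.
rewrite -monotone_convergence//.
- apply: eq_integral => x _; apply/cvg_lim => //.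
  by apply: cvgeZr.
- move=> n; apply: emeasurable_funM; exact/measurable_EFinP.
- by move=> n x _; rewrite mule_ge0 ?lee_fin.
- by move=> x _ a b ab; rewrite lee_wpmul2r ?lee_fin//; exact: ndh.
Qed.

End integral_density.

Definition density d (X : measurableType d) (R : realType)
    (m : set X -> \bar R) (w : X -> Rpos R) : set X -> \bar R :=
  fun A => (\int[m]_(x in A) (Rpos_val (w x))%:E)%E.

Section density_measure.
Context d (X : measurableType d) (R : realType).
Context (m : {measure set X -> \bar R}) (w : X -> Rpos R).
Hypothesis mw : measurable_fun setT w.
Local Open Scope ereal_scope.

Let mwE : measurable_fun setT (fun x => (Rpos_val (w x))%:E).
Proof. by apply/measurable_EFinP; exact: measurableT_comp (@measurable_Rpos_val R) mw. Qed.

Let w0 x : 0 <= (Rpos_val (w x))%:E.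
Proof. by rewrite lee_fin ltW// Rpos_val_gt0. Qed.

Let density0 : density m w set0 = 0.
Proof. by rewrite /density integral_set0. Qed.

Let density_ge0 A : 0 <= density m w A.
Proof. by apply: integral_ge0 => x _. Qed.

Let density_sigma_additive : semi_sigma_additive (density m w).
Proof.
move=> F mF tF mUF; rewrite /density ge0_integral_bigcup//; last exact: measurable_funTS.
by apply: is_cvg_ereal_nneg_natsum_cond => n _ _; exact: integral_ge0.
Qed.

HB.instance Definition _ := isMeasure.Build _ _ _ (density m w)
  density0 density_ge0 density_sigma_additive.

End density_measure.

Lemma integral_mrestr d (X : measurableType d) (R : realType)
    (m : {measure set X -> \bar R}) (C : set X) (mC : measurable C) (f : X -> \bar R) : measurable_fun setT f -> (forall x, (0 <= f x)%E) ->
  (\int[mrestr m mC]_x f x = \int[m]_(x in C) f x)%E.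
Proof.
move=> mf f0.
rewrite (@integral_density _ _ _ m (mrestr m mC) (\1_C))//.
- rewrite [RHS]integral_mkcond; apply: eq_integral => x _.
  by rewrite patchE indicE; case: (x \in C); rewrite ?mule1 ?mule0.
- by move=> A mA; rewrite /mrestr integral_indic// setIC.
Qed.

Section transfer.
Context d d' (X : measurableType d) (Y : measurableType d') (R : realType).
Local Open Scope ereal_scope.

(** [f] pushes the restriction of [m] to [A] and the preimage of [B] forward to c times the
    restriction of [m'] to [B]. Markov transitions are integrated in this form, with c a product of
    transition probabilities. *)
Lemma transfer_integral (m : {measure set X -> \bar R})
    (m' : {measure set Y -> \bar R}) (f : X -> Y) (A : set X) (B : set Y) (c : R)
    (h : Y -> \bar R) :
  measurable_fun setT f -> measurable A -> measurable B -> (0 <= c)%R ->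
  (forall D, measurable D -> m (A `&` f @^-1` (D `&` B)) = c%:E * m' (D `&` B)) ->
  measurable_fun setT h -> (forall y, 0 <= h y) ->
  \int[m]_(x in A `&` f @^-1` B) h (f x) = c%:E * \int[m']_(y in B) h y.
Proof.
move=> mf mA mB c0 mm' mh h0.
have mC : measurable (A `&` f @^-1` B).
  by apply: measurableI => //; exact: measurable_preimage.
have mhf := measurableT_comp mh mf.
have hf0 x : 0 <= (h \o f) x by exact: h0.
rewrite -(integral_mrestr m mC mhf hf0).
rewrite -(integral_mrestr m' mB mh h0).
rewrite -(ge0_integral_mscale (mrestr m' mB) measurableT (NngNum c0))//.
apply: (preserving_integral (m' := mscale (NngNum c0) (mrestr m' mB))) => //.
move=> D mD; transitivity (c%:E * m' (D `&` B)) => //.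
by rewrite -mm'// /mrestr preimage_setI setICA.
Qed.

End transfer.

(** * Cylinders and uniqueness of measures *)

Section cylinder_measure_unique.
Context (I : countType) (R : realType) (win : nat -> seq I).
Hypothesis win_mono : forall k l, (k <= l)%N -> {subset win k <= win l}.
Hypothesis win_exh : forall i, exists k, i \in win k.

Definition cylinder (s : seq I) (a : I -> bool) : set (bitspace I) :=
  [set x : bitspace I | forall i, i \in s -> x i = a i].

Lemma measurable_cylinder s a : measurable (cylinder s a).
Proof.
rewrite (_ : cylinder s a = \bigcap_(i in [set` s]) [set x : bitspace I | x i = a i]).
  by apply: fin_bigcap_measurable => // i _; exact: bit_measurable.
by apply/seteqP; split => x H i; exact: H.
Qed.

(** The windows are nested, so two cylinders are disjoint or the one on the larger window is
    contained in the other; [set0] closes the family under intersection. *)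
Let G : set (set (bitspace I)) :=
  [set A | A = set0 \/ exists k a, A = cylinder (win k) a].

Let G_setI : setI_closed G.
Proof.
move=> A B [->|[k [a ->]]]; first by left; rewrite set0I.
move=> [->|[l [b ->]]]; first by left; rewrite setI0.
wlog kl : k l a b / (k <= l)%N => [H|].
  by have [kl|/ltnW lk] := leqP k l; [exact: H|rewrite setIC; exact: H].
have [->|/set0P[x [xa xb]]] := eqVneq (cylinder (win k) a `&` cylinder (win l) b) set0.
  by left.
right; exists l, b; apply/seteqP; split => [y []//|y yb]; split => // i ik.
have il := win_mono kl ik.
by rewrite yb// -xb// xa.
Qed.

Let measurable_G : @measurable _ (bitspace I) = <<s G >>.
Proof.
apply/seteqP; split; last first.
  apply: smallest_sub; first exact: sigma_algebra_measurable.
  by move=> A [->|[k [a ->]]]; [exact: measurable0|exact: measurable_cylinder].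
rewrite bitspace_measurableE; apply: smallest_sub; first exact: smallest_sigma_algebra.
move=> _ [i ->]; have [k ik] := win_exh i.
pose c (s : seq bool) : set (bitspace I) :=
  cylinder (win k) (fun j => nth false s (pickle j)).
rewrite (_ : [set x | _] = \bigcup_(s in [set s | nth false s (pickle i)]) c s).
  apply: (@bigcup_countType_measurable _ (g_sigma_algebraType G)) => s _.
  by apply: sub_sigma_algebra; right; exists k; eexists.
apply/seteqP; split => [x /= xi|x [s /= si /(_ i ik) ->//]].
pose N := (\max_(j <- win k) pickle j).+1.
have winN j : j \in win k -> (pickle j < N)%N.
  by move=> jk; rewrite ltnS; exact: leq_bigmax_seq.
exists (mkseq (fun l => if unpickle l is Some j then x j else false) N).
  by rewrite /= nth_mkseq ?pickleK// winN.
by move=> j jk; rewrite nth_mkseq ?pickleK// winN.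
Qed.

Lemma cylinder_measure_unique (m1 m2 : {measure set (bitspace I) -> \bar R}) :
  (forall k a, m1 (cylinder (win k) a) = m2 (cylinder (win k) a)) ->
  m1 setT = m2 setT -> (m1 setT < +oo)%E ->
  forall A, measurable A -> m1 A = m2 A.
Proof.
move=> H HT Hoo A mA; apply: (finite_measure_unique measurable_G G_setI) => //.
by move=> B [->|[k [a ->]]]; rewrite ?measure0.
Qed.

End cylinder_measure_unique.

Section positive_density.
Context d (X : measurableType d) (R : realType).
Local Open Scope ereal_scope.

(** The Radon-Nikodym density vanishes only on a set that is null for [th], hence for [m], so its
    values there may be changed to positive ones. *)
Lemma positive_density (th m : {measure set X -> \bar R}) :
  th setT < +oo -> m setT < +oo ->
  (forall A, measurable A -> m A = 0 -> th A = 0) ->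
  (forall A, measurable A -> th A = 0 -> m A = 0) ->
  exists r : X -> Rpos R, measurable_fun setT r /\
    forall A, measurable A -> th A = \int[m]_(x in A) (Rpos_val (r x))%:E.
Proof.
move=> thoo moo thm mth.
have sf : sigma_finite setT m.
  apply: fin_num_fun_sigma_finite => //; first by rewrite measure0.
  move=> A mA; rewrite ge0_fin_numE//; apply: le_lt_trans moo.
  by apply: le_measure; rewrite ?inE.
pose m' := HB.pack_for (SigmaFiniteMeasure.type X R) (Measure.sort m)
  (isSFinite.Build _ _ _ _ (sfinite_measure_sigma_finite sf))
  (isSigmaFinite.Build _ _ _ _ sf).
have [u [mu u0 uf uE]] := @finite_density _ _ _ th m' thoo thm.
have {}uE A : measurable A -> th A = \int[m]_(x in A) u x by exact: uE.
have mfu : measurable_fun setT (fun x => fine (u x)).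
  by apply: measurableT_comp.
exists (fun x => to_Rpos (fine (u x))); split; first exact: measurable_to_Rpos.
move=> A mA; rewrite uE//.
have mZ : measurable (u @^-1` [set 0]).
  exact: measurable_preimage mu (emeasurable_set1 0).
have Z0 : m (u @^-1` [set 0]) = 0.
  apply: mth => //; rewrite uE// (eq_integral (cst 0)) ?integral0//.
  by move=> x; rewrite inE.
apply: ae_eq_integral => //.
- exact: measurable_funTS.
- apply/measurable_EFinP/measurable_funTS; apply: measurableT_comp (@measurable_Rpos_val R) _.
  exact: measurable_to_Rpos.
- have /(ae_measure0 m mZ) := Z0; apply: filterS => x ux _.
  rewrite to_RposK ?fineK//.
  rewrite fine_gt0// ltey_eq uf/= lt_neqAle u0 andbT eq_sym andbT.
  by apply/eqP.
Qed.

End positive_density.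

Section nat_cylinders.
Context (R : realType).

Definition ncyl k (c : nat -> bool) : set (bitspace nat) :=
  [set x | forall i, (i <= k)%N -> x i = c i].

Lemma measurable_ncyl k c : measurable (ncyl k c).
Proof.
rewrite (_ : ncyl k c = cylinder (iota 0 k.+1) c); first exact: measurable_cylinder.
apply/seteqP; split => x H i; first by rewrite mem_iota add0n ltnS => /H.
by move=> ik; apply: H; rewrite mem_iota.
Qed.

Lemma ncyl_measure_unique (m1 m2 : {measure set (bitspace nat) -> \bar R}) :
  (forall k c, m1 (ncyl k c) = m2 (ncyl k c)) -> (m1 setT < +oo)%E ->
  forall A, measurable A -> m1 A = m2 A.
Proof.
move=> H m1oo; apply: (@cylinder_measure_unique _ _ (fun k => iota 0 k.+1)) => //.
- by move=> k l kl i; rewrite !mem_iota !add0n => /leq_trans; exact.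
- by move=> i; exists i; rewrite mem_iota add0n ltnSn.
- move=> k c; rewrite (_ : cylinder _ _ = ncyl k c); first exact: H.
  apply/seteqP; split => x Hx i; last by rewrite mem_iota add0n ltnS => /Hx.
  by move=> ik; apply: Hx; rewrite mem_iota.
(* The total masses agree because the space is the disjoint union of two cylinders. *)
- have TE : [set: bitspace nat] = ncyl 0 (fun=> true) `|` ncyl 0 (fun=> false).
    apply/seteqP; split => // x _; case E : (x 0%N); [left|right] => i;
      by rewrite leqn0 => /eqP ->.
  have dis : ncyl 0 (fun=> true) `&` ncyl 0 (fun=> false) = set0.
    by apply/seteqP; split => // x [h1 h2]; have := h1 0%N isT; rewrite (h2 0%N isT).
  by rewrite TE !measureU//; try exact: measurable_ncyl; congr (_ + _)%E; exact: H.
Qed.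

End nat_cylinders.

(** Coordinate 1 of a two-sided point becomes index 0, in accordance with the numbering of one-sided
    sequences. *)
Definition future (x : bitspace int) : bitspace nat := fun n => x n.+1%:Z.
Definition unshift2 (x : bitspace int) : bitspace int := fun i => x (i - 1).

Lemma shift2K : cancel shift2 unshift2.
Proof. by move=> x; apply/funext => i; rewrite /unshift2 /shift2 subrK. Qed.

Lemma unshift2K : cancel unshift2 shift2.
Proof. by move=> x; apply/funext => i; rewrite /unshift2 /shift2 addrK. Qed.

Lemma measurable_shift1 : measurable_fun setT shift1.
Proof. by apply: measurable_fun_bitspace => i; exact: (bit_measurable i.+1 true). Qed.

Lemma measurable_shift2 : measurable_fun setT shift2.
Proof. by apply: measurable_fun_bitspace => i; exact: (bit_measurable (i + 1) true). Qed.

Lemma measurable_unshift2 : measurable_fun setT unshift2.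
Proof. by apply: measurable_fun_bitspace => i; exact: (bit_measurable (i - 1) true). Qed.

Lemma measurable_future : measurable_fun setT future.
Proof. by apply: measurable_fun_bitspace => i; exact: (bit_measurable i.+1%:Z true). Qed.

Lemma future_shift2 x : future (shift2 x) = shift1 (future x).
Proof. by apply/funext => n; rewrite /future /shift2 /shift1 -PoszD addn1. Qed.

(* Words on the integers are pairs [(b, c)] of words on the naturals: [b j] is
   the letter at [- j] and [c i] the letter at [i + 1]. *)
Definition zcyl k n (b c : nat -> bool) : set (bitspace int) :=
  [set x | (forall j, (j < k)%N -> x (- j%:Z) = b j) /\
           (forall i, (i <= n)%N -> x i.+1%:Z = c i)].

Definition zword (b c : nat -> bool) (i : int) : bool :=
  match i with Posz 0 => b 0%N | Posz n.+1 => c n | Negz n => b n.+1 end.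

Lemma zword_neg b c j : zword b c (- j%:Z) = b j.
Proof. by case: j. Qed.

Definition past k (b : nat -> bool) : set (bitspace int) :=
  [set x | forall j, (j < k)%N -> x (- j%:Z) = b j].

Lemma zcylE k n b c : zcyl k n b c = past k b `&` future @^-1` ncyl n c.
Proof. by []. Qed.

Lemma measurable_past k b : measurable (past k b).
Proof.
rewrite (_ : past k b = cylinder [seq - j%:Z | j <- iota 0 k] (zword b b)).
  exact: measurable_cylinder.
apply/seteqP; split => x H i.
  by move=> /mapP[j]; rewrite mem_iota => /H + ->; rewrite zword_neg.
by move=> ik; rewrite H ?zword_neg//; apply: map_f; rewrite mem_iota.
Qed.

Lemma measurable_zcyl k n b c : measurable (zcyl k n b c).
Proof.
rewrite zcylE; apply: measurableI; first exact: measurable_past.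
exact: measurable_preimage measurable_future (measurable_ncyl n c).
Qed.

(** Only cylinders fixing at least two future letters are tested, because the shift moves one of
    them into the past. *)
Lemma zcyl_measure_unique (R : realType) (m1 m2 : {measure set (bitspace int) -> \bar R}) :
  (forall k n b c, m1 (zcyl k n.+1 b c) = m2 (zcyl k n.+1 b c)) ->
  m1 setT = m2 setT -> (m1 setT < +oo)%E ->
  forall A, measurable A -> m1 A = m2 A.
Proof.
move=> H HT m1oo.
pose win k : seq int := [seq - j%:Z | j <- iota 0 k] ++ [seq j.+1%:Z | j <- iota 0 k.+2].
have winP i k : i \in win k <-> (exists2 j, (j < k)%N & i = - j%:Z) \/
    (exists2 j, (j < k.+2)%N & i = j.+1%:Z).
  rewrite /win mem_cat; split => [/orP[|] /mapP[j]|].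
  - by rewrite mem_iota add0n => jk ->; left; exists j.
  - by rewrite mem_iota add0n => jk ->; right; exists j.
  - move=> [|] [j jk ->]; apply/orP; [left|right]; apply/mapP;
      by exists j => //; rewrite mem_iota.
apply: (@cylinder_measure_unique _ _ win) => //.
- move=> k l kl i /winP[|] [j jk ->]; apply/winP; [left|right]; exists j => //.
    exact: leq_trans kl.
  by rewrite (leq_trans jk).
- move=> [[|i]|i].
  + by exists 1%N; apply/winP; left; exists 0%N.
  + by exists i; apply/winP; right; exists i => //; rewrite ltnS leqW.
  + by exists i.+2; apply/winP; left; exists i.+1; rewrite ?NegzE.
- move=> k a.
  rewrite (_ : cylinder _ _ = zcyl k k.+1 (fun j => a (- j%:Z)) (fun i => a i.+1%:Z)); first exact: H.
  apply/seteqP; split => x Hx.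
    by split => [j jk|i ik]; apply: Hx; apply/winP; [left; exists j|right; exists i].
  by case: Hx => Hb Hc i /winP[|] [j jk ->]; [exact: Hb|exact: Hc].
Qed.

(** * Markov measures *)

(** The letter at 1 - j, the right neighbour of the letter [b j] at - j; [c0] is the letter at 1. *)
Definition hist (b : nat -> bool) (c0 : bool) : nat -> bool :=
  fun j => if j is j'.+1 then b j' else c0.

Definition upd (b : nat -> bool) (k : nat) (v : bool) : nat -> bool :=
  fun j => if j == k then v else b j.

Section markov_cylinders.
Context (R : realType) (lam : bool -> R) (P : nat -> bool -> bool -> R).
Context (mu : probability (bitspace nat) R) (mut : probability (bitspace int) R).
Hypotheses (Pstoch : forall n, stochastic (P n))
  (lam_gt0 : forall a, 0 < lam a) (P_gt0 : forall n a b, 0 < P n a b).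
Hypothesis mu_markov : markov_measure lam P mu.
Hypothesis mut_markov : natural_extension_measure lam P mut.

Definition mlaw n (c : nat -> bool) : R :=
  lam (c 0%N) * \prod_(0 <= i < n) P i (c i) (c i.+1).

(** The conditional law of k past letters given the letter [c0] at 1: a chain running backward with
    the constant kernel Q. *)
Definition qlaw k (b : nat -> bool) (c0 : bool) : R :=
  \prod_(0 <= j < k) Qmx lam P (b j) (hist b c0 j).

Lemma mu_ncyl n c : mu (ncyl n c) = (mlaw n c)%:E.
Proof. exact: mu_markov. Qed.

Lemma Qden_gt0 j : 0 < lam false * P 0%N false j + lam true * P 0%N true j.
Proof. by rewrite addr_gt0// mulr_gt0. Qed.

Lemma Qmx_gt0 i j : 0 < Qmx lam P i j.
Proof. by rewrite /Qmx divr_gt0 ?Qden_gt0// mulr_gt0. Qed.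

Lemma Qmx_sum j : Qmx lam P true j + Qmx lam P false j = 1.
Proof. by rewrite /Qmx -mulrDl addrC divff// gt_eqF// Qden_gt0. Qed.

Lemma P_sum n a : P n a true + P n a false = 1.
Proof. by have [_] := Pstoch n a; rewrite big_bool. Qed.

Lemma qlaw_gt0 k b c0 : 0 < qlaw k b c0.
Proof. by apply: prodr_gt0 => j _; exact: Qmx_gt0. Qed.

Lemma qlaw_upd k b c0 v :
  qlaw k.+1 (upd b k v) c0 = qlaw k b c0 * Qmx lam P v (hist b c0 k).
Proof.
have histE j : (j <= k)%N -> hist (upd b k v) c0 j = hist b c0 j.
  by case: j => //= j jk; rewrite /upd ltn_eqF.
have uk : upd b k v k = v by rewrite /upd eqxx.
rewrite /qlaw big_nat_recr//= histE// uk; congr (_ * _).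
apply: eq_big_nat => j /andP[_ jk]; congr (Qmx lam P _ _).
  by rewrite /upd (ltn_eqF jk).
exact: histE (ltnW jk).
Qed.

Lemma mlaw_upd n c v :
  mlaw n.+1 (upd c n.+1 v) = mlaw n c * P n (c n) v.
Proof.
have updE i : (i <= n)%N -> upd c n.+1 v i = c i.
  by move=> ik; rewrite /upd ltn_eqF.
have un : upd c n.+1 v n.+1 = v by rewrite /upd eqxx.
rewrite /mlaw big_nat_recr//= mulrA un !updE//; congr (_ * _ * _).
apply: eq_big_nat => j /andP[_ jn]; congr (P j _ _); apply: updE => //.
exact: ltnW.
Qed.

Let zlaw k n (b c : nat -> bool) : Prop :=
  mut (zcyl k n b c) = (qlaw k b (c 0%N) * mlaw n c)%:E.

Let lower_past k n : (forall b c, zlaw k.+1 n b c) -> forall b c, zlaw k n b c.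
Proof.
move=> H b c.
have E : zcyl k n b c = zcyl k.+1 n (upd b k true) c `|` zcyl k.+1 n (upd b k false) c.
  apply/seteqP; split => [x [Hb Hc]|x [] [Hb Hc]].
  - case xk : (x (- k%:Z)); [left|right]; split => // j; rewrite ltnS leq_eqVlt;
      by rewrite /upd => /orP[/eqP ->|jk]; [rewrite eqxx|rewrite (ltn_eqF jk) Hb].
  - by split => // j jk; rewrite Hb ?leqW// /upd ltn_eqF.
  - by split => // j jk; rewrite Hb ?leqW// /upd ltn_eqF.
rewrite /zlaw; transitivity (mut (zcyl k.+1 n (upd b k true) c) +
    mut (zcyl k.+1 n (upd b k false) c))%E.
  rewrite E; apply: measureU; [exact: measurable_zcyl|exact: measurable_zcyl|].
  apply/seteqP; split => // x [[h _] [h' _]]; have := h k (ltnSn k).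
  by rewrite (h' k (ltnSn k)) /upd eqxx.
rewrite !H !qlaw_upd -EFinD; congr EFin.
by rewrite -mulrDl -mulrDr Qmx_sum mulr1.
Qed.

Let lower_future k n : (forall b c, zlaw k n.+1 b c) -> forall b c, zlaw k n b c.
Proof.
move=> H b c.
have E : zcyl k n b c = zcyl k n.+1 b (upd c n.+1 true) `|` zcyl k n.+1 b (upd c n.+1 false).
  apply/seteqP; split => [x [Hb Hc]|x [] [Hb Hc]].
  - case xk : (x n.+2%:Z); [left|right]; split => // j; rewrite leq_eqVlt;
      by rewrite /upd => /orP[/eqP ->|jk]; [rewrite eqxx|rewrite (ltn_eqF jk) Hc].
  - by split => // j jk; rewrite Hc ?leqW// /upd ltn_eqF// ltnS.
  - by split => // j jk; rewrite Hc ?leqW// /upd ltn_eqF// ltnS.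
rewrite /zlaw; transitivity (mut (zcyl k n.+1 b (upd c n.+1 true)) +
    mut (zcyl k n.+1 b (upd c n.+1 false)))%E.
  rewrite E; apply: measureU; [exact: measurable_zcyl|exact: measurable_zcyl|].
  apply/seteqP; split => // x [[_ h] [_ h']]; have := h n.+1 (leqnn _).
  by rewrite (h' n.+1 (leqnn _)) /upd eqxx.
rewrite !H !mlaw_upd -EFinD; congr EFin.
by rewrite /upd/= -mulrDr -mulrDr P_sum mulr1.
Qed.

Let zlaw_base n b c : zlaw n.+2 n b c.
Proof.
have := mut_markov (zword b c) (ltn0Sn n).
rewrite (_ : [set x | _] = zcyl n.+2 n b c); last first.
  apply/seteqP; split => [x H|x [Hb Hc] i].
    split => [j jn|i jn]; first by rewrite H ?zword_neg//; lia.
    by rewrite H//; lia.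
  case: i => [[|i]|i] hi /=; first by rewrite -(Hb 0%N).
    by apply: Hc; lia.
  by rewrite NegzE; apply: Hb; lia.
rewrite /zlaw => ->; congr EFin.
rewrite -mulrA; congr (_ * (_ * _)).
  apply: eq_big_nat => j _; congr (Qmx lam P _ _).
    by rewrite addrAC subrr add0r zword_neg.
  case: j => [|j]; first by rewrite subr0.
  by rewrite (_ : 1 - j.+1%:Z = - j%:Z) ?zword_neg//; lia.
rewrite big_add1; apply: eq_big_nat => i _; congr (P i _ _).
by rewrite -PoszD addn1.
Qed.

(** The measure is prescribed on symmetric windows. Summing over the outermost letters drops d
    letters of the past ([H1]) or e letters of the future ([H2]), since the columns of Q and the
    rows of each P sum to 1. *)
Lemma mut_zcyl k n b c : mut (zcyl k n b c) = (qlaw k b (c 0%N) * mlaw n c)%:E.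
Proof.
have H1 d : forall k n, (k + d = n.+2)%N -> forall b c, zlaw k n b c.
  elim: d => [|d IH] {}k {}n; first by rewrite addn0 => -> {}b {}c; exact: zlaw_base.
  by rewrite addnS -addSn => kn; apply: lower_past; exact: IH.
have H2 e : forall n, (k <= n.+2 + e)%N -> forall b c, zlaw k n b c.
  elim: e => [|e IH] {}n; first by rewrite addn0 => kn; exact: (H1 (n.+2 - k)%N _ _ (subnKC kn)).
  by rewrite addnS -addSn => kn; apply: lower_future; exact: IH.
by apply: (H2 k); rewrite leq_addl.
Qed.

End markov_cylinders.

Definition bit0 (c0 : bool) : set (bitspace nat) := [set z | z 0%N = c0].

Lemma measurable_bit0 c0 : measurable (bit0 c0).
Proof. exact: bit_measurable. Qed.

Lemma ncyl_bit0 n c b : c 0%N = b -> ncyl n c `&` bit0 b = ncyl n c.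
Proof. by move=> cb; apply/seteqP; split => [x []//|x H]; split => //; rewrite /bit0/= H. Qed.

Lemma ncyl_bit0_neq n c b : c 0%N <> b -> ncyl n c `&` bit0 b = set0.
Proof. by move=> cb; apply/seteqP; split => // x [H xb]; apply: cb; rewrite -H. Qed.

(** * The Markov property of the one-sided and two-sided measures *)

Section markov_transfer.
Context (R : realType) (lam : bool -> R) (P : nat -> bool -> bool -> R).
Context (mu : probability (bitspace nat) R) (mut : probability (bitspace int) R).
Hypotheses (Pstoch : forall n, stochastic (P n))
  (lam_gt0 : forall a, 0 < lam a) (P_gt0 : forall n a b, 0 < P n a b).
Hypothesis mu_markov : markov_measure lam P mu.
Hypothesis mut_markov : natural_extension_measure lam P mut.
Local Open Scope ereal_scope.

Lemma transfer_cylinder d (X : measurableType d) (m : probability X R)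
    (m' : {measure set (bitspace nat) -> \bar R}) (f : X -> bitspace nat)
    (A : set X) (B : set (bitspace nat)) (c : R) :
  measurable_fun setT f -> measurable A -> measurable B -> (0 <= c)%R ->
  (forall k w, m (A `&` f @^-1` (ncyl k w `&` B)) = c%:E * m' (ncyl k w `&` B)) ->
  forall D, measurable D -> m (A `&` f @^-1` (D `&` B)) = c%:E * m' (D `&` B).
Proof.
move=> mf mA mB c0 H D mD.
have mC : measurable (A `&` f @^-1` B).
  by apply: measurableI => //; exact: measurable_preimage.
pose m1 : {measure set (bitspace nat) -> \bar R} := pushforward (mrestr m mC) f.
have E D' : m1 mf D' = m (A `&` f @^-1` (D' `&` B)).
  by rewrite /m1/= /pushforward /mrestr preimage_setI setICA.
transitivity (m1 mf D); first by rewrite E.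
transitivity (mscale (NngNum c0) (mrestr m' mB) D) => //.
apply: ncyl_measure_unique => //.
- by move=> k w; rewrite E H.
- apply: (@le_lt_trans _ _ (m setT)); last by rewrite probability_setT ltry.
  rewrite E; apply: le_measure; rewrite ?inE//.
  apply: measurableI => //; apply: measurable_preimage => //.
  exact: measurableI.
Qed.

(** Given the letter at 1, past and future are independent; on cylinders this is the product form of
    [mut_zcyl]. *)
Lemma past_future k b c0 D : measurable D ->
  mut (past k b `&` future @^-1` (D `&` bit0 c0)) =
  (qlaw lam P k b c0)%:E * mu (D `&` bit0 c0).
Proof.
apply: transfer_cylinder.
- exact: measurable_future.
- exact: measurable_past.
- exact: measurable_bit0.
- exact/ltW/qlaw_gt0.
- move=> n w; have [wc|wc] := eqVneq (w 0%N) c0.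
    rewrite ncyl_bit0// -zcylE (mut_zcyl Pstoch lam_gt0 P_gt0 mut_markov) EFinM wc.
    by congr (_ * _); exact/esym/mu_ncyl.
  by rewrite ncyl_bit0_neq ?preimage_set0 ?setI0 ?measure0 ?mule0//; apply/eqP.
Qed.

Lemma future_pres D : measurable D -> mut (future @^-1` D) = mu D.
Proof.
move=> mD; have H c0 : mut (future @^-1` (D `&` bit0 c0)) = mu (D `&` bit0 c0).
  have := past_future 0 (fun=> true) c0 mD.
  rewrite (_ : past 0 _ = setT); last by apply/seteqP; split.
  by rewrite setTI => ->; rewrite /qlaw big_geq// mul1e.
have mI c0 : measurable (D `&` bit0 c0) by apply: measurableI => //; exact: measurable_bit0.
have DE : D = (D `&` bit0 true) `|` (D `&` bit0 false).
  apply/seteqP; split => [z Dz|z [[]|[]]]//.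
  by case E : (z 0%N); [left|right].
have dis : (D `&` bit0 true) `&` (D `&` bit0 false) = set0.
  by apply/seteqP; split => // z [[_ z1] [_]]; rewrite /bit0/= z1.
rewrite DE preimage_setU; transitivity (mut (future @^-1` (D `&` bit0 true)) +
    mut (future @^-1` (D `&` bit0 false))).
  apply: measureU; try exact: measurable_preimage measurable_future _.
  by rewrite -preimage_setI dis preimage_set0.
by rewrite !H; apply/esym; apply: measureU.
Qed.

(** This is the origin of Q: [Qmx lam P a b] is the conditional probability of the first letter a,
    given that the rest of the sequence begins with b, whatever follows. *)
Lemma one_step a b D : measurable D ->
  mu (bit0 a `&` shift1 @^-1` (D `&` bit0 b)) =
  (Qmx lam P a b)%:E * mu (shift1 @^-1` (D `&` bit0 b)).
Proof.
move=> mD; pose muT : {measure set (bitspace nat) -> \bar R} := pushforward mu shift1.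
apply: (transfer_cylinder (m' := muT measurable_shift1)) => //.
- exact: measurable_shift1.
- exact: measurable_bit0.
- exact: measurable_bit0.
- exact/ltW/Qmx_gt0.
- move=> n w; have [wb|wb] := eqVneq (w 0%N) b; last first.
    rewrite ncyl_bit0_neq ?preimage_set0 ?setI0 ?measure0 ?mule0//; exact/eqP.
  rewrite ncyl_bit0//.
  have E a' : bit0 a' `&` shift1 @^-1` ncyl n w = ncyl n.+1 (hist w a').
    apply/seteqP; split => [x [xa xw] [//|i]|x H]; first by rewrite ltnS => /xw.
    by split; [rewrite /bit0/= H|move=> i ni; rewrite [LHS](H i.+1)].
  have mE a' : measurable (ncyl n.+1 (hist w a')) by exact: measurable_ncyl.
  have TE : shift1 @^-1` ncyl n w = ncyl n.+1 (hist w true) `|` ncyl n.+1 (hist w false).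
    rewrite -!E -setIUl (_ : bit0 true `|` bit0 false = setT) ?setTI//.
    by apply/seteqP; split => // x _; case xE : (x 0%N); [left|right].
  have dis : ncyl n.+1 (hist w true) `&` ncyl n.+1 (hist w false) = set0.
    by apply/seteqP; split => // x [h1 h2]; have := h1 0%N isT; rewrite (h2 0%N isT).
  transitivity ((Qmx lam P a b)%:E * (mu (ncyl n.+1 (hist w true)) +
      mu (ncyl n.+1 (hist w false)))); last first.
    by congr (_ * _); rewrite /muT/= /pushforward TE; apply/esym; exact: measureU.
  rewrite E !(mu_ncyl mu_markov) -EFinD -EFinM; congr EFin.
  have lE a' : mlaw lam P n.+1 (hist w a') =
      (lam a' * P 0 a' b * \prod_(0 <= i < n) P i.+1 (w i) (w i.+1))%R.
    by rewrite /mlaw big_nat_recl//= mulrA wb.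
  rewrite !lE /Qmx; field.
  by have := Qden_gt0 lam_gt0 P_gt0 b; lra.
Qed.

End markov_transfer.

Definition image_measure d d' (X : measurableType d) (Y : measurableType d')
    (R : realType) (m : {measure set X -> \bar R}) (f : X -> Y)
    (mf : measurable_fun setT f) : {measure set Y -> \bar R} :=
  measure_function_pushforward__canonical__measure_function_Measure m mf.

Lemma measurable_Rpos_valE d (X : measurableType d) (R : realType)
    (r : X -> Rpos R) : measurable_fun setT r ->
  measurable_fun setT (fun x => (Rpos_val (r x))%:E).
Proof.
by move=> mr; apply/measurable_EFinP; exact: measurableT_comp (@measurable_Rpos_val R) mr.
Qed.

Lemma Rpos_valE_ge0 (R : realType) (t : Rpos R) : (0 <= (Rpos_val t)%:E)%E.
Proof. by rewrite lee_fin ltW// Rpos_val_gt0. Qed.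

Section markov_density.
Context (R : realType) (lam : bool -> R) (P : nat -> bool -> bool -> R).
Context (mu : probability (bitspace nat) R) (mut : probability (bitspace int) R).
Hypotheses (Pstoch : forall n, stochastic (P n))
  (lam_gt0 : forall a, 0 < lam a) (P_gt0 : forall n a b, 0 < P n a b).
Hypothesis mu_markov : markov_measure lam P mu.
Hypothesis mut_markov : natural_extension_measure lam P mut.
Local Open Scope ereal_scope.
Local Notation muT := (image_measure mu measurable_shift1).

(** The derivative of mu by mu o T^-1 is taken, in this direction, because composing it with T gives
    the density of the two-sided shift ([natural_extension_density]). *)
Lemma image_shift_density : measure_equiv (fun A => mu (shift1 @^-1` A)) mu ->
  exists rho : bitspace nat -> Rpos R, measurable_fun setT rho /\
    forall A, measurable A -> mu A = \int[muT]_(x in A) (Rpos_val (rho x))%:E.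
Proof.
move=> [H1 H2]; apply: positive_density.
- by rewrite [X in X < _](@probability_setT _ _ _ mu) ltry.
- by rewrite [X in X < _](@probability_setT _ _ _ mu) ltry.
- move=> A mA A0; apply: (H2 A) => // B mB BA; apply/eqP.
  by rewrite -measure_le0 -A0; apply: (le_measure muT); rewrite ?inE.
- by move=> A mA A0; apply: (H1 A) => // B mB BA; apply/eqP;
    rewrite -measure_le0 -A0; apply: (le_measure mu); rewrite ?inE.
Qed.

Context (rho : bitspace nat -> Rpos R).
Hypothesis mrho : measurable_fun setT rho.
Hypothesis rhoE : forall A, measurable A ->
  mu A = \int[muT]_(x in A) (Rpos_val (rho x))%:E.

Lemma shift_density_integral (h : bitspace nat -> \bar R) :
  measurable_fun setT h -> (forall z, 0 <= h z) ->
  \int[mu]_z h z = \int[muT]_z (h z * (Rpos_val (rho z))%:E).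
Proof.
move=> mh h0; apply: integral_density => //.
- exact: measurableT_comp (@measurable_Rpos_val R) mrho.
- by move=> z; rewrite ltW// Rpos_val_gt0.
Qed.

Lemma one_step_integral_on a b B (h : bitspace nat -> \bar R) :
  measurable B -> B `<=` bit0 b ->
  measurable_fun setT h -> (forall z, 0 <= h z) ->
  \int[mu]_(x in bit0 a `&` shift1 @^-1` B) h (shift1 x) =
  (Qmx lam P a b)%:E * \int[muT]_(z in B) h z.
Proof.
move=> mB Bb; apply: transfer_integral => //.
- exact: measurable_shift1.
- exact: measurable_bit0.
- exact/ltW/Qmx_gt0.
- move=> D mD; have -> : D `&` B = (D `&` B) `&` bit0 b.
    by apply/seteqP; split => [z [Dz Bz]|z []//]; split => //; exact: Bb.
  by apply: (one_step lam_gt0 P_gt0 mu_markov); exact: measurableI.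
Qed.

(** The integral is split by the second letter, since the factor Q is constant only once that letter
    is fixed. *)
Lemma one_step_integral a (h : bitspace nat -> \bar R) :
  measurable_fun setT h -> (forall z, 0 <= h z) ->
  \int[mu]_(x in bit0 a) h (shift1 x) =
  \int[muT]_z ((Qmx lam P a (z 0%N))%:E * h z).
Proof.
move=> mh h0; have m0 b := measurable_bit0 b.
have mT0 b : measurable (shift1 @^-1` bit0 b).
  exact: measurable_preimage measurable_shift1 (m0 b).
have UE : setT = bit0 true `|` bit0 false.
  by apply/seteqP; split => // z _; case E : (z 0%N); [left|right].
have dis : [disjoint bit0 true & bit0 false].
  by apply/disj_setPS => z [z1 z2]; move: z1; rewrite /bit0/= z2.
have -> : bit0 a = (bit0 a `&` shift1 @^-1` bit0 true) `|`
    (bit0 a `&` shift1 @^-1` bit0 false).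
  by rewrite -setIUr -preimage_setU -UE preimage_setT setIT.
have mhT : measurable_fun setT (fun x => h (shift1 x)).
  exact: measurableT_comp mh measurable_shift1.
rewrite ge0_integral_setU//; last 4 first.
- by apply: measurableI.
- by apply: measurableI.
- exact: measurable_funTS.
- by apply/disj_setPS => x [[_ x1] [_ x2]]; move: x1; rewrite /bit0/= x2.
have m1 : measurable_fun setT (fun z : bitspace nat => (Qmx lam P a (z 0%N))%:E * h z).
  apply: emeasurable_funM => //; apply/measurable_EFinP.
  rewrite (_ : (fun z => _) = (fun z : bitspace nat => if z 0%N then Qmx lam P a true else Qmx lam P a false)).
    by apply: measurable_fun_ifT => //; exact: measurable_bit.
  by apply/funext => z; case: (z 0%N).
rewrite [in RHS]UE ge0_integral_setU//; last 2 first.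
- by rewrite -UE.
- by move=> z _; rewrite mule_ge0// lee_fin ltW// Qmx_gt0.
have E b : \int[mu]_(x in bit0 a `&` shift1 @^-1` bit0 b) h (shift1 x) =
    \int[muT]_(z in bit0 b) ((Qmx lam P a (z 0%N))%:E * h z).
  rewrite (one_step_integral_on a (b := b))// -ge0_integralZl//.
  - by apply: eq_integral => z; rewrite inE => ->.
  - exact: measurable_funTS.
  - by rewrite lee_fin ltW// Qmx_gt0.
by rewrite !E.
Qed.

Lemma qlaw_hist k b c0 c1 :
  qlaw lam P k.+1 (hist b c0) c1 = (Qmx lam P c0 c1 * qlaw lam P k b c0)%R.
Proof. by rewrite /qlaw big_nat_recl. Qed.

Lemma unshift2_zcyl k n b c : unshift2 @^-1` zcyl k n.+1 b c =
  zcyl k.+1 n (hist b (c 0%N)) (c \o succn).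
Proof.
apply/seteqP; split => [y [Hb Hc]|y [Hb Hc]].
  split => [[|j] jk|i ik] /=.
  - by rewrite -(Hc 0%N)// /unshift2; congr (y _); lia.
  - by rewrite -(Hb j)// /unshift2; congr (y _); lia.
  - by rewrite -(Hc i.+1)// /unshift2; congr (y _); lia.
split => [j jk|i ik]; rewrite /unshift2.
  by rewrite (_ : _ - 1 = - j.+1%:Z)%R ?(Hb j.+1)//; lia.
case: i ik => [|i] ik; first by rewrite (_ : _ - 1 = - 0%N%:Z)%R ?(Hb 0%N)//.
by rewrite (_ : _ - 1 = i.+1%:Z)%R ?(Hc i)//; lia.
Qed.

(** On a cylinder both sides equal qlaw k b (c 0) Q(c 0, c 1) times the measure of the future
    without its first letter. On the left, the shift moves that letter into the past; on the right,
    one step of the transfer produces Q and [rhoE] turns the integral against mu o T^-1 into mu. *)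
Lemma natural_extension_density C : measurable C ->
  mut (shift2 @` C) = \int[mut]_(x in C) (Rpos_val (rho (shift1 (future x))))%:E.
Proof.
move=> mC.
have -> : shift2 @` C = unshift2 @^-1` C.
  apply/seteqP; split => [_ [x Cx <-]|y Cy] /=; first by rewrite shift2K.
  by exists (unshift2 y) => //; rewrite unshift2K.
pose w x := rho (shift1 (future x)).
have mw : measurable_fun setT w.
  apply: measurableT_comp mrho _.
  exact: measurableT_comp measurable_shift1 measurable_future.
have mr := measurable_Rpos_valE mrho.
have r0 z : 0 <= (Rpos_val (rho z))%:E by exact: Rpos_valE_ge0.
have mrT : measurable_fun setT (fun z => (Rpos_val (rho (shift1 z)))%:E).
  exact: measurableT_comp mr measurable_shift1.
pose m1 := image_measure mut measurable_unshift2.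
pose m2 : {measure set (bitspace int) -> \bar R} := density mut w.
suff H : forall A, measurable A -> m1 A = m2 mw A by exact: H.
apply: zcyl_measure_unique.
- move=> k n b c; transitivity (mut (unshift2 @^-1` zcyl k n.+1 b c)) => //.
  rewrite unshift2_zcyl (mut_zcyl Pstoch lam_gt0 P_gt0 mut_markov).
  transitivity (\int[mut]_(x in zcyl k n.+1 b c) (Rpos_val (rho (shift1 (future x))))%:E) => //.
  have mn m' c' := measurable_ncyl m' c'.
  rewrite zcylE (transfer_integral (m' := mu) (c := qlaw lam P k b (c 0%N))
    (h := fun z => (Rpos_val (rho (shift1 z)))%:E) measurable_future
    (measurable_past k b) (mn n.+1 c))//.
  + have -> : ncyl n.+1 c = bit0 (c 0%N) `&` shift1 @^-1` ncyl n (c \o succn).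
      apply/seteqP; split => [z H|z [z0 H] [//|i]].
        by split => [|i ik]; [exact: H|exact: (H i.+1)].
      by rewrite ltnS => /H.
    rewrite (one_step_integral_on (c 0%N) (b := c 1%N) (h := fun z => (Rpos_val (rho z))%:E))//.
      rewrite -rhoE// (mu_ncyl mu_markov) -!EFinM; congr EFin.
      by rewrite qlaw_hist mulrA; congr (_ * _)%R; rewrite mulrC.
    by move=> z H; rewrite /bit0/= H.
  + exact/ltW/qlaw_gt0.
  + move=> D mD; have -> : D `&` ncyl n.+1 c = (D `&` ncyl n.+1 c) `&` bit0 (c 0%N).
      by apply/seteqP; split => [z [Dz H]|z []//]; split => //; rewrite /bit0/= H.
    by apply: (past_future Pstoch lam_gt0 P_gt0 mu_markov mut_markov); exact: measurableI.
- transitivity (1 : \bar R); first by apply: probability_setT.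
  transitivity (\int[mut]_x (Rpos_val (rho (shift1 (future x))))%:E) => //.
  rewrite (preserving_integral (m' := mu) (h := fun z => (Rpos_val (rho (shift1 z)))%:E)
    measurable_future)//; last first.
    by move=> A mA; exact: (future_pres Pstoch lam_gt0 P_gt0 mu_markov mut_markov).
  rewrite (preserving_integral (m' := muT) (h := fun z => (Rpos_val (rho z))%:E)
    measurable_shift1)//.
  by rewrite -rhoE// probability_setT.
- by rewrite [X in X < _](@probability_setT _ _ _ mut) ltry.
Qed.

End markov_density.

(** * Jacobians of the powers of the one-sided shift *)

Definition pre n (c : nat -> bool) : set (bitspace nat) :=
  [set x | forall i, (i < n)%N -> x i = c i].

(** The inverse branch of T^n on the cylinder [pre n c]. *)
Definition splice n (c : nat -> bool) (z : bitspace nat) : bitspace nat :=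
  fun i => if (i < n)%N then c i else z (i - n)%N.

Lemma iter_shift1 n (x : bitspace nat) i : iter n shift1 x i = x (i + n)%N.
Proof. by elim: n i => [|n IH] i; rewrite ?addn0//= /shift1 IH addSnnS. Qed.

Lemma iter_shift1_splice n c z : iter n shift1 (splice n c z) = z.
Proof.
by apply/funext => i; rewrite iter_shift1 /splice ltnNge leq_addl/= addnK.
Qed.

Lemma splice_iter n c x : pre n c x -> splice n c (iter n shift1 x) = x.
Proof.
move=> xc; apply/funext => i; rewrite /splice; case: ltnP => [/xc//|ni].
by rewrite iter_shift1 subnK.
Qed.

Lemma measurable_splice n c : measurable_fun setT (splice n c).
Proof.
apply: measurable_fun_bitspace => i; rewrite /splice; case: ltnP => ni.
  case: (c i); first by rewrite (_ : [set _ | _] = setT)//; apply/seteqP; split.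
  by rewrite (_ : [set _ | _] = set0)//; apply/seteqP; split.
exact: (bit_measurable (i - n)%N true).
Qed.

Lemma measurable_pre n c : measurable (pre n c).
Proof.
rewrite (_ : pre n c = cylinder (iota 0 n) c); first exact: measurable_cylinder.
apply/seteqP; split => x H i; first by rewrite mem_iota add0n => /H.
by move=> ni; apply: H; rewrite mem_iota.
Qed.

Section jacobian.
Context (R : realType) (lam : bool -> R) (P : nat -> bool -> bool -> R).
Context (mu : probability (bitspace nat) R).
Hypotheses (lam_gt0 : forall a, 0 < lam a) (P_gt0 : forall n a b, 0 < P n a b).
Hypothesis mu_markov : markov_measure lam P mu.
Local Notation muT := (image_measure mu measurable_shift1).
Context (rho : bitspace nat -> Rpos R).
Hypothesis mrho : measurable_fun setT rho.
Hypothesis rhoE : forall A, measurable A ->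
  (mu A = \int[muT]_(x in A) (Rpos_val (rho x))%:E)%E.
Local Notation Q := (Qmx lam P).

(* The density of mu o T^n with respect to mu, on each cylinder of length n. *)
Fixpoint jac n (x : bitspace nat) : R :=
  if n is n'.+1 then
    Rpos_val (rho (shift1 x)) / Q (x 0%N) (x 1%N) * jac n' (shift1 x)
  else 1.

(** [jac] cut off to the cylinder [pre n c], written recursively so that induction on n can peel off
    the first letter. *)
Fixpoint jac_on n (c : nat -> bool) (x : bitspace nat) : R :=
  if n is n'.+1 then
    (if x 0%N == c 0%N then Rpos_val (rho (shift1 x)) / Q (x 0%N) (x 1%N) else 0) *
    jac_on n' (c \o succn) (shift1 x)
  else 1.

Lemma jac_gt0 n x : 0 < jac n x.
Proof.
elim: n x => //= n IH x; rewrite mulr_gt0// divr_gt0//; first exact: Rpos_val_gt0.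
exact: Qmx_gt0.
Qed.

Lemma jac_onE n c x : jac_on n c x = jac n x * \1_(pre n c) x.
Proof.
elim: n c x => [|n IH] c x /=.
  by rewrite indicE mem_set ?mulr1// => i.
rewrite IH !indicE; case: eqP => x0; last first.
  rewrite mul0r memNset ?mulr0// => /(_ 0%N isT); exact: x0.
rewrite mulrA; congr (_ * (nat_of_bool _)%:R); apply/idP/idP; rewrite !inE.
  by move=> H [//|i] ni; exact: H.
by move=> H i ni; exact: (H i.+1).
Qed.

Lemma measurable_Q : measurable_fun setT (fun x : bitspace nat => Q (x 0%N) (x 1%N)).
Proof.
rewrite (_ : (fun x => _) = (fun x : bitspace nat => if x 0%N
  then (if x 1%N then Q true true else Q true false)
  else (if x 1%N then Q false true else Q false false))).
  by apply: measurable_fun_ifT; [exact: measurable_bit| |];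
    apply: measurable_fun_ifT => //; exact: measurable_bit.
by apply/funext => x; case: (x 0%N); case: (x 1%N).
Qed.

Lemma measurable_jac n : measurable_fun setT (jac n).
Proof.
elim: n => [|n IH]; first exact: measurable_cst.
have -> : jac n.+1 = (fun x => Rpos_val (rho (shift1 x)) * (Q (x 0%N) (x 1%N))^-1 * jac n (shift1 x)) by [].
apply: measurable_funM; last exact: measurableT_comp IH measurable_shift1.
apply: measurable_funM.
  apply: measurableT_comp (@measurable_Rpos_val R) _.
  exact: measurableT_comp mrho measurable_shift1.
apply: measurable_fun_posV; last exact: measurable_Q.
by move=> x; exact: Qmx_gt0.
Qed.

Lemma measurable_jac_on n c : measurable_fun setT (jac_on n c).
Proof.
rewrite (_ : jac_on n c = (fun x => jac n x * \1_(pre n c) x)).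
  apply: measurable_funM; first exact: measurable_jac.
  by apply: measurable_indic; exact: measurable_pre.
by apply/funext => x; rewrite jac_onE.
Qed.

Lemma jac_on_ge0 n c x : 0 <= jac_on n c x.
Proof. by rewrite jac_onE mulr_ge0// ltW// jac_gt0. Qed.

Local Open Scope ereal_scope.

(** Change of variables by T^n from a cylinder onto the whole space. In each step the factor 1/Q
    cancels the Q of [one_step_integral], and [rho] turns mu o T^-1 back into mu. *)
Lemma jac_on_integral n c (phi : bitspace nat -> \bar R) :
  measurable_fun setT phi -> (forall z, 0 <= phi z) ->
  \int[mu]_x ((jac_on n c x)%:E * phi (iter n shift1 x)) = \int[mu]_x phi x.
Proof.
move=> mphi phi0; elim: n c => [|n IH] c.
  by apply: eq_integral => x _; rewrite mul1e.
have mphin : measurable_fun setT (fun x => phi (iter n shift1 x)).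
  exact: measurableT_comp mphi (measurable_iter n measurable_shift1).
pose h (z : bitspace nat) := (jac_on n (c \o succn) z)%:E * phi (iter n shift1 z).
have mh : measurable_fun setT h.
  by apply: emeasurable_funM => //; apply/measurable_EFinP; exact: measurable_jac_on.
have h0 z : 0 <= h z by rewrite mule_ge0// lee_fin jac_on_ge0.
have mr := measurable_Rpos_valE mrho.
have mQ : measurable_fun setT (fun z : bitspace nat => ((Q (c 0%N) (z 0%N))^-1)%:E).
  apply/measurable_EFinP; apply: measurable_fun_posV; first by move=> z; exact: Qmx_gt0.
  rewrite (_ : (fun z => _) = (fun z : bitspace nat => if z 0%N then Q (c 0%N) true else Q (c 0%N) false)).
    by apply: measurable_fun_ifT => //; exact: measurable_bit.
  by apply/funext => z; case: (z 0%N).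
pose g (z : bitspace nat) := ((Q (c 0%N) (z 0%N))^-1)%:E * (h z * (Rpos_val (rho z))%:E).
have mg : measurable_fun setT g.
  by apply: emeasurable_funM => //; exact: emeasurable_funM.
have g0 z : 0 <= g z.
  apply: mule_ge0; first by rewrite lee_fin invr_ge0 ltW// Qmx_gt0.
  by apply: mule_ge0 => //; exact: Rpos_valE_ge0.
transitivity (\int[mu]_(x in bit0 (c 0%N)) g (shift1 x)).
  rewrite [RHS]integral_mkcond; apply: eq_integral => x _; rewrite patchE /=.
  case: eqP => x0; last by rewrite mul0r mul0e memNset.
  rewrite mem_set// /g /h -iterS iterSr x0 (_ : shift1 x 0%N = x 1%N)//.
  rewrite -[X in _ = _ * X]muleA (muleC (phi _)) !muleA -!EFinM; congr (_%:E * _).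
  by ring.
rewrite (one_step_integral lam_gt0 P_gt0 mu_markov)// -(IH (c \o succn)).
rewrite -/(h _) (shift_density_integral mrho rhoE mh h0).
apply: eq_integral => z _; rewrite /g muleA -EFinM divff ?mul1e//.
by rewrite gt_eqF// Qmx_gt0.
Qed.

End jacobian.

Section cocycle_density.
Context (R : realType) (lam : bool -> R) (P : nat -> bool -> bool -> R).
Context (mu : probability (bitspace nat) R).
Hypotheses (lam_gt0 : forall a, 0 < lam a) (P_gt0 : forall n a b, 0 < P n a b).
Hypothesis mu_markov : markov_measure lam P mu.
Local Notation muT := (image_measure mu measurable_shift1).
Context (rho : bitspace nat -> Rpos R).
Hypothesis mrho : measurable_fun setT rho.
Hypothesis rhoE : forall A, measurable A ->
  (mu A = \int[muT]_(x in A) (Rpos_val (rho x))%:E)%E.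
Local Notation J := (jac lam P rho).

Context (g g' : bitspace nat -> bitspace nat) (D0 : bitspace nat -> Rpos R).
Hypotheses (gK : cancel g g') (g'K : cancel g' g).
Hypotheses (mg : measurable_fun setT g) (mg' : measurable_fun setT g').
Hypothesis mD0 : measurable_fun setT D0.
Hypothesis D0E : forall A, measurable A ->
  (mu (g @` A) = \int[mu]_(x in A) (Rpos_val (D0 x))%:E)%E.
Local Open Scope ereal_scope.

Let imgE C : g @` C = g' @^-1` C.
Proof.
apply/seteqP; split => [_ [x Cx <-]|y Cy] /=; first by rewrite gK.
by exists (g' y).
Qed.

Let same n a b : set (bitspace nat) := [set x | [/\ pre n a x, pre n b (g x) &
  iter n shift1 x = iter n shift1 (g x)]].

Let measurable_same n a b : measurable (same n a b).
Proof.
rewrite (_ : same n a b = pre n a `&` (g @^-1` pre n b `&`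
    \bigcap_i [set x : bitspace nat | [set y : bitspace nat | y (i + n)%N = true] x =
      (g @^-1` [set y : bitspace nat | y (i + n)%N = true]) x])).
  apply: measurableI; first exact: measurable_pre.
  apply: measurableI; first exact: measurable_preimage mg (measurable_pre n b).
  apply: bigcapT_measurable => i.
  have mi := bit_measurable (i + n)%N true.
  exact: measurable_eq_set mi (measurable_preimage mg mi).
apply/seteqP; split => x.
  move=> [xa gb H]; split => //; split => // i _ /=.
  by move/(congr1 (@^~ i)) : H; rewrite !iter_shift1 => ->.
move=> [xa [gb H]]; split => //; apply/funext => i; rewrite !iter_shift1.
have := H i I; rewrite /preimage/= => E.
by apply/idP/idP; move: E; rewrite /is_true => ->.
Qed.

Let quot n x : R := (J n x / J n (g x))%R.

Let measurable_quot n : measurable_fun setT (quot n).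
Proof.
apply: measurable_funM; first exact: measurable_jac.
apply: measurable_fun_posV; first by move=> x; exact: jac_gt0.
exact: measurableT_comp (measurable_jac lam_gt0 P_gt0 mrho n) mg.
Qed.

(* Both sides are integrals of functions of T^n x against the density of
   mu o T^n, over the cylinders [pre n a] and [pre n b] respectively. *)
Let same_density n a b C : measurable C -> C `<=` same n a b ->
  mu (g @` C) = \int[mu]_(x in C) (quot n x)%:E.
Proof.
move=> mC Cs; pose D := splice n a @^-1` C.
have mD : measurable D by exact: measurable_preimage (measurable_splice n a) mC.
(* Over [pre n b], [jac_on_integral] cancels [psi] and leaves mu (g C). Over [pre n a] it leaves J n
   x / J n (g x), because g x is the point of [pre n b] above T^n x. *)
pose psi z := J n (splice n b z).
have psi_gt0 z : (0 < psi z)%R by exact: jac_gt0.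
pose phi z := (\1_D z / psi z)%:E.
have mphi : measurable_fun setT phi.
  apply/measurable_EFinP; apply: measurable_funM; first exact: measurable_indic.
  apply: measurable_fun_posV => //.
  exact: measurableT_comp (measurable_jac lam_gt0 P_gt0 mrho n) (measurable_splice n b).
have phi0 z : 0 <= phi z by rewrite lee_fin divr_ge0// ltW.
have JI c := jac_on_integral lam_gt0 P_gt0 mu_markov mrho rhoE n c mphi phi0.
transitivity (\int[mu]_x phi x); last first.
  rewrite -(JI a) [RHS]integral_mkcond; apply: eq_integral => x _.
  rewrite patchE /phi -EFinM jac_onE !indicE.
  have [Cx|Cx] := pselect (C x); [rewrite (mem_set Cx)|rewrite (memNset Cx)].
    have [xa gxb E] := Cs _ Cx.
    rewrite !mem_set//; last by rewrite /D/= splice_iter.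
    by rewrite /= mulr1 mul1r /psi E splice_iter.
  have [xa|xa] := pselect (pre n a x); last by rewrite (memNset xa) mulr0 mul0r.
  have nD : ~ D (iter n shift1 x) by rewrite /D/= splice_iter.
  by rewrite (memNset nD) mul0r mulr0.
have mgC : measurable (g @` C) by rewrite imgE; exact: measurable_preimage.
rewrite -(JI b) -[X in mu X]setIT -integral_indic//; apply: eq_integral => y _.
rewrite /phi -EFinM jac_onE !indicE; congr EFin.
have [yC|yC] := pselect ((g @` C) y).
  rewrite mem_set//; case: yC => x Cx gx; have [xa gxb E] := Cs _ Cx.
  rewrite -gx !mem_set//; last by rewrite /D/= -E splice_iter.
  by rewrite /= mulr1 mul1r /psi splice_iter// divff// gt_eqF// jac_gt0.
rewrite memNset//; have [yb|yb] := pselect (pre n b y); last first.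
  by rewrite (memNset yb) mulr0 mul0r.
rewrite (memNset (_ : ~ D (iter n shift1 y))) ?mul0r ?mulr0// => Dy; apply: yC; exists (splice n a (iter n shift1 y)) => //.
have [xa gxb E] := Cs _ Dy.
by rewrite -(splice_iter gxb) -E iter_shift1_splice splice_iter.
Qed.

(** For fixed n, the pieces [same n a b] are countably many once a and b are coded by finite words,
    and on each of them densities are unique almost everywhere. *)
Lemma cocycle_density : {ae mu, forall x, forall n,
  iter n shift1 x = iter n shift1 (g x) ->
  (Rpos_val (D0 x) = J n x / J n (g x))%R}.
Proof.
apply: ae_foralln => n.
pose word (s : seq bool) i := nth false s i.
have key (s : seq bool * seq bool) : {ae mu, forall x, same n (word s.1) (word s.2) x ->
    (Rpos_val (D0 x))%:E = (quot n x)%:E}.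
  set Y := same n (word s.1) (word s.2).
  have mY : measurable Y by exact: measurable_same.
  apply: integral_ae_eq => //.
  - apply/integrableP; split.
      exact: measurable_funTS (measurable_Rpos_valE mD0).
    under eq_integral do rewrite gee0_abs ?Rpos_valE_ge0//.
    rewrite -D0E// (le_lt_trans _ (ltry 1))// probability_le1//.
    by rewrite imgE; exact: measurable_preimage.
  - by apply: measurable_funTS; apply/measurable_EFinP; exact: measurable_quot.
  - by move=> C CY mC; rewrite -D0E//; exact: same_density CY.
have {}key : {ae mu, forall x k, forall s : seq bool * seq bool, unpickle k = Some s ->
    same n (word s.1) (word s.2) x -> (Rpos_val (D0 x))%:E = (quot n x)%:E}.
  apply: ae_foralln => k; case: (unpickle k) => [s|]; last exact: aeW.
  by move: (key s); apply: filterS => x H _ [<-].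
move: key; apply: filterS => x H E.
pose s (y : bitspace nat) := mkseq y n.
have sE y : pre n (word (s y)) y by move=> i ni; rewrite /word nth_mkseq.
by apply: EFin_inj; apply: (H _ _ (pickleK (s x, s (g x))));
  split => //; exact: sE.
Qed.

End cocycle_density.

Lemma delta_cocycleE (R : realType) (lam : bool -> R) (P : nat -> bool -> bool -> R)
    (x y : bitspace nat) n : iter n shift1 x = iter n shift1 y ->
  (forall a, 0 < lam a) -> (forall n a b, 0 < P n a b) ->
  delta_cocycle lam P x y = \prod_(0 <= i < n)
    (Qmx lam P (y i) (y i.+1) / Qmx lam P (x i) (x i.+1)).
Proof.
move=> xy lam_gt0 P_gt0; apply/cvg_lim => //.
apply: cvg_near_cst; exists n => // m /= nm.
rewrite (big_cat_nat (n := n))//= [X in _ * X]big1_seq ?mulr1// => i.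
rewrite andTb mem_index_iota => /andP[ni _].
have E j : (n <= j)%N -> x j = y j.
  move=> nj; move/(congr1 (@^~ (j - n)%N)) : xy.
  by rewrite !iter_shift1 subnK.
rewrite (E _ ni) (E _ (leqW ni)) divff// gt_eqF//; exact: Qmx_gt0.
Qed.

(** * Exactness of the extended one-sided shift *)

Section exactness.
Context (R : realType) (lam : bool -> R) (P : nat -> bool -> bool -> R).
Context (mu : probability (bitspace nat) R).
Context (chi kappa : {sigma_finite_measure set (Rpos R) -> \bar R}).
Context (Delta : bitspace nat -> bitspace nat -> Rpos R).
Hypotheses (lam_gt0 : forall a, 0 < lam a) (P_gt0 : forall n a b, 0 < P n a b).
Hypothesis mu_markov : markov_measure lam P mu.
Local Notation muT := (image_measure mu measurable_shift1).
Context (rho : bitspace nat -> Rpos R).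
Hypothesis mrho : measurable_fun setT rho.
Hypothesis rhoE : forall A, measurable A ->
  (mu A = \int[muT]_(x in A) (Rpos_val (rho x))%:E)%E.
Hypotheses (hchi : is_haar chi) (hkappa : is_maharam_fiber kappa).
Local Notation S := (tail_equivalent shift1).
Hypothesis Delta_RN : is_RN_cocycle S mu Delta.
Local Notation delta := (delta_cocycle lam P).
Hypothesis erg : cocycle_ergodic chi mu S
  (fun x y => Rpos_val (Delta x y) / delta x y).
Local Notation Q := (Qmx lam P).
Local Notation J := (jac lam P rho).

Definition shift_ext := skew_product shift1 (rho \o shift1).

Lemma measurable_shift_ext : measurable_fun setT shift_ext.
Proof.
apply: measurable_skew; first exact: measurable_shift1.
exact: measurableT_comp mrho measurable_shift1.
Qed.

Let Qprod n (x : bitspace nat) : R := \prod_(0 <= i < n) Q (x i) (x i.+1).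

Let Qprod_gt0 n x : 0 < Qprod n x.
Proof. by apply: prodr_gt0 => i _; exact: Qmx_gt0. Qed.

Let iter_ext n x t : iter n shift_ext (x, t) =
  (iter n shift1 x, Rpos_mul (iter n shift_ext (x, Rpos_one R)).2 t).
Proof. by rewrite [LHS]surjective_pairing iter_skew1 /shift_ext iter_skew2. Qed.

(** Hence (x, t) and (y, s) with T^n x = T^n y have the same image iff s / t is the quotient of J at
    x and y, which is Delta, divided by that of [Qprod] at y and x, which is delta. *)
Let iter_ext_val n x :
  Rpos_val (iter n shift_ext (x, Rpos_one R)).2 = J n x * Qprod n x.
Proof.
elim: n x => [|n IH] x; first by rewrite /Qprod big_geq// mulr1.
transitivity (Rpos_val (iter n shift_ext (shift1 x, Rpos_one R)).2 * Rpos_val (rho (shift1 x))).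
  rewrite iterSr (_ : shift_ext (x, Rpos_one R) = (shift1 x, rho (shift1 x))).
    by rewrite iter_ext.
  by rewrite /shift_ext /skew_product/= Rpos_mulC Rpos_mul1.
rewrite IH.
rewrite /Qprod [in RHS]big_nat_recl//=.
have -> : \prod_(0 <= i < n) Q (x i.+1) (x i.+2) = Qprod n (shift1 x) by [].
rewrite /=; field.
by rewrite gt_eqF// Qmx_gt0.
Qed.

Let deltaE n x y : iter n shift1 x = iter n shift1 y ->
  delta x y = Qprod n y / Qprod n x.
Proof.
by move=> xy; rewrite (delta_cocycleE xy)// prodf_div.
Qed.

Let delta_gt0 x y : S x y -> 0 < delta x y.
Proof. by move=> [n xy]; rewrite (deltaE xy) divr_gt0. Qed.

Let delta_mul x y z : S x y -> S y z -> delta x z = delta x y * delta y z.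
Proof.
move=> [n xy] [k yz].
have xy' : iter (n + k) shift1 x = iter (n + k) shift1 y.
  by rewrite addnC !iterD xy.
have yz' : iter (n + k) shift1 y = iter (n + k) shift1 z by rewrite !iterD yz.
rewrite (deltaE (etrans xy' yz')) (deltaE xy') (deltaE yz').
by field; rewrite !gt_eqF.
Qed.

(** [delta] along g is a pointwise limit of measurable partial products, eventually constant at each
    point. *)
Let measurable_delta g : measurable_fun setT g -> (forall x, S x (g x)) ->
  measurable_fun setT (fun x => delta x (g x)).
Proof.
move=> mg Sg.
pose h m (x : bitspace nat) : R := \prod_(0 <= i < m)
  (Q (g x i) (g x i.+1) / Q (x i) (x i.+1)).
have mQ i : measurable_fun setT (fun x : bitspace nat => Q (x i) (x i.+1)).
  have -> : (fun x : bitspace nat => Q (x i) (x i.+1)) =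
      (fun x : bitspace nat => Q (x 0%N) (x 1%N)) \o iter i shift1.
    by apply/funext => x /=; rewrite !iter_shift1 add0n.
  exact: measurableT_comp (measurable_Q lam P) (measurable_iter i measurable_shift1).
apply: (measurable_fun_cvg (h := h)).
- elim=> [|m IH].
    have -> : h 0%N = cst 1 by apply/funext => x; rewrite /h big_geq.
    exact: measurable_cst.
  have -> : h m.+1 = (fun x => h m x * (Q (g x m) (g x m.+1) / Q (x m) (x m.+1))).
    by apply/funext => x; rewrite /h big_nat_recr.
  apply: measurable_funM => //.
  apply: measurable_funM; first exact: measurableT_comp (mQ m) mg.
  by apply: measurable_fun_posV => // x; exact: Qmx_gt0.
- move=> x _; have [n xg] := Sg x; apply: cvg_near_cst; exists n => // m /= nm.
  apply/esym/delta_cocycleE => //.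
  by rewrite -(subnK nm) !iterD xg.
Qed.

Let ratio x y : Rpos R := to_Rpos (Rpos_val (Delta x y) / delta x y).

Let ratioE x y : S x y -> Rpos_val (ratio x y) = Rpos_val (Delta x y) / delta x y.
Proof. by move=> xy; rewrite to_RposK// divr_gt0 ?delta_gt0 ?Rpos_val_gt0. Qed.

Let lift (g : bitspace nat -> bitspace nat) := skew_product g (fun x => ratio x (g x)).

Let iter_lift g n x t : iter n shift1 x = iter n shift1 (g x) ->
  Rpos_val (Delta x (g x)) = J n x / J n (g x) ->
  iter n shift_ext (lift g (x, t)) = iter n shift_ext (x, t).
Proof.
move=> xg dens.
have Sxg : S x (g x) by exists n.
have -> : lift g (x, t) = (g x, Rpos_mul (ratio x (g x)) t) by [].
rewrite (iter_ext n (g x)) (iter_ext n x) -xg.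
apply: (congr1 (pair _)); apply: Rpos_val_inj.
rewrite [LHS]Rpos_val_mul [RHS]Rpos_val_mul [in LHS]Rpos_val_mul !iter_ext_val.
rewrite (ratioE Sxg) dens (deltaE xg).
have := jac_gt0 lam_gt0 P_gt0 rho n x; have := jac_gt0 lam_gt0 P_gt0 rho n (g x).
have := Qprod_gt0 n x; have := Qprod_gt0 n (g x).
move: (Qprod n x) (Qprod n (g x)) (J n x) (J n (g x)) (Rpos_val t) => a b c e u b0 a0 e0 c0.
by field; rewrite !gt_eqF.
Qed.

Local Open Scope ereal_scope.

(** For each g in the group, almost every p is identified with its lift by some power of the
    extended shift, so [A] is almost invariant under each lift. As the group is countable, [A] can
    be made strictly invariant, as [erg] requires. *)
Lemma shift_ext_exact A : measurable A ->
  (forall n, exists2 B, measurable B &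
    {ae (mu \x kappa), forall p, A p = B (iter n shift_ext p)}) ->
  null_or_conull (mu \x kappa) A.
Proof.
move=> mA tailA.
have [Dcoc [G [[cG Gid Gcomp Ginv mG] SG nsG RNG]]] := Delta_RN.
have Sg g x : G g -> S x (g x) by move=> Gg; apply/SG; exists g.
have nsg g : G g -> nonsingular mu mu g.
  move=> Gg; split; first exact: mG.
  move=> N mN N0; have [g' Gg' [gK g'K]] := Ginv g Gg.
  have -> : g @^-1` N = g' @` N.
    apply/seteqP; split => [x Nx|_ [y Ny <-]]; last by rewrite /preimage/= g'K.
    by exists (g x).
  have [H _] := nsG g' Gg'.
  by apply: (proj1 (null_content_dominatesP _ mu) H).
have mratio g : G g -> measurable_fun setT (fun x => ratio x (g x)).
  move=> Gg; apply: measurable_to_Rpos.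
  apply: measurable_funM.
    apply: measurableT_comp (@measurable_Rpos_val R) _.
    by have [] := RNG g Gg.
  apply: measurable_fun_posV; first by move=> x; apply: delta_gt0; exact: Sg.
  by apply: measurable_delta; [exact: mG|move=> x; exact: Sg].
have nslift g : G g -> nonsingular (mu \x kappa) (mu \x kappa) (lift g).
  move=> Gg; apply: skew_nonsingular; [exact: mG|exact: mratio| |exact: nsg].
  exact: maharam_quasi_invariant.
have mlift g : G g -> measurable_fun setT (lift g) by move=> /nslift[].
have Alift g : G g -> {ae (mu \x kappa), forall p, A (lift g p) = A p}.
  move=> Gg; have [g' Gg' [gK g'K]] := Ginv g Gg.
  have /choice[B HB] : forall n, exists B, measurable B /\
      {ae (mu \x kappa), forall p, A p = B (iter n shift_ext p)}.
    by move=> n; have [B mB AB] := tailA n; exists B.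
  have AB : {ae (mu \x kappa), forall p n, A p = B n (iter n shift_ext p)}.
    by apply: ae_foralln => n; case: (HB n).
  have [mDg DgE] := RNG g Gg.
  have := cocycle_density lam_gt0 P_gt0 mu_markov mrho rhoE gK g'K (mG _ Gg)
    (mG _ Gg') mDg DgE.
  move=> /(ae_fst kappa) dens.
  have AB' := nonsingular_ae (nslift g Gg) AB.
  move: dens AB AB'; apply: filterS3 => -[x t] /= dens AB AB'.
  have [n xg] := Sg g x Gg.
  have E : iter n shift_ext (lift g (x, t)) = iter n shift_ext (x, t).
    exact: iter_lift xg (dens n xg).
  by rewrite (AB n) (AB' n) E.
have [f finj] := countable_injP _ cG.
(* The preimages of [A] under all lifts, enumerated through the injection [f] of the group into the
   naturals. *)
pose A' := \bigcap_k [set p | forall g, G g -> f g = k -> A (lift g p)].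
have unique k : (forall g, G g -> f g <> k) \/
    (exists2 g, G g & forall h, G h -> f h = k <-> h = g).
  have [[g [Gg fg]]|H] := pselect (exists g, G g /\ f g = k); [right|left].
    exists g => // h Gh; split => [fh|->//].
    by apply: finj; rewrite ?inE// fg.
  by move=> g Gg fg; apply: H; exists g.
have mA' : measurable A'.
  apply: bigcapT_measurable => k; have [H|[g Gg H]] := unique k.
    rewrite (_ : [set p | _] = setT)//; apply/seteqP; split => // p _ g Gg fg.
    by have := H g Gg.
  rewrite (_ : [set p | _] = lift g @^-1` A).
    exact: measurable_preimage (mlift g Gg) mA.
  apply/seteqP; split => [p /= Hp|p Ap h Gh /(H h Gh) ->//].
  by apply: Hp => //; apply/H.
have AA' : {ae (mu \x kappa), forall p, A' p = A p}.
  have : {ae (mu \x kappa), forall p k g, G g -> f g = k -> A (lift g p) = A p}.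
    apply: ae_foralln => k; have [H|[g Gg H]] := unique k.
      by apply: aeW => p g Gg /(H g Gg).
    by move: (Alift g Gg); apply: filterS => p Ap h Gh /(H h Gh) ->.
  apply: filterS => p H; apply/propext; split => [A'p|Ap k _ g Gg fg].
    by rewrite -(H _ _ Gid erefl); exact: (A'p (f id) Logic.I).
  by rewrite (H k).
(* [erg] decides with [chi] whether a set is null; the comparison of null sets on the fibres passes
   to [kappa]. *)
have chi_kappa B : measurable B -> (mu \x chi) B = 0 -> (mu \x kappa) B = 0.
  move=> mB /(product_measure0E _ _ mB) H; apply/(product_measure0E _ _ mB).
  move: H; apply: filterS => x /= H.
  have [_ _ chi0] := hchi.
  apply: (quasi_invariant_dominates (haar_quasi_invariant hchi)
    (maharam_quasi_invariant hkappa) chi0 _ H).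
  exact: measurable_xsection.
have invA' p q : S p.1 q.1 /\ (Rpos_val q.2 =
    Rpos_val (Delta p.1 q.1) / delta p.1 q.1 * Rpos_val p.2)%R -> A' p -> A' q.
  case: p q => [x t] [y s] /= [Sxy sE] A'p k _ g Gg _.
  have [h Gh yE] := (SG x y).1 Sxy.
  (* With y = h x, this is the cocycle identity of Delta / delta. *)
  have <- : lift (g \o h) (x, t) = lift g (y, s).
    have -> : lift (g \o h) (x, t) = (g y, Rpos_mul (ratio x (g y)) t).
      by rewrite yE.
    have -> : lift g (y, s) = (g y, Rpos_mul (ratio y (g y)) s) by [].
    apply: (congr1 (pair _)); apply: Rpos_val_inj.
    rewrite [LHS]Rpos_val_mul [RHS]Rpos_val_mul sE.
    have Sygy : S y (g y) by exact: Sg.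
    have Sxgy : S x (g y) by rewrite yE; exact: (Sg (g \o h) x (Gcomp _ _ Gg Gh)).
    rewrite (ratioE Sxgy) (ratioE Sygy) (Dcoc x y (g y) Sxy Sygy).
    rewrite (delta_mul Sxy Sygy) [in LHS]Rpos_val_mul.
    have := delta_gt0 Sxy; have := delta_gt0 Sygy.
    move: (delta x y) (delta y (g y)) (Rpos_val _) (Rpos_val _) (Rpos_val _).
    move=> a b c e u b0 a0.
    by field; rewrite !gt_eqF.
  by apply: (A'p (f (g \o h)) Logic.I) => //; exact: Gcomp.
have mAC : measurable (~` A) by exact: measurableC.
have mA'C : measurable (~` A') by exact: measurableC.
case: (erg mA' invA') => [/(chi_kappa _ mA')|/(chi_kappa _ mA'C)] A'0; [left|right].
  transitivity ((mu \x kappa) A'); last exact: A'0.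
  apply: measure_ae mA mA' _.
  by move: AA'; apply: filterS => p ->.
transitivity ((mu \x kappa) (~` A')); last exact: A'0.
apply: measure_ae mAC mA'C _.
by move: AA'; apply: filterS => p pE; rewrite /setC/= pE.
Qed.

End exactness.

(** * The Maharam extension of the two-sided shift *)

Lemma fiber_scale (R : realType) (kappa : {measure set (Rpos R) -> \bar R}) s B :
  is_maharam_fiber kappa -> measurable B ->
  (kappa (Rpos_mul s @^-1` B) = (Rpos_val s)%:E * kappa B)%E.
Proof.
move=> [_ inv] mB; rewrite -{1}(Rpos_invK s) -dilateE inv//.
by rewrite Rpos_val_inv invrK.
Qed.

Lemma cancel_image (X Y : Type) (f : X -> Y) g (A : set X) :
  cancel f g -> cancel g f -> f @` A = g @^-1` A.
Proof.
move=> fK gK; apply/seteqP; split => [_ [x Ax <-]|y Ay] /=; first by rewrite fK.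
by exists (g y).
Qed.

(** * Invertible maps with a density, and invariance of the product measure *)

Section invertible_density.
Context d (X : measurableType d) (R : realType).
Context (m : {sigma_finite_measure set X -> \bar R}).
Context (T Ti : X -> X) (w : X -> Rpos R).
Hypotheses (TK : cancel T Ti) (TiK : cancel Ti T).
Hypotheses (mT : measurable_fun setT T) (mTi : measurable_fun setT Ti).
Hypothesis wT : is_RN_derivative (direct_image m T) m w.
Local Open Scope ereal_scope.

Let mw : measurable_fun setT w. Proof. by case: wT. Qed.

Let TE A : T @` A = Ti @^-1` A. Proof. exact: cancel_image. Qed.

Let wE A : measurable A -> m (Ti @^-1` A) = \int[m]_(x in A) (Rpos_val (w x))%:E.
Proof. by move=> mA; rewrite -TE; exact: (proj2 wT). Qed.

Lemma RN_nonsingular_inv : nonsingular m m Ti.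
Proof.
split => // N mN N0; rewrite wE//.
by apply: null_set_integral => //; apply: measurable_funTS; exact: measurable_Rpos_valE.
Qed.

Lemma RN_nonsingular : nonsingular m m T.
Proof.
split => // N mN N0.
have mTN : measurable (T @^-1` N) by exact: measurable_preimage.
have := wE mTN; rewrite -comp_preimage (_ : T \o Ti = id); last first.
  by apply/funext => x /=; rewrite TiK.
rewrite preimage_id N0 => /esym I0.
have mwE : measurable_fun (T @^-1` N) (fun x => (Rpos_val (w x))%:E).
  by apply: measurable_funTS; exact: measurable_Rpos_valE.
have [+ _] := ae_eq_integral_abs m mTN mwE.
move=> H; have {}H := H _; apply/(@ae_measure0 _ _ _ m _ mTN).
have : {ae m, forall x, (T @^-1` N) x -> (Rpos_val (w x))%:E = 0}.
  apply: H; rewrite -[RHS]I0; apply: eq_integral => x _.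
  by rewrite gee0_abs// Rpos_valE_ge0.
apply: filterS => x Hx Nx; have [] := Hx Nx.
by apply/eqP; rewrite gt_eqF// Rpos_val_gt0.
Qed.

Lemma RN_invertible_nonsingular : invertible_nonsingular m T.
Proof.
split.
- by exists Ti.
- exact: mT.
- by move=> A mA; rewrite TE; exact: measurable_preimage.
- split => A A0 B mB BA; rewrite /direct_image.
    have [_ H] := RN_nonsingular_inv; rewrite TE; apply: H => //; exact: A0.
  have [_ H] := RN_nonsingular.
  have := A0 B mB BA; rewrite /direct_image => mTB.
  have -> : B = T @^-1` (T @` B) by rewrite TE -comp_preimage (_ : Ti \o T = id)//;
    apply/funext => x /=; rewrite TK.
  by apply: H => //; rewrite TE; exact: measurable_preimage.
Qed.

Context (kappa : {sigma_finite_measure set (Rpos R) -> \bar R}).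
Hypothesis hkappa : is_maharam_fiber kappa.

(** The preimage of a fibre set under multiplication by w(x) has [kappa]-measure multiplied by w(x).
    As w is the density of m o T, integrating over x undoes the change of base point. *)
Lemma maharam_preserving A : measurable A ->
  (m \x kappa) (skew_product T w @^-1` A) = (m \x kappa) A.
Proof.
move=> mA; rewrite /product_measure1.
pose h x := kappa (xsection A x).
have mh : measurable_fun setT h by exact: measurable_fun_xsection.
have h0 x : 0 <= h x by exact: measure_ge0.
have mhT : measurable_fun setT (h \o T) by exact: measurableT_comp mh mT.
transitivity (\int[m]_x (h (T x) * (Rpos_val (w x))%:E)).
  apply: eq_integral => x _; rewrite [LHS]/=.
  transitivity (kappa (Rpos_mul (w x) @^-1` xsection A (T x))).
    by congr (kappa _); exact: xsection_skew.
  rewrite fiber_scale//; first by rewrite muleC.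
  exact: measurable_xsection.
rewrite -(@integral_density _ _ _ m (image_measure m mTi) (fun x => Rpos_val (w x)) _ _ _ (h \o T))//.
- transitivity (\int[m]_x (h \o T) (Ti x)).
    by apply/esym; apply: preserving_integral => // x; exact: h0.
  by apply: eq_integral => x _ /=; rewrite TiK.
- exact: measurableT_comp (@measurable_Rpos_val R) mw.
- by move=> x; rewrite ltW// Rpos_val_gt0.
Qed.

End invertible_density.

Lemma RN_derivative_unique d (X : measurableType d) (R : realType)
    (m : {measure set X -> \bar R}) (m' : set X -> \bar R) (w1 w2 : X -> Rpos R) :
  is_RN_derivative m' m w1 -> is_RN_derivative m' m w2 -> (m' setT < +oo)%E ->
  {ae m, forall x, w1 x = w2 x}.
Proof.
move=> [mw1 w1E] [mw2 w2E] m'oo.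
have : ae_eq m setT (fun x => (Rpos_val (w1 x))%:E) (fun x => (Rpos_val (w2 x))%:E).
  apply: integral_ae_eq => //.
  - apply/integrableP; split; first exact: measurable_Rpos_valE.
    under eq_integral do rewrite gee0_abs ?Rpos_valE_ge0//.
    by rewrite -w1E.
  - exact: measurable_Rpos_valE.
  - by move=> A _ mA; rewrite -w1E// -w2E.
by apply: filterS => x /(_ Logic.I)[] /Rpos_val_inj.
Qed.

(** The property does not involve the coordinate in [Y]; as [k] is nonzero, Fubini leaves at least
    one value of it outside the exceptional set. *)
Lemma ae_drop_fiber d d' d'' (X : measurableType d) (Y : measurableType d')
    (Z : measurableType d'') (R : realType)
    (m : {sigma_finite_measure set X -> \bar R})
    (k : {sigma_finite_measure set Y -> \bar R})
    (rho : {sigma_finite_measure set Z -> \bar R}) (P : X * Z -> Prop) :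
  (0 < k setT)%E -> measurable [set p | P p] ->
  {ae (sigma_finite_prod m k \x rho)%E, forall p, P (p.1.1, p.2)} ->
  {ae (m \x rho)%E, forall p, P p}.
Proof.
move=> k0 mP /ae_prodCW H; apply: ae_prodCP => //.
move: H; apply: filterS => z /(@ae_prodCW _ _ _ _ _ m k) /= H.
have [N [mN N0 HN]] := H.
have [y Ny] : exists y, ~ N y.
  apply: contrapT => /forallNP nN.
  have NT : N = setT by apply/seteqP; split => // y _; exact: contrapT (nN y).
  by move: k0; rewrite -NT N0 ltxx.
by apply: contrapT => nP; exact/Ny/HN.
Qed.

Section generators.
Context (R : realType).

Let G : set (set (bitspace int * Rpos R)) :=
  [set g | (exists i, g = [set x : bitspace int | x i : bool] `*` setT) \/
           (exists2 C, measurable C & g = setT `*` C)].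

Lemma bitspace_prod_generated : @measurable _ (bitspace int * Rpos R)%type = <<s G >>.
Proof.
apply/seteqP; split => A mA; last first.
  have sG : sigma_algebra setT (@measurable _ (bitspace int * Rpos R)%type).
    by split; [exact: measurable0|move=> B mB; rewrite setTD; exact: measurableC|exact: bigcupT_measurable].
  apply: (smallest_sub sG) mA => _ [[i ->]|[C mC ->]]; last exact: measurableX.
  by apply: measurableX => //; exact: bit_measurable i true.
pose Y := g_sigma_algebraType G.
have mY g : G g -> @measurable _ Y g by move=> Gg; exact: sub_sigma_algebra.
have mfst : measurable_fun setT (fun y : Y => y.1 : bitspace int).
  apply: measurable_fun_bitspace => i.
  apply: mY; left; exists i.
  by apply/seteqP; split => // -[x t] [].
have msnd : measurable_fun setT (fun y : Y => y.2 : Rpos R).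
  move=> _ C mC; rewrite setTI; apply: mY; right; exists C => //.
  by apply/seteqP; split => // -[x t] [].
have := measurable_fun_pair mfst msnd.
rewrite (_ : (fun y : Y => (y.1, y.2)) = id); last by apply/funext => -[].
by move=> /(_ measurableT A mA); rewrite setTI preimage_id.
Qed.

End generators.

Lemma iter_shift2 n x i : iter n shift2 x i = x (i + n%:Z).
Proof.
elim: n x => [|n IH] x; first by rewrite addr0.
by rewrite iterSr IH /shift2; congr (x _); lia.
Qed.

(** * The Maharam extension of the natural extension *)

Section natural_extension.
Context (R : realType) (lam : bool -> R) (P : nat -> bool -> bool -> R).
Context (mu : probability (bitspace nat) R) (mut : probability (bitspace int) R).
Context (chi kappa : {sigma_finite_measure set (Rpos R) -> \bar R}).
Context (Delta : bitspace nat -> bitspace nat -> Rpos R).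
Hypothesis shift_mu : nonsingular_markov_shift lam P mu.
Hypothesis mut_markov : natural_extension_measure lam P mut.
Hypotheses (hchi : is_haar chi) (hkappa : is_maharam_fiber kappa).
Hypothesis Delta_RN : is_RN_cocycle (tail_equivalent shift1) mu Delta.
Hypothesis erg : cocycle_ergodic chi mu (tail_equivalent shift1)
  (fun x y => Rpos_val (Delta x y) / delta_cocycle lam P x y).
Local Open Scope ereal_scope.

Let Pstoch n : stochastic (P n). Proof. by case: shift_mu => -[]. Qed.
Let mu_markov : markov_measure lam P mu. Proof. by case: shift_mu. Qed.
Let lam_gt0 a : (0 < lam a)%R. Proof. by case: shift_mu => _ _ []. Qed.
Let P_gt0 n a b : (0 < P n a b)%R. Proof. by case: shift_mu => _ _ []. Qed.

Context (rho : bitspace nat -> Rpos R).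
Hypothesis mrho : measurable_fun setT rho.
Hypothesis rhoE : forall A, measurable A ->
  mu A = \int[image_measure mu measurable_shift1]_(x in A) (Rpos_val (rho x))%:E.

Let w0 x : Rpos R := rho (shift1 (future x)).

Let w0P : is_RN_derivative (direct_image mut shift2) mut w0.
Proof.
split => [|A mA].
  apply: measurableT_comp mrho _.
  exact: measurableT_comp measurable_shift1 measurable_future.
exact: (natural_extension_density Pstoch lam_gt0 P_gt0 mu_markov mut_markov mrho rhoE).
Qed.

Let w := omega mut shift2.

Let wP : is_RN_derivative (direct_image mut shift2) mut w.
Proof.
apply: (@xgetPex _ _ [set w | is_RN_derivative (direct_image mut shift2) mut w]).
by exists w0.
Qed.

Let mw : measurable_fun setT w. Proof. by case: wP. Qed.

(** [maharam] uses the version picked by [omega], which need not depend on the future only; it does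
    so almost everywhere. *)
Let w_w0 : {ae mut, forall x, w x = w0 x}.
Proof.
apply: RN_derivative_unique wP w0P _; rewrite /direct_image.
rewrite (cancel_image _ shift2K unshift2K) preimage_setT.
by rewrite [X in X < _](@probability_setT _ _ _ mut) ltry.
Qed.

Let S := maharam mut shift2.
Let Si := skew_inv unshift2 w.
Let nu := sigma_finite_prod mut kappa.
Let nu0 := sigma_finite_prod mu kappa.
Let T0 := shift_ext rho.
Let p : bitspace int * Rpos R -> bitspace nat * Rpos R := map_pair future id.

Let mS : measurable_fun setT S.
Proof. exact: measurable_skew measurable_shift2 mw. Qed.

Let SK : cancel S Si. Proof. exact: skewK shift2K. Qed.
Let SiK : cancel Si S. Proof. exact: skew_invK unshift2K. Qed.

Let mSi : measurable_fun setT Si.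
Proof. exact: measurable_skew_inv measurable_unshift2 mw. Qed.

Let S_pres A : measurable A -> nu (S @^-1` A) = nu A.
Proof.
exact: (maharam_preserving shift2K unshift2K measurable_shift2 measurable_unshift2 wP hkappa).
Qed.

Let mT0 : measurable_fun setT T0. Proof. exact: measurable_shift_ext. Qed.

Let mp : measurable_fun setT p.
Proof. exact: measurable_map_pair measurable_future (@measurable_id _ _ _). Qed.

Let p_pres A : measurable A -> nu (p @^-1` A) = nu0 A.
Proof.
move=> mA; apply: preserving_prod => //; first exact: measurable_future.
move=> B mB; exact: (future_pres Pstoch lam_gt0 P_gt0 mu_markov mut_markov mB).
Qed.

Let pS : {ae nu, forall y, p (S y) = T0 (p y)}.
Proof.
have := ae_fst kappa w_w0; apply: filterS => -[x t] /= E.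
by rewrite /p /map_pair /S /maharam/= future_shift2 -/w E.
Qed.

Let G : set (set (bitspace int * Rpos R)) :=
  [set g | (exists i, g = [set x : bitspace int | x i : bool] `*` setT) \/
           (exists2 C, measurable C & g = setT `*` C)].

Let gensF g : G g -> exists n B, measurable B /\
  {ae nu, forall y, g (iter n S y) = B (p y)}.
Proof.
case=> [[i ->]|[C mC ->]].
  (* |i| + 1 shifts bring the letter at i + |i| + 1 >= 1 to position i, and [future] reads that
     letter at index i + |i|. *)
  exists (`|i|.+1)%N.
  exists ([set z : bitspace nat | z `|(i + `|i|%:Z)%R|%N] `*` setT); split.
    apply: measurableX => //; exact: (bit_measurable _ true).
  apply: aeW => -[x t]; set n := `|i|.+1.
  have E : (iter n S (x, t)).1 i = future x `|(i + `|i|%:Z)%R|%N.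
    rewrite /S /maharam iter_skew1 iter_shift2 /future /n; congr (x _); lia.
  by clearbody n; apply/propext; rewrite /setX/= E.
exists 0%N, (setT `*` C); split; first exact: measurableX.
by apply: aeW => -[x t].
Qed.

Let exactT0 A : measurable A ->
  (forall n, exists2 B, measurable B & {ae nu0, forall y, A y = B (iter n T0 y)}) ->
  null_or_conull nu0 A.
Proof.
move=> mA; exact: (shift_ext_exact lam_gt0 P_gt0 mu_markov mrho rhoE hchi hkappa Delta_RN erg mA).
Qed.

Lemma natural_extension_K : K_automorphism nu S.
Proof.
exact: (exact_factor_K_automorphism (product_sigma_finite mu kappa)
  SK SiK mS mSi S_pres mT0 mp p_pres pS
  (bitspace_prod_generated R) gensF exactT0).
Qed.

Hypothesis consT : conservative mut shift2.

Let maharam_null W : measurable W -> wandering S W -> nu W = 0.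
Proof.
move=> mW wW.
apply: (@maharam_conservative _ _ _ mut kappa shift2 unshift2 w shift2K unshift2K
  measurable_unshift2 _ _ _ mw _ S_pres consT W mW wW).
- exact: RN_nonsingular shift2K unshift2K measurable_shift2 wP.
- exact: RN_nonsingular_inv shift2K unshift2K measurable_unshift2 wP.
- by rewrite [X in X < _](@probability_setT _ _ _ mut) ltry.
- by move=> c c0; exact: (maharam_fiber_tail_finite hchi hkappa c0).
Qed.

Let recS E : measurable E ->
  {ae nu, forall y, E y -> forall m, exists2 n, (m <= n)%N & E (iter n Si y)}.
Proof.
move=> mE; have noW W : measurable W -> wandering S W -> nu W = 0.
  exact: maharam_null.
exact: (conservative_recurrent SK mSi S_pres mE noW).
Qed.
Let nu0_gt0 : 0 < nu0 setT.
Proof.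
rewrite -setXTT (_ : nu0 _ = mu setT * kappa setT); last first.
  exact: product_measure1E.
by rewrite [X in X * _](@probability_setT _ _ _ mu) mul1e; exact: maharam_fiber_neq0.
Qed.

Lemma natural_extension_product_ergodic d' (Z : measurableType d')
    (r : probability Z R) (U : Z -> Z) :
  measurable_fun setT U -> (forall A, measurable A -> r (U @^-1` A) = r A) ->
  ergodic r U ->
  forall A, measurable A -> (forall x, A (S x.1, U x.2) = A x) ->
  null_or_conull (nu \x r) A.
Proof.
move=> mU U_pres ergU A mA AQ.
exact: (@invariant_null_or_conull _ _ _ _ _ _ _ nu nu0 r S Si T0 p U _ SK mS mSi
  S_pres mT0 mp p_pres pS (bitspace_prod_generated R) gensF exactT0 recS mU U_pres
  (@probability_setT _ _ _ r) ergU nu0_gt0 A mA AQ).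
Qed.

Lemma natural_extension_weakly_mixing : weakly_mixing mut shift2.
Proof.
move=> d' Z r U mU U_pres ergU A mA AU.
pose L := [set q : (bitspace int * Rpos R) * Z | A (q.1.1, q.2)].
have mL : measurable L.
  rewrite (_ : L = (fun q : (bitspace int * Rpos R) * Z => (q.1.1, q.2)) @^-1` A)//.
  apply: measurable_preimage mA; apply: measurable_fun_pair => //.
  exact: measurableT_comp measurable_fst measurable_fst.
have LQ x : L (S x.1, U x.2) = L x.
  by rewrite /L/= -[in RHS]AU.
have k0 := maharam_fiber_neq0 hkappa.
have := natural_extension_product_ergodic mU U_pres ergU mL LQ.
move=> /(null_or_conullP _ mL) H; apply/(null_or_conullP _ mA).
case: H => H; [left|right].
  by apply: (ae_drop_fiber (k := kappa)) => //; exact: measurableC.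
exact: (ae_drop_fiber (k := kappa)).
Qed.

Lemma natural_extension_type_III1 : type_III1 kappa mut shift2.
Proof.
split.
  exact: RN_invertible_nonsingular shift2K unshift2K measurable_shift2 measurable_unshift2 wP.
move=> A mA AS.
have d0 (N : set unit) : ~ N tt -> \d_tt N = 0 :> \bar R.
  by move=> Ntt; rewrite diracE memNset.
have erg1 : ergodic (\d_tt : probability unit R) id.
  move=> B mB _; have [Btt|Btt] := pselect (B tt).
    by right; exact: (d0 (~` B) (fun nB => nB Btt)).
  by left; exact: (d0 _ Btt).
have AQ (x : (bitspace int * Rpos R) * unit) : (A `*` setT) (S x.1, id x.2) = (A `*` setT) x.
  by rewrite /setX/= -[in RHS]AS.
have mAT : measurable (A `*` [set: unit]) by exact: measurableX.
have := natural_extension_product_ergodic (@measurable_id _ _ _) (fun _ _ => erefl) erg1 mAT AQ.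
move=> /(null_or_conullP _ mAT) H; apply/(null_or_conullP _ mA).
have dae (Q : unit -> Prop) : {ae (\d_tt : probability unit R), forall z, Q z} -> Q tt.
  move=> [N [_ N0 QN]]; apply: contrapT => nQ.
  have Ntt : N tt by exact: QN.
  have N1 : \d_tt N = 1 :> \bar R by rewrite diracE mem_set.
  have : (1 : \bar R) = 0 := etrans (esym N1) N0.
  by move=> /eqP; rewrite eqe oner_eq0.
case: H => /ae_prodCW/dae H; [left|right].
  by move: H; apply: filterS => x /= nAx Ax; exact: nAx.
by move: H; apply: filterS => x [].
Qed.

End natural_extension.


Theorem theorem7p5 (R : realType)
    (lam : bool -> R) (P : nat -> bool -> bool -> R)
    (mu : probability (bitspace nat) R)
    (mut : probability (bitspace int) R)
    (chi kappa : {sigma_finite_measure set (Rpos R) -> \bar R})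
    (Delta : bitspace nat -> bitspace nat -> Rpos R) :
  nonsingular_markov_shift lam P mu ->
  natural_extension_measure lam P mut ->
  is_haar chi ->
  is_maharam_fiber kappa ->
  is_RN_cocycle (tail_equivalent shift1) mu Delta ->
  cocycle_ergodic chi mu (tail_equivalent shift1)
    (fun x y => Rpos_val (Delta x y) / delta_cocycle lam P x y) ->
  K_automorphism (mut \x kappa)%E (maharam mut shift2) /\
  (conservative mut shift2 ->
     weakly_mixing mut shift2 /\ type_III1 kappa mut shift2).
Proof.
move=> shift_mu mut_markov hchi hkappa Delta_RN erg.
have [_ _ _ _ mu_equiv] := shift_mu.
have [rho [mrho rhoE]] := image_shift_density mu_equiv.
split; first exact: (natural_extension_K shift_mu mut_markov hchi hkappa
  Delta_RN erg mrho rhoE).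
move=> consT; split.
  exact: (natural_extension_weakly_mixing shift_mu mut_markov hchi hkappa
    Delta_RN erg mrho rhoE consT).
exact: (natural_extension_type_III1 shift_mu mut_markov hchi hkappa
  Delta_RN erg mrho rhoE consT).
Qed.
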